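(* There is a fixed-parameter algorithm for the special case of SMC in which each woman finds at most two men acceptable (i.e., $\Delta_{\mathcal W}\le 2$), with parameter $|\mathcal W^\star_0|+|\mathcal M^\star_0|$, the number of distinguished women and men left unmatched by a stable matching. That is, the algorithm computes a feasible matching with the minimum number of blocking pairs (or reports that none exists) in time $f(|\mathcal W^\star_0|+|\mathcal M^\star_0|)\cdot|I|^{O(1)}$ for some computable function $f$.
   Context: An instance $I$ of Stable Marriage with Covering Constraints (SMC) consists of a finite set $\mathcal M$ of men, a finite set $\mathcal W$ of women, for each person $x$ a preference list $L(x)$ strictly ordering a subset of the opposite sex (the persons acceptable to $x$), and subsets $\mathcal W^\star\subseteq\mathcal W$, $\mathcal M^\star\subseteq\mathcal M$ of distinguished persons. A matching is a set of disjoint man–woman pairs $\{m,w\}$ with $m$ and $w$ in each other's lists; $M(x)$ denotes the partner of $x$. A pair $\{m,w\}$ of mutually acceptable persons is blocking for $M$ if $m$ is unmatched or prefers $w$ to $M(m)$, and $w$ is unmatched or prefers $m$ to $M(w)$; a matching is stable if it has no blocking pair. A matching is feasible if it matches every person in $\mathcal W^\star\cup\mathcal M^\star$. $\Delta_{\mathcal W}$ is the maximum length of a woman's preference list. For a stable matching $M_s$ of $I$, $\mathcal W^\star_0$ and $\mathcal M^\star_0$ denote the distinguished women and men, respectively, unmatched by $M_s$ (these sets are the same for every stable matching). *)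

(* Defs.v *)
From mathcomp Require Import all_boot.

Set Implicit Arguments.
Unset Strict Implicit.
Unset Printing Implicit Defensive.

(** * Stable Marriage with Covering Constraints *)

(* Lists need not be symmetric: [w \in mpref m] does not imply [m \in wpref w];
   only mutually acceptable pairs may be matched or may block. *)
Record smc (M W : finType) := Smc {
  mpref : M -> seq W;
  wpref : W -> seq M;
  mpref_uniq : forall m, uniq (mpref m);
  wpref_uniq : forall w, uniq (wpref w);
  mstar : {set M};
  wstar : {set W}
}.

Definition prefers (T : eqType) (l : seq T) (x y : T) : bool :=
  [&& x \in l, y \in l & index x l < index y l].

Section Matchings.
Variables (M W : finType) (I : smc M W).
Implicit Types (X : {set M * W}) (m : M) (w : W).

Definition acceptable m w : bool := (w \in mpref I m) && (m \in wpref I w).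

Definition matching X : bool :=
  [forall p in X, acceptable p.1 p.2] &&
  [forall p in X, forall q in X,
     (p != q) ==> (p.1 != q.1) && (p.2 != q.2)].

Definition mpartner X m : option W := [pick w | (m, w) \in X].
Definition wpartner X w : option M := [pick m | (m, w) \in X].

Definition blocking X m w : bool :=
  [&& acceptable m w,
      (if mpartner X m is Some w' then prefers (mpref I m) w w' else true)
    & (if wpartner X w is Some m' then prefers (wpref I w) m m' else true)].

Definition blocking_pairs X : {set M * W} := [set p | blocking X p.1 p.2].

Definition stable X : bool := matching X && (blocking_pairs X == set0).

Definition feasible X : bool :=
  [&& matching X,
      [forall m in mstar I, mpartner X m != None]
    & [forall w in wstar I, wpartner X w != None]].

Definition optimal X : Prop :=
  feasible X /\
  forall Y, feasible Y -> #|blocking_pairs X| <= #|blocking_pairs Y|.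

Definition DeltaW : nat := \max_(w : W) size (wpref I w).

Definition mstar0 X : {set M} := [set m in mstar I | mpartner X m == None].
Definition wstar0 X : {set W} := [set w in wstar I | wpartner X w == None].

Definition solution (o : option (seq (M * W))) : Prop :=
  match o with
  | Some s => uniq s /\ optimal [set p in s]
  | None => forall X, ~~ feasible X
  end.

End Matchings.

(** * Model of computation: first-order functional programs on binary trees *)

Inductive tree : Type := Leaf | Node of tree & tree.

Fixpoint tree_size (t : tree) : nat :=
  if t is Node a b then (tree_size a + tree_size b).+1 else 1.

(* [Var i] is a de Bruijn index.  In [Case e e1 e2] the branch [e2] is taken
   when [e] is a [Node a b], with 0 bound to [a] and 1 to [b].  A program is a
   list of mutually recursive unary functions; [Call j e] invokes the [j]-th
   one, and execution starts with function 0 on the input. *)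
Inductive expr : Type :=
| Var of nat
| Let of expr & expr
| ELeaf
| ENode of expr & expr
| Case of expr & expr & expr
| Call of nat & expr.

Definition program := seq expr.

(* [eval P env e v t]: [e] evaluates to [v] in [t] steps, a step being the
   evaluation of one occurrence of a construct.  No construct copies, compares
   or measures a tree: with trees held as pointers to shared cells each step is
   a bounded number of pointer operations (environments have length bounded by
   the program text), so this measure and Turing machine time are polynomially
   related (Jones, Computability and Complexity, for the same kind of
   language). *)
Inductive eval (P : program) : seq tree -> expr -> tree -> nat -> Prop :=
| eval_var env i : eval P env (Var i) (nth Leaf env i) 1
| eval_let env e1 e2 v1 v2 t1 t2 :
    eval P env e1 v1 t1 -> eval P (v1 :: env) e2 v2 t2 ->
    eval P env (Let e1 e2) v2 (t1 + t2).+1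
| eval_leaf env : eval P env ELeaf Leaf 1
| eval_node env e1 e2 v1 v2 t1 t2 :
    eval P env e1 v1 t1 -> eval P env e2 v2 t2 ->
    eval P env (ENode e1 e2) (Node v1 v2) (t1 + t2).+1
| eval_case_leaf env e e1 e2 v t t1 :
    eval P env e Leaf t -> eval P env e1 v t1 ->
    eval P env (Case e e1 e2) v (t + t1).+1
| eval_case_node env e e1 e2 a b v t t2 :
    eval P env e (Node a b) t -> eval P (a :: b :: env) e2 v t2 ->
    eval P env (Case e e1 e2) v (t + t2).+1
| eval_call env j e a v t1 t2 :
    eval P env e a t1 -> eval P [:: a] (nth ELeaf P j) v t2 ->
    eval P env (Call j e) v (t1 + t2).+1.

Definition exec (P : program) (input output : tree) (t : nat) : Prop :=
  eval P [:: input] (nth ELeaf P 0) output t.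

Lemma eval_det P env e v t v' t' :
  eval P env e v t -> eval P env e v' t' -> v = v' /\ t = t'.
Proof.
move=> ev; elim: ev v' t' => {env e v t} [env i|env e1 e2 v1 v2 t1 t2 _ H1 _ H2
  |env|env e1 e2 v1 v2 t1 t2 _ H1 _ H2|env e e1 e2 v t t1 _ H1 _ H2
  |env e e1 e2 a b v t t2 _ H1 _ H2|env j e a v t1 t2 _ H1 _ H2] v' t' ev;
  inversion ev; subst=> //;
  do 2?match goal with
  | H : forall v t, eval _ _ _ v t -> _, H' : eval _ _ _ _ _ |- _ =>
      case: (H _ _ H') => E ?; clear H H'; first [discriminate E
        | injection E as ? ?; subst | subst]
  end; by [].
Qed.

(** * Encodings *)

Fixpoint code_nat (n : nat) : tree :=
  if n is n'.+1 then Node Leaf (code_nat n') else Leaf.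

Definition code_bool (b : bool) : tree := code_nat b.

Definition code_seq (T : Type) (c : T -> tree) (s : seq T) : tree :=
  foldr (fun x => Node (c x)) Leaf s.

Definition computable (f : nat -> nat) : Prop :=
  exists P : program, forall n, exists t,
    exec P (code_nat n) (code_nat (f n)) t.

(* Unary names cost at most a polynomial factor: a name is smaller than the
   number of persons, each of whom has an entry in the encoded instance. *)
Definition code_name (T : finType) (x : T) : tree := code_nat (enum_rank x).

Definition code_smc (M W : finType) (I : smc M W) : tree :=
  Node
    (code_seq (fun m => Node (code_bool (m \in mstar I))
                             (code_seq (@code_name W) (mpref I m))) (enum M))
    (code_seq (fun w => Node (code_bool (w \in wstar I))
                             (code_seq (@code_name M) (wpref I w))) (enum W)).

Definition code_output (M W : finType) (o : option (seq (M * W))) : tree :=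
  match o with
  | Some s => Node Leaf
      (code_seq (fun p => Node (code_name p.1) (code_name p.2)) s)
  | None => Leaf
  end.

(* Main.v *)
From Stdlib Require Import Classical.
Require Import Defs.
From mathcomp Require Import all_boot zify.

(* Fix a stable matching s. Every woman is acceptable to at most two men who
   accept her, so "the other man who can marry s(m)" is a function [nextm] of m,
   and an assignment p differs from s along paths and cycles of its graph: a man
   who leaves his woman makes room for the next one. A path starts at a man who
   takes a woman unmatched in s, or becomes single.
     Let p be feasible with the fewest blocking pairs and, among those, closest to
   s. By exchange arguments (reverting, shortening or rerouting a path cannot pay
   off), a path that starts with a distinguished woman stops at one of boundedly
   many places on the walk along [nextm], every cycle on which p differs from s is
   the one met next by such a path, and every other path ends at a distinguished
   man unmatched in s. Hence the first two kinds are described by a guess whose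
   size depends on the parameter k only. The remaining paths, at most k, fall into
   clusters closed under "a man on the path would rather have the unmatched woman
   at the start of that path". Clusters contribute independently to the number of
   blocking pairs, and a cluster is determined by its head; so each one may be
   replaced by the best cluster that serves the same men and avoids the women used
   elsewhere, of which at most k have to be named. The algorithm tries all guesses
   and keeps the best feasible result. That k does not depend on the choice of the
   stable matching is the rural hospitals theorem.
     For the running time, the polynomial-time functions are closed under
   composition and under folds with controlled growth. The list of guesses is not
   polynomial, but its cost is a computable function of k. *)

(** A woman given up by one man can be contested by only one other. So an exchange that releases one
    woman creates, in the situations considered, at most one new blocking pair, and it suffices to
    exhibit one that disappears. The count need not drop, hence the tie-break in minimality: the
    strict decrease of the distance to [s] yields the contradiction. The usual source of a
    disappearing pair is that being worse off than in [s] is passed on along a path as long as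
    nobody blocks with his own [s]-partner. The obstacle on the algorithmic side is that names of
    persons are not bounded by the parameter. A guess therefore consists only of positions in lists
    that the algorithm computes itself: options on a walk, marks on the men still to be served, and
    positions among the new women of the cluster that is currently best. Clusters are independent
    because a woman with admirers in two components of the graph of [nextm] is unmatched in [s];
    otherwise [nextm] would link the two men. The parameter-dependent factor must be computable, so
    costs are exact step counts, which the same language can compute. *)

Set Implicit Arguments.
Unset Strict Implicit.
Unset Printing Implicit Defensive.

(** * A combinator language compiled to programs *)

(* [Fold f] maps [(e, (a, l))] to the left fold of [(a, x) |-> f (e, (a, x))]
   over the list [l], started at [a]. *)
Inductive fn : Type :=
| Id | Lf | Fst | Snd
| Pr of fn & fn
| Cmp of fn & fn
| If of fn & fn & fn
| Fold of fn.

Definition tfst (t : tree) := if t is Node a _ then a else Leaf.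
Definition tsnd (t : tree) := if t is Node _ b then b else Leaf.

Fixpoint sem (f : fn) (x : tree) : tree :=
  match f with
  | Id => x
  | Lf => Leaf
  | Fst => tfst x
  | Snd => tsnd x
  | Pr f g => Node (sem f x) (sem g x)
  | Cmp g f => sem g (sem f x)
  | If c f g => if sem c x is Leaf then sem f x else sem g x
  | Fold f =>
    if x is Node e (Node a l) then
      (fix loop a l := if l is Node y l' then loop (sem f (Node e (Node a y))) l'
                       else a) a l
    else Leaf
  end.

(** The constants are the exact numbers of evaluation steps of the code emitted by [compile], so
    [comp_correct] needs no slack. *)
Fixpoint cost (f : fn) (x : tree) : nat :=
  match f with
  | Id => 1
  | Lf => 1
  | Fst => 3
  | Snd => 3
  | Pr f g => (cost f x + cost g x) + 5
  | Cmp g f => (cost f x + cost g (sem f x)) + 3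
  | If c f g => cost c x + (if sem c x is Leaf then cost f x else cost g x) + 5
  | Fold f =>
    if x is Node e (Node a l) then
      (fix loop a l :=
         if l is Node y l' then
           loop (sem f (Node e (Node a y))) l' + cost f (Node e (Node a y)) + 17
         else 7) a l
    else if x is Node e Leaf then 5 else 3
  end.

(** [sloop] and [cloop] name the anonymous loops inside [sem] and [cost], to which they are
    convertible, so that inductions over the list can be stated. *)
Definition sloop f e := fix loop a l :=
  if l is Node y l' then loop (sem f (Node e (Node a y))) l' else a.

Definition cloop f e := fix loop a l :=
  if l is Node y l' then
    loop (sem f (Node e (Node a y))) l' + cost f (Node e (Node a y)) + 17
  else 7.

Lemma cost_fold f e a l : cost (Fold f) (Node e (Node a l)) = cloop f e a l.
Proof. by []. Qed.

Fixpoint fsize (f : fn) : nat :=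
  match f with
  | Pr f g => (fsize f + fsize g).+1
  | Cmp f g => (fsize f + fsize g).+1
  | If c f g => (fsize c + (fsize f + fsize g)).+1
  | Fold f => (fsize f).+1
  | _ => 1
  end.

(** [n] is the address at which the code will be placed: function [n] is the entry point, the code
    of the subterms follows, and all calls are absolute. A [Fold] becomes a function that calls
    itself at [n]. *)
Fixpoint compile (f : fn) (n : nat) : seq expr :=
  match f with
  | Id => [:: Var 0]
  | Lf => [:: ELeaf]
  | Fst => [:: Case (Var 0) ELeaf (Var 0)]
  | Snd => [:: Case (Var 0) ELeaf (Var 1)]
  | Pr f g =>
    ENode (Call n.+1 (Var 0)) (Call (n.+1 + fsize f) (Var 0))
    :: compile f n.+1 ++ compile g (n.+1 + fsize f)
  | Cmp g f =>
    Call n.+1 (Call (n.+1 + fsize g) (Var 0))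
    :: compile g n.+1 ++ compile f (n.+1 + fsize g)
  | If c f g =>
    Case (Call n.+1 (Var 0)) (Call (n.+1 + fsize c) (Var 0))
         (Call (n.+1 + fsize c + fsize f) (Var 2))
    :: compile c n.+1 ++ compile f (n.+1 + fsize c) ++ compile g (n.+1 + fsize c + fsize f)
  | Fold f =>
    Case (Var 0) ELeaf (Case (Var 1) ELeaf (Case (Var 1) (Var 0)
      (Call n (ENode (Var 4)
         (ENode (Call n.+1 (ENode (Var 4) (ENode (Var 2) (Var 0)))) (Var 1))))))
    :: compile f n.+1
  end.

Lemma size_compile f n : size (compile f n) = fsize f.
Proof.
elim: f n => //= [f Hf g Hg|f Hf g Hg|c Hc f Hf g Hg|f Hf] n;
  by rewrite ?size_cat ?Hc ?Hf ?Hg.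
Qed.

Definition prog_at (P : program) n (L : seq expr) :=
  forall i, i < size L -> nth ELeaf P (n + i) = nth ELeaf L i.

Lemma prog_at_cons P n e L :
  prog_at P n (e :: L) -> nth ELeaf P n = e /\ prog_at P n.+1 L.
Proof.
move=> H; split; first by have := H 0 isT; rewrite addn0.
by move=> i Hi; have := H i.+1 Hi; rewrite addnS addSn.
Qed.

Lemma prog_at_cat P n L1 L2 :
  prog_at P n (L1 ++ L2) -> prog_at P n L1 /\ prog_at P (n + size L1) L2.
Proof.
move=> H; split=> i Hi.
  by have := H i; rewrite size_cat nth_cat Hi; apply; apply: ltn_addr.
have := H (size L1 + i); rewrite size_cat nth_cat ltn_add2l Hi => /(_ isT).
by rewrite ltnNge leq_addr /= addKn addnA.
Qed.

Lemma eval_time P env e v t t' : eval P env e v t -> t = t' -> eval P env e v t'.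
Proof. by move=> ? <-. Qed.

Lemma comp_correct f P n x :
  prog_at P n (compile f n) -> eval P [:: x] (nth ELeaf P n) (sem f x) (cost f x).
Proof.
elim: f P n x => [||||f Hf g Hg|g Hg f Hf|c Hc f Hf g Hg|f Hf] P n x /=
  /prog_at_cons [E].
- by move=> _; rewrite E; exact: (eval_var P [:: x] 0).
- by move=> _; rewrite E; constructor.
- move=> _; rewrite E; case: x => [|a b] /=.
    by apply: eval_time; first apply: eval_case_leaf;
      [exact: (eval_var P [:: Leaf] 0)|constructor|].
  apply: eval_time; first apply: eval_case_node.
  + exact: (eval_var P [:: Node a b] 0).
  + exact: (eval_var P [:: a; b; Node a b] 0).
  + by [].
- move=> _; rewrite E; case: x => [|a b] /=.
    by apply: eval_time; first apply: eval_case_leaf;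
      [exact: (eval_var P [:: Leaf] 0)|constructor|].
  apply: eval_time; first apply: eval_case_node.
  + exact: (eval_var P [:: Node a b] 0).
  + exact: (eval_var P [:: a; b; Node a b] 1).
  + by [].
- case/prog_at_cat; rewrite size_compile => /Hf{Hf} Hf /Hg{Hg} Hg; rewrite E.
  apply: eval_time.
    apply: eval_node.
      by apply: eval_call; [exact: (eval_var P [:: x] 0)|exact: Hf].
    by apply: eval_call; [exact: (eval_var P [:: x] 0)|exact: Hg].
  by rewrite /=; lia.
- case/prog_at_cat; rewrite size_compile => /Hg{Hg} Hg /Hf{Hf} Hf; rewrite E.
  apply: eval_time.
    apply: eval_call; last exact: Hg.
    by apply: eval_call; [exact: (eval_var P [:: x] 0)|exact: Hf].
  by rewrite /=; lia.
- case/prog_at_cat; rewrite size_compile => /Hc{Hc} Hc.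
  case/prog_at_cat; rewrite size_compile => /Hf{Hf} Hf /Hg{Hg} Hg; rewrite E.
  have {}Hc : eval P [:: x] (Call n.+1 (Var 0)) (sem c x) (1 + cost c x).+1.
    by apply: eval_call; [exact: (eval_var P [:: x] 0)|exact: Hc].
  case: (sem c x) Hc => [|a b] Hc.
    apply: eval_time; first apply: (eval_case_leaf _ Hc).
      by apply: eval_call; [exact: (eval_var P [:: x] 0)|exact: Hf].
    by rewrite /=; lia.
  apply: eval_time; first apply: (eval_case_node _ Hc).
    by apply: eval_call; [exact: (eval_var P [:: a; b; x] 2)|exact: Hg].
  by rewrite /=; lia.
- move=> /Hf{Hf} Hf.
  case: x => [|e [|a l]].
  + rewrite E; apply: eval_time.
      by apply: eval_case_leaf; [exact: (eval_var P [:: Leaf] 0)|constructor].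
    by [].
  + rewrite E; apply: eval_time.
      apply: eval_case_node; first exact: (eval_var P [:: Node e Leaf] 0).
      apply: eval_case_leaf; last by constructor.
      exact: (eval_var P [:: e; Leaf; Node e Leaf] 1).
    by [].
  elim: l a => [|y _ l IHl] a; rewrite E.
    apply: eval_time.
      apply: eval_case_node; first exact: (eval_var P [:: _] 0).
      apply: eval_case_node; first exact: (eval_var P [:: e; Node a Leaf; _] 1).
      apply: eval_case_leaf; first exact: (eval_var P [:: a; Leaf; _; _; _] 1).
      exact: (eval_var P [:: a; Leaf; _; _; _] 0).
    by [].
  set x := Node e _.
  apply: eval_time.
    apply: eval_case_node; first exact: (eval_var P [:: x] 0).
    apply: eval_case_node; first exact: (eval_var P [:: e; Node a (Node y l); _] 1).
    apply: eval_case_node; first exact: (eval_var P [:: a; Node y l; _; _; _] 1).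
    set env := [:: y; l; a; Node y l; e; Node a (Node y l); x].
    apply: eval_call; last by have := IHl (sem f (Node e (Node a y))); exact.
    apply: eval_node; first exact: (eval_var P env 4).
    apply: eval_node; last exact: (eval_var P env 1).
    apply: eval_call; last exact: Hf.
    apply: eval_node; first exact: (eval_var P env 4).
    apply: eval_node; first exact: (eval_var P env 2).
    exact: (eval_var P env 0).
  by rewrite /=; lia.
Qed.

Lemma exec_fn f x : exec (compile f 0) x (sem f x) (cost f x).
Proof. by apply: comp_correct. Qed.

Lemma tree_size_gt0 t : 0 < tree_size t.
Proof. by case: t. Qed.

(* Sharing at worst doubles the size of a tree at each step. *)
Lemma sem_size f x : tree_size (sem f x) <= tree_size x * 2 ^ cost f x.
Proof.
elim: f x => [||||f Hf g Hg|g Hg f Hf|c Hc f Hf g Hg|f Hf] x /=.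
- by rewrite leq_pmulr ?expn_gt0.
- by rewrite muln_gt0 tree_size_gt0 expn_gt0.
- by case: x => //= a b; nia.
- by case: x => //= a b; nia.
- have := Hf x; have := Hg x; have := tree_size_gt0 x.
  rewrite !expnD.
  have: 0 < 2 ^ cost f x by rewrite expn_gt0.
  have: 0 < 2 ^ cost g x by rewrite expn_gt0.
  move: (2 ^ cost f x) (2 ^ cost g x) (tree_size x) => u v k Hv Hu Hk.
  move: (tree_size _) (tree_size _) => m n Hm Hn; have -> : 2 ^ 5 = 32 by [].
  have H1 : k * u <= k * u * v by rewrite leq_pmulr.
  have H2 : k * v <= k * u * v by rewrite mulnAC leq_pmulr.
  have H3 : 0 < k * u * v by rewrite !muln_gt0 Hk Hu.
  have -> : k * (u * v * 32) = k * u * v * 32 by lia.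
  by move: (k * u * v) H1 H2 H3 => z ? ? ?; rewrite /=; lia.
- apply: leq_trans (Hg _) _; rewrite !expnD mulnA.
  have := Hf x; set A := tree_size x * _ => H.
  by rewrite mulnA; have -> : 2 ^ 3 = 8 by []; nia.
- have H n : n <= 2 ^ cost c x * n * 2 ^ 5.
    by rewrite mulnAC leq_pmull // muln_gt0 !expn_gt0.
  case E: (sem c x) => [|a b]; rewrite !expnD.
    by apply: leq_trans (Hf x) _; apply: leq_mul.
  by apply: leq_trans (Hg x) _; apply: leq_mul.
- case: x => [|e [|a l]] //=.
  have H : tree_size (sloop f e a l) <= (tree_size e + tree_size a + tree_size l).+2
       * 2 ^ cloop f e a l.
    elim: l a => [|y _ l IHl] a /=.
      by have -> : 2 ^ 7 = 128 by []; lia.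
    apply: leq_trans (IHl _) _.
    have := Hf (Node e (Node a y)); move: (sem f _) => a' /=.
    rewrite !expnD.
    have: 0 < 2 ^ cost f (Node e (Node a y)) by rewrite expn_gt0.
    move: (2 ^ cost f _) (2 ^ cloop f e a' l) => u v Hu.
    have -> : 2 ^ 17 = 131072 by [].
    move: (tree_size e) (tree_size a) (tree_size y) (tree_size l) (tree_size a').
    move=> E' A Y L A' HA'.
    set X := (E' + _ + _).+2; set Z := (E' + _ + _).+2.
    have HX : X <= 2 * (Z * u) by rewrite /X /Z; nia.
    have: X * v <= 2 * (Z * u) * v by rewrite leq_mul2r HX orbT.
    have -> : Z * (v * u * 131072) = (Z * u) * v * 131072 by lia.
    by move=> H; apply: leq_trans H _; rewrite -mulnA mulnC leq_mul2l orbT.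
  apply: leq_trans H _; rewrite -/(cloop f e a l) leq_mul2r; apply/orP; right.
  by rewrite /=; lia.
Qed.

Definition fnadd : fn := Cmp (Fold (Pr Lf (Cmp Fst Snd))) (Pr Lf Id).

Lemma sem_fnadd m n : sem fnadd (Node (code_nat m) (code_nat n)) = code_nat (m + n).
Proof.
rewrite /= ; elim: n m => [|n IHn] m; first by rewrite addn0.
by rewrite addnS -addSn -IHn.
Qed.

Fixpoint fnconst (t : tree) : fn :=
  if t is Node a b then Pr (fnconst a) (fnconst b) else Lf.

Lemma sem_fnconst t x : sem (fnconst t) x = t.
Proof. by elim: t => //= a -> b ->. Qed.

Fixpoint cconst (t : tree) : nat :=
  if t is Node a b then cconst a + cconst b + 5 else 1.

Lemma cost_fnconst t x : cost (fnconst t) x = cconst t.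
Proof. by elim: t => //= a -> b ->. Qed.

Definition fnk n : fn := fnconst (code_nat n).
Definition plus f g : fn := Cmp fnadd (Pr f g).

Lemma sem_plus f g x m n :
  sem f x = code_nat m -> sem g x = code_nat n -> sem (plus f g) x = code_nat (m + n).
Proof. by move=> Hf Hg; rewrite -sem_fnadd -Hf -Hg. Qed.

Lemma sem_fnk n x : sem (fnk n) x = code_nat n.
Proof. exact: sem_fnconst. Qed.

(** Instrumentation of a term with a step counter. It is needed because the factor in the final
    bound contains the time to list the guesses and has to be computable. *)
Lemma cost_computable f : exists g, forall x, sem g x = code_nat (cost f x).
Proof.
elim: f => [||||f [f' Hf] g [g' Hg]|g [g' Hg] f [f' Hf]
           |c [c' Hc] f [f' Hf] g [g' Hg]|f [f' Hf]].
- by exists (fnk 1) => x; rewrite sem_fnk.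
- by exists (fnk 1) => x; rewrite sem_fnk.
- by exists (fnk 3) => x; rewrite sem_fnk.
- by exists (fnk 3) => x; rewrite sem_fnk.
- exists (plus (plus f' g') (fnk 5)) => x.
  by apply: sem_plus (sem_fnk _ _); apply: sem_plus.
- exists (plus (plus f' (Cmp g' f)) (fnk 3)) => x.
  by apply: sem_plus (sem_fnk _ _); apply: sem_plus => //=.
- exists (plus (plus c' (If c f' g')) (fnk 5)) => x.
  by apply: sem_plus (sem_fnk _ _); apply: sem_plus => //=; case: (sem c x).
(* The loop state carries a counter next to the accumulator; [arg] removes it, so that [f] sees its
   usual argument. The counter starts at 7, the cost of the loop on the empty list. *)
pose arg := Pr Fst (Pr (Cmp Fst (Cmp Fst Snd)) (Cmp Snd Snd)).
pose body := Pr (Cmp f arg) (plus (plus (Cmp Snd (Cmp Fst Snd)) (Cmp f' arg)) (fnk 17)).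
pose main := Cmp Snd (Cmp (Fold body)
   (Pr Fst (Pr (Pr (Cmp Fst Snd) (fnk 7)) (Cmp Snd Snd)))).
exists (If Id (fnk 3) (If Snd (fnk 5) main)) => -[|e [|a l]] //.
rewrite cost_fold.
change (tsnd (sloop body e (Node a (code_nat 7)) l) = code_nat (cloop f e a l)).
(* For an arbitrary start [k] the final 7 must not be counted twice, hence the subtraction. *)
suff H k : tsnd (sloop body e (Node a (code_nat k)) l) = code_nat (k + cloop f e a l - 7).
  by rewrite H addKn.
elim: l a k => [|y _ l IHl] a k; first by rewrite /= addnK.
set z := Node e (Node (Node a (code_nat k)) y).
have Hb : sem body z
   = Node (sem f (Node e (Node a y))) (code_nat (k + cost f (Node e (Node a y)) + 17)).
  have E1 : sem (Cmp Snd (Cmp Fst Snd)) z = code_nat k by [].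
  have E2 : sem (Cmp f' arg) z = code_nat (cost f (Node e (Node a y))) by rewrite -Hf.
  by rewrite -(sem_plus (sem_plus E1 E2) (sem_fnk 17 z)).
rewrite [LHS]/(tsnd (sloop body e (sem body z) l)) Hb; apply: etrans (IHl _ _) _.
by congr code_nat; rewrite [cloop f e a (Node y l)]/= -/(cloop f e); lia.
Qed.

Arguments sloop : simpl never.
Arguments cloop : simpl never.

(** * Encoded types and polynomial-time functions *)

Class Enc (T : Type) := enc : T -> tree.
Arguments enc : simpl never.

#[global] Instance enc_nat : Enc nat := code_nat.
#[global] Instance enc_bool : Enc bool := code_bool.
(* Not an instance: unification would also find it for [bool]. *)
Definition enc_fin (T : finType) : Enc T := @code_name T.
#[global] Hint Extern 0 (Enc (Finite.sort ?T)) => exact (@enc_fin T) : typeclass_instances.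
#[global] Instance enc_prod A B {EA : Enc A} {EB : Enc B} : Enc (A * B) :=
  fun p => Node (enc p.1) (enc p.2).
#[global] Instance enc_seq A {EA : Enc A} : Enc (seq A) := code_seq enc.
#[global] Instance enc_option A {EA : Enc A} : Enc (option A) :=
  fun o => if o is Some x then Node Leaf (enc x) else Leaf.
#[global] Instance enc_smc (M W : finType) : Enc (smc M W) := @code_smc M W.

(** The successor makes sizes at least 2, so that constants and sums of powers are below a single
    power, and it makes [sz] additive on pairs and on [cons]. *)
Definition sz T {E : Enc T} (x : T) := (tree_size (enc x)).+1.

(* The witnesses [t] and [c] are arguments, so that one pair can serve all
   instances of a function that is polymorphic in the finite types [M], [W]. *)
Definition PT A B {EA : Enc A} {EB : Enc B} (t : fn) (c : nat) (f : A -> B) :=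
  forall x, [/\ sem t (enc x) = enc (f x), cost t (enc x) <= sz x ^ c
              & sz (f x) <= sz x ^ c].

Lemma sz_ge2 T {E : Enc T} (x : T) : 2 <= sz x.
Proof. by rewrite /sz ltnS tree_size_gt0. Qed.

Lemma leX s a m n : 2 <= s -> m <= n -> a <= s ^ m -> a <= s ^ n.
Proof. by move=> Hs Hmn H; apply: leq_trans H _; rewrite leq_exp2l. Qed.

Lemma addX s a b m n : 2 <= s -> a <= s ^ m -> b <= s ^ n -> a + b <= s ^ (m + n).+1.
Proof.
move=> Hs Ha Hb; rewrite expnS expnD.
have Hm : 0 < s ^ m by rewrite expn_gt0; case: s Hs {Ha Hb}.
have Hn : 0 < s ^ n by rewrite expn_gt0; case: s Hs {Ha Hb Hm}.
move: (s ^ m) (s ^ n) Ha Hb Hm Hn => x y Ha Hb Hm Hn.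
have : x + y <= 2 * (x * y) by nia.
move=> H; apply: leq_trans (leq_add Ha Hb) _; apply: leq_trans H _.
by rewrite leq_mul2r Hs orbT.
Qed.

Lemma mulX s a b m n : a <= s ^ m -> b <= s ^ n -> a * b <= s ^ (m + n).
Proof. by rewrite expnD; apply: leq_mul. Qed.

Lemma powX s a m n : a <= s ^ m -> a ^ n <= s ^ (m * n).
Proof. by rewrite expnM => H; case: n => // n; rewrite leq_exp2r. Qed.

Lemma kX s k : 2 <= s -> k <= s ^ k.
Proof.
by move=> Hs; apply: leq_trans (ltnW (ltn_expl k (ltnSn 1))) _; case: k => // k; rewrite leq_exp2r.
Qed.

(* The exponents are named, so that terms built by nested uses stay small. *)
Definition ccomp cf cg := cf + cf * cg + 6.
(** The language has no binder: the scrutinee is run twice, once for the test and once to hand its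
    content, next to the whole input, to the [Some] branch. *)
Definition topt to tg tf := If to tg (Cmp tf (Pr Id (Cmp Snd to))).
Definition copt co cg cf := co.+3 * cf.+3 + co + cg + 30.
Definition cfoldl ci cl cF d := ci + cl + cl + (1 + (d + cl)) * cF + 100 + d.
Definition cfoldl_add ci cl cF d := cfoldl ci cl cF (ci + (cl + (1 + cl) * d)).+1.

Section Closure.
Context {A B C D : Type} {EA : Enc A} {EB : Enc B} {EC : Enc C} {ED : Enc D}.

Lemma PT_ext (t : fn) c (f g : A -> B) : f =1 g -> PT t c f -> PT t c g.
Proof. by move=> E H x; rewrite -E. Qed.

Lemma PT_comp tf cf tg cg (f : A -> B) (g : B -> C) :
  PT tf cf f -> PT tg cg g -> PT (Cmp tg tf) (ccomp cf cg) (fun x => g (f x)).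
Proof.
rewrite /ccomp.
move=> Hf Hg x; have [Ef Cf Sf] := Hf x; have [Eg Cg Sg] := Hg (f x).
have Hs : 2 <= sz x by exact: sz_ge2.
have {}Cg := leq_trans Cg (powX cg Sf).
have {}Sg := leq_trans Sg (powX cg Sf).
split; rewrite /= ?Ef //.
  by apply: (leX Hs _ (addX Hs (addX Hs Cf Cg) (kX 3 Hs))); lia.
by apply: (leX Hs _ Sg); lia.
Qed.

Lemma PT_pair tf cf tg cg (f : A -> B) (g : A -> C) :
  PT tf cf f -> PT tg cg g -> PT (Pr tf tg) (cf + cg + 7) (fun x => (f x, g x)).
Proof.
move=> Hf Hg x; have [Ef Cf Sf] := Hf x; have [Eg Cg Sg] := Hg x.
have Hs : 2 <= sz x by exact: sz_ge2.
split; rewrite /= ?Ef ?Eg //.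
  by apply: (leX Hs _ (addX Hs (addX Hs Cf Cg) (kX 5 Hs))); lia.
rewrite /sz [tree_size _]/= -addSn -addnS.
by apply: (leX Hs _ (addX Hs Sf Sg)); lia.
Qed.

Lemma PT_cons tf cf tg cg (f : A -> B) (g : A -> seq B) :
  PT tf cf f -> PT tg cg g -> PT (Pr tf tg) (cf + cg + 7) (fun x => f x :: g x).
Proof.
move=> Hf Hg x; have [Ef Cf Sf] := Hf x; have [Eg Cg Sg] := Hg x.
have Hs : 2 <= sz x by exact: sz_ge2.
split; rewrite /= ?Ef ?Eg //.
  by apply: (leX Hs _ (addX Hs (addX Hs Cf Cg) (kX 5 Hs))); lia.
rewrite /sz [tree_size _]/= -addSn -addnS.
by apply: (leX Hs _ (addX Hs Sf Sg)); lia.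
Qed.

Lemma PT_id : PT Id 1 (fun x : A => x).
Proof. by move=> x; rewrite expn1; split=> //; apply: ltnW (sz_ge2 x). Qed.

Lemma PT_nil : PT Lf 1 (fun x : A => [::] : seq B).
Proof. by move=> x; rewrite expn1; split; [by []|apply: ltnW (sz_ge2 x)|apply: sz_ge2]. Qed.

Lemma PT_none : PT Lf 1 (fun x : A => None : option B).
Proof. by move=> x; rewrite expn1; split; [by []|apply: ltnW (sz_ge2 x)|apply: sz_ge2]. Qed.

Lemma PT_const (b : B) : PT (fnconst (enc b)) (cconst (enc b) + sz b) (fun x : A => b).
Proof.
move=> x.
have Hs : 2 <= sz x by exact: sz_ge2.
 split; first exact: sem_fnconst.
  by rewrite cost_fnconst; apply: (leX Hs _ (kX _ Hs)); lia.
by apply: (leX Hs _ (kX _ Hs)); lia.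
Qed.

Lemma PT_some tf cf (f : A -> B) :
  PT tf cf f -> PT (Pr Lf tf) (cf + 8) (fun x => Some (f x)).
Proof.
move=> Hf x; have [Ef Cf Sf] := Hf x.
have Hs : 2 <= sz x by exact: sz_ge2.
split; rewrite /= ?Ef //.
  by rewrite add1n addSnnS; apply: (leX Hs _ (addX Hs Cf (kX 6 Hs))); lia.
rewrite /sz [tree_size _]/= add1n -addn1 -[(tree_size _).+2]addn1 -addnA.
by apply: (leX Hs _ (addX Hs Sf (kX 2 Hs))); lia.
Qed.

Lemma PT_fst te ce (e : A -> B * C) :
  PT te ce e -> PT (Cmp Fst te) (ce + 10) (fun x => (e x).1).
Proof.
move=> H x; have [E Ce Se] := H x.
have Hs : 2 <= sz x by exact: sz_ge2.
split; rewrite /= ?E //; first by rewrite -addnA; apply: (leX Hs _ (addX Hs Ce (kX 6 Hs))); lia.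
by apply: leq_trans (leX Hs _ Se); [rewrite /sz /= ltnS; lia|lia].
Qed.

Lemma PT_snd te ce (e : A -> B * C) :
  PT te ce e -> PT (Cmp Snd te) (ce + 10) (fun x => (e x).2).
Proof.
move=> H x; have [E Ce Se] := H x.
have Hs : 2 <= sz x by exact: sz_ge2.
split; rewrite /= ?E //; first by rewrite -addnA; apply: (leX Hs _ (addX Hs Ce (kX 6 Hs))); lia.
by apply: leq_trans (leX Hs _ Se); [rewrite /sz /= ltnS; lia|lia].
Qed.

Lemma PT_if tb cb tf cf tg cg (b : A -> bool) (f g : A -> B) :
  PT tb cb b -> PT tf cf f -> PT tg cg g ->
  PT (If tb tg tf) (cb + cf + cg + 7) (fun x => if b x then f x else g x).
Proof.
move=> Hb Hf Hg x; have [Eb Cb Sb] := Hb x; have [Ef Cf Sf] := Hf x.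
have [Eg Cg Sg] := Hg x.
have Hs : 2 <= sz x by exact: sz_ge2.
have Ec : enc (b x) = if b x then Node Leaf Leaf else Leaf by case: (b x).
split; rewrite /= ?Eb ?Ec; case: (b x) => //=.
- by apply: (leX Hs _ (addX Hs (addX Hs Cb Cf) (kX 5 Hs))); lia.
- by apply: (leX Hs _ (addX Hs (addX Hs Cb Cg) (kX 5 Hs))); lia.
- by apply: (leX Hs _ Sf); lia.
- by apply: (leX Hs _ Sg); lia.
Qed.

Lemma PT_opt to co tf cf tg cg (o : A -> option B) (f : A -> B -> C) (g : A -> C) :
  PT to co o -> PT tf cf (fun p : A * B => f p.1 p.2) -> PT tg cg g ->
  PT (topt to tg tf) (copt co cg cf) (fun x => if o x is Some y then f x y else g x).
Proof.
rewrite /topt /copt.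
move=> Ho Hf Hg x; have [Eo Co So] := Ho x.
have [Eg Cg Sg] := Hg x.
have Hs : 2 <= sz x by exact: sz_ge2.
case E: (o x) Eo Co So => [y|] Eo Co So; last first.
  split; rewrite /= ?Eo //=; last by apply: (leX Hs _ Sg); lia.
  by apply: (leX Hs _ (addX Hs (addX Hs Co Cg) (kX 5 Hs))); lia.
have [/= Ef Cf Sf] := Hf (x, y).
have Hx1 : sz x <= sz x ^ 1 by rewrite expn1.
have Hxy : sz (x, y) <= sz x ^ co.+3.
  apply: leq_trans (leX Hs _ (addX Hs Hx1 So)); last by lia.
  by rewrite /sz /=; lia.
have {}Cf := leq_trans Cf (powX cf Hxy); have {}Sf := leq_trans Sf (powX cf Hxy).
have Ey : enc (Some y) = Node Leaf (enc y) by [].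
split; rewrite /= ?Eo ?Ey //=.
- set z := cost tf _.
  have -> : cost to (enc x) + (1 + (cost to (enc x) + 3 + 3) + 5 + z + 3) + 5
    = cost to (enc x) + (cost to (enc x) + z) + 20 by lia.
  apply: (leX Hs _ (addX Hs (addX Hs Co (addX Hs Co Cf)) (kX 20 Hs))); lia.
- by apply: (leX Hs _ Sf); lia.
Qed.

End Closure.

Section Sizes.
Context {A B : Type} {EA : Enc A} {EB : Enc B}.

Lemma sz_pair (a : A) (b : B) : sz (a, b) = sz a + sz b.
Proof. by rewrite /sz addSn addnS. Qed.

Lemma sz_cons (a : A) (s : seq A) : sz (a :: s) = sz a + sz s.
Proof. by rewrite /sz addSn addnS. Qed.

Lemma size_sz (s : seq A) : size s < sz s.
Proof.
elim: s => //= a s IHs; rewrite sz_cons.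
have ? : 2 <= sz a by exact: sz_ge2.
by lia.
Qed.

Lemma sz_pair_mul (a : A) (b : B) : sz (a, b) <= sz a * sz b.
Proof.
rewrite sz_pair; have ? : 2 <= sz a by exact: sz_ge2.
have ? : 2 <= sz b by exact: sz_ge2.
  nia. Qed.

End Sizes.

Section Folds.
Context {A B C E : Type} {EA : Enc A} {EB : Enc B} {EC : Enc C} {EE : Enc E}.

Lemma foldl_loop tF cF (F : A -> B -> E -> B) x s b N :
  PT tF cF (fun p : A * (B * E) => F p.1 p.2.1 p.2.2) ->
  (forall n, sz (foldl (F x) b (take n s)) <= N) ->
  sloop tF (enc x) (enc b) (enc s) = enc (foldl (F x) b s) /\
  cloop tF (enc x) (enc b) (enc s) <= size s * ((sz x * (N * sz s)) ^ cF + 17) + 7.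
Proof.
move=> HF; elim: s b => [|e s IHs] b HN //=.
have [EF CF SF] := HF (x, (b, e)).
have [|E1 E2] := IHs (F x b e); first by move=> n; have := HN n.+1.
have -> : sloop tF (enc x) (enc b) (enc (e :: s))
  = sloop tF (enc x) (sem tF (enc (x, (b, e)))) (enc s) by [].
have -> : cloop tF (enc x) (enc b) (enc (e :: s))
  = cloop tF (enc x) (sem tF (enc (x, (b, e)))) (enc s)
    + cost tF (enc (x, (b, e))) + 17 by [].
rewrite EF; split=> //=.
have mono k n m : n <= m -> n ^ k <= m ^ k by case: k => // k; rewrite leq_exp2r.
have Hb : sz b <= N by have := HN 0; rewrite take0.
have {CF} : cost tF (enc (x, (b, e))) <= (sz x * (N * sz (e :: s))) ^ cF.
  apply: leq_trans CF _; apply: mono.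
  have: sz (b, e) <= N * sz (e :: s).
    rewrite sz_cons sz_pair.
    have : 2 <= sz b by exact: sz_ge2.
    have : 2 <= sz e by exact: sz_ge2.
    have : 2 <= sz s by exact: sz_ge2.
    by move: (sz b) (sz e) (sz s) Hb => u v w; nia.
  move=> H; have -> : sz (x, (b, e)) = sz x + sz (b, e) by rewrite /sz addSn addnS.
  have : 2 <= sz x by exact: sz_ge2.
  have : 2 <= sz (b, e) by exact: sz_ge2.
  by move: (sz x) (sz (b, e)) (N * _) H => u v w; nia.
have {}E2 : cloop tF (enc x) (enc (F x b e)) (enc s)
   <= size s * ((sz x * (N * sz (e :: s))) ^ cF + 17) + 7.
  apply: leq_trans E2 _; rewrite leq_add2r leq_mul2l leq_add2r; apply/orP; right.
  by apply: mono; rewrite !leq_mul2l sz_cons leq_addl !orbT.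
by rewrite mulSn /=; move: (_ ^ cF) (cost _ _) (cloop _ _ _ _) (size s) E2 => u v w z;
  move: (z * _) => k; lia.
Qed.

Lemma PT_foldl tF cF ti ci tl cl d (F : A -> B -> E -> B) (i : A -> B) (l : A -> seq E) :
  PT tF cF (fun p : A * (B * E) => F p.1 p.2.1 p.2.2) ->
  PT ti ci i -> PT tl cl l ->
  (forall x n, sz (foldl (F x) (i x) (take n (l x))) <= sz x ^ d) ->
  PT (Cmp (Fold tF) (Pr Id (Pr ti tl))) (cfoldl ci cl cF d)
     (fun x => foldl (F x) (i x) (l x)).
Proof.
rewrite /cfoldl.
move=> HF Hi Hl HN x; have [Ei Ci Si] := Hi x; have [El Cl Sl] := Hl x.
have Hs : 2 <= sz x by exact: sz_ge2.
have [E1 E2] := foldl_loop HF (HN x).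
have Es : sem (Cmp (Fold tF) (Pr Id (Pr ti tl))) (enc x)
  = sloop tF (enc x) (sem ti (enc x)) (sem tl (enc x)) by [].
have Ec : cost (Cmp (Fold tF) (Pr Id (Pr ti tl))) (enc x)
  = 1 + (cost ti (enc x) + cost tl (enc x) + 5) + 5
    + cloop tF (enc x) (sem ti (enc x)) (sem tl (enc x)) + 3 by [].
split; first by rewrite Es Ei El.
- have -> : cost (Cmp (Fold tF) (Pr Id (Pr ti tl))) (enc x) =
     cost ti (enc x) + cost tl (enc x)
       + cloop tF (enc x) (enc (i x)) (enc (l x)) + 14 by rewrite Ec Ei El; lia.
  have Hx1 : sz x <= sz x ^ 1 by rewrite expn1.
  have Hd : sz x ^ d <= sz x ^ d by [].
  have H1 : (sz x * (sz x ^ d * sz (l x))) ^ cF <= sz x ^ ((1 + (d + cl)) * cF).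
    by apply/powX/mulX => //; apply: mulX.
  have H2 : size (l x) <= sz x ^ cl by apply: leq_trans (ltnW (size_sz _)) Sl.
  have {}E2 := leq_trans E2 (addX Hs (mulX H2 (addX Hs H1 (kX 17 Hs))) (kX 7 Hs)).
  by apply: (leX Hs _ (addX Hs (addX Hs (addX Hs Ci Cl) E2) (kX 14 Hs))); lia.
have := HN x (size (l x)); rewrite take_size => H.
by apply: (leX Hs _ H); lia.
Qed.

(** One round adds an amount that does not depend on the accumulator, so sizes add up over the list
    instead of being composed. *)
Lemma PT_foldl_add tF cF ti ci tl cl d (F : A -> B -> E -> B) (i : A -> B) (l : A -> seq E) :
  PT tF cF (fun p : A * (B * E) => F p.1 p.2.1 p.2.2) ->
  PT ti ci i -> PT tl cl l ->
  (forall x b e, sz (F x b e) <= sz b + (sz x * sz e) ^ d) ->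
  PT (Cmp (Fold tF) (Pr Id (Pr ti tl))) (cfoldl_add ci cl cF d)
     (fun x => foldl (F x) (i x) (l x)).
Proof.
move=> HF Hi Hl Ha; apply: PT_foldl => // x n.
have [_ _ Si] := Hi x; have [_ _ Sl] := Hl x.
have Hs : 2 <= sz x by exact: sz_ge2.
have mono k m m' : m <= m' -> m ^ k <= m' ^ k by case: k => // k; rewrite leq_exp2r.
have H b s : sz (foldl (F x) b (take n s)) <= sz b + size s * (sz x * sz s) ^ d.
  elim: s n b => [|e s IHs] k b /=; first by case: k => //=; rewrite leq_addr.
  case: k => [|k] /=; first by rewrite leq_addr.
  apply: leq_trans (IHs _ _) _; rewrite mulSn addnA; apply: leq_add.
    apply: leq_trans (Ha _ _ _) _; rewrite leq_add2l; apply: mono.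
    by rewrite leq_mul2l sz_cons leq_addr orbT.
  rewrite leq_mul2l; apply/orP; right; apply: mono.
  by rewrite leq_mul2l sz_cons leq_addl orbT.
apply: leq_trans (H _ _) _; apply: addX => //.
have Hx1 : sz x <= sz x ^ 1 by rewrite expn1.
apply: mulX; first by apply: leq_trans (ltnW (size_sz _)) Sl.
by apply: powX; apply: mulX.
Qed.

End Folds.

#[global] Instance enc_unit : Enc unit := fun _ => Leaf.

(** * Automation, and list and number operations in polynomial time *)

Ltac pt_user := fail.
Ltac pt1 :=
  lazymatch goal with
  | |- PT _ _ (@fst _ _) => eapply (PT_fst (e := fun x => x))
  | |- PT _ _ (@snd _ _) => eapply (PT_snd (e := fun x => x))
  | |- PT _ _ (fun x => x) => apply: PT_id
  | |- PT _ _ (fun x => (_, _)) => eapply PT_pair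
  | |- PT _ _ (fun x => _.1) => eapply PT_fst
  | |- PT _ _ (fun x => _.2) => eapply PT_snd
  | |- PT _ _ (fun x => _ :: _) => eapply PT_cons
  | |- PT _ _ (fun x => [::]) => apply: PT_nil
  | |- PT _ _ (fun x => None) => apply: PT_none
  | |- PT _ _ (fun x => Some _) => eapply PT_some
  | |- PT _ _ (fun x => true) => apply: (@PT_const _ bool)
  | |- PT _ _ (fun x => false) => apply: (@PT_const _ bool)
  | |- PT _ _ (fun x => 0) => apply: (@PT_const _ nat)
  | |- PT _ _ (fun x => 1) => apply: (@PT_const _ nat)
  | |- PT _ _ (fun x => tt) => apply: (@PT_const _ unit)
  | |- PT _ _ (fun x => if _ then _ else _) =>
      first [eapply PT_if | eapply (PT_opt (f := fun x y => _))]
  | |- PT _ _ (fun x => match _ with Some _ => _ | None => _ end) => eapply PT_opt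
  | _ => first [eassumption | pt_user]
  end.
Ltac pt := repeat (pt1; cbv beta).
Ltac pt_start :=
  lazymatch goal with
  | |- {tc : (fn -> fn -> fn) * _ | _} => eexists (pair (fun tf tg => _) (fun cf cg => _))
  | |- {tc : (fn -> fn) * _ | _} => eexists (pair (fun tf => _) (fun cf => _))
  | _ => eexists (pair _ _)
  end; cbn [fst snd]; intros.

Notation SIG P := {tc : fn * nat | P tc.1 tc.2} (only parsing).
Notation SIG1 P := {tc : (fn -> fn) * (nat -> nat) |
  forall tf cf, P tf cf (tc.1 tf) (tc.2 cf)} (only parsing).
Notation SIG2 P := {tc : (fn -> fn -> fn) * (nat -> nat -> nat) |
  forall tf cf tg cg, P tf cf tg cg (tc.1 tf tg) (tc.2 cf cg)} (only parsing).

Lemma leXt s a b m n : 2 <= s -> m <= n -> b <= s ^ m -> a <= b -> a <= s ^ n.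
Proof. by move=> Hs Hmn Hb /leq_trans-> //; exact: leX Hb. Qed.

Lemma PT_rev_sig : SIG1 (fun te ce t c => forall A B (EA : Enc A) (EB : Enc B)
    (e : A -> seq B), PT te ce e -> PT t c (fun x => rev (e x))).
Proof.
pt_start.
apply: (@PT_ext _ _ _ _ _ _ (fun x => foldl (fun acc y => y :: acc) [::] (e x))).
  by move=> x; rewrite /rev; elim: (e x) [::] => //=.
eapply (PT_foldl_add (F := fun x acc y => y :: acc) (d := 1)); pt.
by move=> x b y; rewrite sz_cons expn1 addnC leq_add2l leq_pmull.
Qed.

Lemma PT_map_sig : SIG2 (fun tf cf tl cl t c => forall A B C (EA : Enc A) (EB : Enc B)
    (EC : Enc C) (f : A -> B -> C) (l : A -> seq B),
  PT tf cf (fun p : A * B => f p.1 p.2) -> PT tl cl l ->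
  PT t c (fun x => [seq f x y | y <- l x])).
Proof.
pt_start.
apply: (@PT_ext _ _ _ _ _ _ (fun x => rev (foldl (fun acc y => f x y :: acc) [::] (l x)))).
  move=> x; suff -> s : foldl (fun acc y => f x y :: acc) s (l x) = catrev (map (f x) (l x)) s.
    by rewrite -/(rev _) revK.
  by elim: (l x) s => //=.
eapply (proj2_sig PT_rev_sig).
eapply (PT_foldl_add (F := fun x acc y => f x y :: acc) (d := cf)); try by pt.
  pt; eapply (PT_comp (f := fun p => (p.1, p.2.2)) (g := fun p => f p.1 p.2)); last by eassumption.
  by pt.
move=> x b y; rewrite sz_cons addnC leq_add2l.
have [_ _ /= S] := H (x, y); apply: leq_trans S _.
by case: (cf) => // k; rewrite leq_exp2r // sz_pair_mul.
Qed.

Lemma PT_filter_sig : SIG2 (fun tf cf tl cl t c => forall A B (EA : Enc A) (EB : Enc B)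
    (f : A -> B -> bool) (l : A -> seq B),
  PT tf cf (fun p : A * B => f p.1 p.2) -> PT tl cl l ->
  PT t c (fun x => [seq y <- l x | f x y])).
Proof.
pt_start.
apply: (@PT_ext _ _ _ _ _ _ (fun x => rev (foldl (fun acc y =>
  if f x y then y :: acc else acc) [::] (l x)))).
  move=> x; suff -> s : foldl (fun acc y => if f x y then y :: acc else acc) s (l x)
      = catrev (filter (f x) (l x)) s by rewrite -/(rev _) revK.
  by elim: (l x) s => //= y r IHr s; rewrite IHr; case: (f x y).
eapply (proj2_sig PT_rev_sig).
eapply (PT_foldl_add (F := fun x acc y => if f x y then y :: acc else acc) (d := 1));
  try by pt.
  pt; eapply (PT_comp (f := fun p => (p.1, p.2.2)) (g := fun p => f p.1 p.2)); last by eassumption.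
  by pt.
move=> x b y; case: (f x y); last by rewrite leq_addr.
by rewrite sz_cons addnC leq_add2l expn1 leq_pmull.
Qed.

Lemma PT_has_sig : SIG2 (fun tf cf tl cl t c => forall A B (EA : Enc A) (EB : Enc B)
    (f : A -> B -> bool) (l : A -> seq B),
  PT tf cf (fun p : A * B => f p.1 p.2) -> PT tl cl l ->
  PT t c (fun x => has (f x) (l x))).
Proof.
pt_start.
apply: (@PT_ext _ _ _ _ _ _ (fun x => foldl (fun acc y =>
  if f x y then true else acc) false (l x))).
  move=> x; suff -> s : foldl (fun acc y => if f x y then true else acc) s (l x)
      = has (f x) (l x) || s by rewrite orbF.
  by elim: (l x) s => //= y r IHr s; rewrite IHr; case: (f x y) => //; rewrite orbT.
eapply (PT_foldl_add (F := fun x acc y => if f x y then true else acc) (d := 1));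
  try by pt.
  pt; eapply (PT_comp (f := fun p => (p.1, p.2.2)) (g := fun p => f p.1 p.2)); last by eassumption.
  by pt.
move=> x b y; case: (f x y); last by rewrite leq_addr.
rewrite expn1; have : 2 <= sz x by exact: sz_ge2.
have : 2 <= sz y by exact: sz_ge2.
by case: b; rewrite /sz /=; move: (tree_size _) (tree_size _) => u v; nia.
Qed.

Lemma PT_neg_sig : SIG1 (fun tf cf t c => forall A (EA : Enc A) (f : A -> bool),
  PT tf cf f -> PT t c (fun x => ~~ f x)).
Proof.
pt_start; apply: (@PT_ext _ _ _ _ _ _ (fun x => if f x then false else true)).
  by move=> x; case: (f x).
by pt.
Qed.

Lemma PT_and_sig : SIG2 (fun tf cf tg cg t c => forall A (EA : Enc A) (f g : A -> bool),
  PT tf cf f -> PT tg cg g -> PT t c (fun x => f x && g x)).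
Proof. by pt_start; rewrite /andb; pt. Qed.

Lemma PT_or_sig : SIG2 (fun tf cf tg cg t c => forall A (EA : Enc A) (f g : A -> bool),
  PT tf cf f -> PT tg cg g -> PT t c (fun x => f x || g x)).
Proof. by pt_start; rewrite /orb; pt. Qed.

Ltac pt_user ::= first
  [ eapply (proj2_sig PT_rev_sig)
  | eapply (proj2_sig PT_map_sig)
  | eapply (proj2_sig PT_filter_sig)
  | eapply (proj2_sig PT_has_sig)
  | eapply (proj2_sig PT_neg_sig)
  | eapply (proj2_sig PT_and_sig)
  | eapply (proj2_sig PT_or_sig) ].

Lemma PT_all_sig : SIG2 (fun tf cf tl cl t c => forall A B (EA : Enc A) (EB : Enc B)
    (f : A -> B -> bool) (l : A -> seq B),
  PT tf cf (fun p : A * B => f p.1 p.2) -> PT tl cl l ->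
  PT t c (fun x => all (f x) (l x))).
Proof.
pt_start; apply: (@PT_ext _ _ _ _ _ _ (fun x => ~~ has (fun y => ~~ f x y) (l x))).
  by move=> x; rewrite -all_predC; apply: eq_all => y /=; rewrite negbK.
by pt.
Qed.

Lemma PT_cat_sig : SIG2 (fun tf cf tg cg t c => forall A B (EA : Enc A) (EB : Enc B)
    (f g : A -> seq B), PT tf cf f -> PT tg cg g -> PT t c (fun x => f x ++ g x)).
Proof.
pt_start.
apply: (@PT_ext _ _ _ _ _ _ (fun x => foldl (fun acc y => y :: acc) (g x) (rev (f x)))).
  move=> x; rewrite -{2}(revK (f x)) -catrevE /catrev; by elim: (rev _) (g x) => //=.
eapply (PT_foldl_add (F := fun x acc y => y :: acc) (d := 1)); try by pt.
by move=> x b y; rewrite sz_cons expn1 addnC leq_add2l leq_pmull.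
Qed.

Lemma sz_cat A (EA : Enc A) (s1 s2 : seq A) : sz (s1 ++ s2) <= sz s1 + sz s2.
Proof. by elim: s1 => [|x s IHs]; rewrite ?leq_addl //= !sz_cons -addnA leq_add2l. Qed.

Ltac pt_user2 := first
  [ eapply (proj2_sig PT_rev_sig)
  | eapply (proj2_sig PT_map_sig)
  | eapply (proj2_sig PT_filter_sig)
  | eapply (proj2_sig PT_has_sig)
  | eapply (proj2_sig PT_all_sig)
  | eapply (proj2_sig PT_cat_sig)
  | eapply (proj2_sig PT_neg_sig)
  | eapply (proj2_sig PT_and_sig)
  | eapply (proj2_sig PT_or_sig) ].
Ltac pt_user ::= pt_user2.

Lemma PT_flatten_sig : SIG1 (fun tf cf t c => forall A B (EA : Enc A) (EB : Enc B)
    (f : A -> seq (seq B)), PT tf cf f -> PT t c (fun x => flatten (f x))).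
Proof.
pt_start.
apply: (@PT_ext _ _ _ _ _ _ (fun x => foldl (fun acc y => acc ++ y) [::] (f x))).
  move=> x; suff -> s : foldl (fun acc y => acc ++ y) s (f x) = s ++ flatten (f x) by [].
  by elim: (f x) s => [|y r IHr] s; rewrite /= ?cats0 // IHr catA.
eapply (PT_foldl_add (F := fun x acc y => acc ++ y) (d := 1)); try by pt.
move=> x b y; apply: leq_trans (sz_cat _ _ _) _.
by rewrite leq_add2l expn1 leq_pmull.
Qed.

Lemma PT_last_sig : SIG2 (fun tf cf tg cg t c => forall A B (EA : Enc A) (EB : Enc B)
    (f : A -> B) (g : A -> seq B),
  PT tf cf f -> PT tg cg g -> PT t c (fun x => last (f x) (g x))).
Proof.
pt_start.
apply: (@PT_ext _ _ _ _ _ _ (fun x => foldl (fun _ y => y) (f x) (g x))).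
  by move=> x; elim: (g x) (f x) => //=.
eapply (PT_foldl_add (F := fun x _ y => y) (d := 1)); try by pt.
by move=> x b y; rewrite expn1; apply: leq_trans (leq_pmull _ _) (leq_addl _ _).
Qed.

(** A number and a list of that many units have the same encoding, so the conversion is free; it
    allows folds to run over numbers. *)
Lemma PT_units_sig : SIG1 (fun tf cf t c => forall A (EA : Enc A) (f : A -> nat),
  PT tf cf f -> PT t c (fun x => nseq (f x) tt)).
Proof.
exists (pair (fun tf => tf) (fun cf => cf)) => /= tf cf A EA f H.
have E n : enc (nseq n tt) = enc n by elim: n => //= n IHn; rewrite -[LHS]/(Node Leaf (enc (nseq n tt))) IHn.
move=> x; have [H1 H2 H3] := H x; rewrite /sz E; split; [exact: H1|exact: H2|exact: H3].
Qed.

Lemma PT_succ tf cf A (EA : Enc A) (f : A -> nat) :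
  PT tf cf f -> PT (Pr Lf tf) (cf + 8) (fun x => (f x).+1).
Proof. by move=> H x; have := PT_some H x. Qed.

Lemma PT_size_sig : SIG1 (fun tf cf t c => forall A B (EA : Enc A) (EB : Enc B)
    (f : A -> seq B), PT tf cf f -> PT t c (fun x => size (f x))).
Proof.
pt_start.
apply: (@PT_ext _ _ _ _ _ _ (fun x => foldl (fun n _ => n.+1) 0 (f x))).
  move=> x; suff -> n : foldl (fun n _ => n.+1) n (f x) = n + size (f x) by [].
  by elim: (f x) n => [|y r IHr] n; rewrite /= ?addn0 // IHr addnS.
eapply (PT_foldl_add (F := fun x n _ => n.+1) (d := 1)); try by pt.
  by apply: PT_succ; pt.
move=> x b y; rewrite expn1.
have : 2 <= sz x by exact: sz_ge2.
have : 2 <= sz y by exact: sz_ge2.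
have -> : sz b.+1 = (sz b).+2 by [].
by move: (sz x) (sz y) (sz b) => u v w; nia.
Qed.

Lemma PT_behead_sig : SIG1 (fun tf cf t c => forall A B (EA : Enc A) (EB : Enc B)
    (f : A -> seq B), PT tf cf f -> PT t c (fun x => behead (f x))).
Proof.
exists (pair (fun tf => Cmp Snd tf) (fun cf => cf + 10)) => /= tf cf A B EA EB f H x; have [H1 H2 H3] := H x.
have Hs : 2 <= sz x by exact: sz_ge2.
split; first by rewrite /= H1; case: (f x).
  by rewrite /= -addnA; apply: (leX Hs _ (addX Hs H2 (kX 6 Hs))); lia.
apply: leq_trans (leX Hs (leq_addr 10 cf) H3).
by case: (f x) => //= y s; rewrite sz_cons leq_addl.
Qed.

Lemma PT_pred_sig : SIG1 (fun tf cf t c => forall A (EA : Enc A) (f : A -> nat),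
  PT tf cf f -> PT t c (fun x => (f x).-1)).
Proof.
exists (pair (fun tf => Cmp Snd tf) (fun cf => cf + 10)) => /= tf cf A EA f H x; have [H1 H2 H3] := H x.
have Hs : 2 <= sz x by exact: sz_ge2.
split; first by rewrite /= H1; case: (f x).
  by rewrite /= -addnA; apply: (leX Hs _ (addX Hs H2 (kX 6 Hs))); lia.
apply: leq_trans (leX Hs (leq_addr 10 cf) H3).
case: (f x) => //= n; have -> : sz n.+1 = (sz n).+2 by [].
by rewrite -addn2 leq_addr.
Qed.

Lemma PT_subn_sig : SIG2 (fun tf cf tg cg t c => forall A (EA : Enc A) (f g : A -> nat),
  PT tf cf f -> PT tg cg g -> PT t c (fun x => f x - g x)).
Proof.
pt_start.
apply: (@PT_ext _ _ _ _ _ _ (fun x => foldl (fun n _ => n.-1) (f x) (nseq (g x) tt))).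
  by move=> x; elim: (g x) (f x) => [|k IHk] n; rewrite /= ?subn0 // IHk; case: n.
eapply (PT_foldl_add (F := fun x n _ => n.-1) (d := 1)); try by pt.
- by eapply (proj2_sig PT_pred_sig); pt.
- by eapply (proj2_sig PT_units_sig).
move=> x b y; apply: leq_trans (leq_addr _ _).
by case: b => //= n; have -> : sz n.+1 = (sz n).+2 by []; rewrite -addn2 leq_addr.
Qed.

Lemma PT_nil_eq_sig : SIG1 (fun tf cf t c => forall A B (EA : Enc A) (EB : Enc B)
    (f : A -> seq B), PT tf cf f -> PT t c (fun x => nilp (f x))).
Proof.
exists (pair (fun tf => If tf (fnconst (Node Leaf Leaf)) Lf) (fun cf => cf + 30)).
move=> /= tf cf A B EA EB f H x; have [H1 H2 H3] := H x.
have Hs : 2 <= sz x by exact: sz_ge2.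
split.
- by rewrite /= H1; case: (f x).
- apply: leXt Hs _ (addX Hs H2 (kX 20 Hs)) _; first by rewrite /=; lia.
  by rewrite /= H1; case: (f x) => [|y s] /=; rewrite -addnA leq_add2l.
apply: leXt Hs _ (kX 5 Hs) _; first by rewrite /=; lia.
by rewrite /nilp; case: (f x).
Qed.

Lemma PT_leq_sig : SIG2 (fun tf cf tg cg t c => forall A (EA : Enc A) (f g : A -> nat),
  PT tf cf f -> PT tg cg g -> PT t c (fun x => f x <= g x)).
Proof.
pt_start.
apply: (@PT_ext _ _ _ _ _ _ (fun x => nilp (nseq (f x - g x) tt))).
  by move=> x; rewrite /nilp size_nseq.
eapply (proj2_sig PT_nil_eq_sig); eapply (proj2_sig PT_units_sig).
by eapply (proj2_sig PT_subn_sig).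
Qed.

Lemma PT_eqn_sig : SIG2 (fun tf cf tg cg t c => forall A (EA : Enc A) (f g : A -> nat),
  PT tf cf f -> PT tg cg g -> PT t c (fun x => f x == g x)).
Proof.
pt_start; apply: (@PT_ext _ _ _ _ _ _ (fun x => (f x <= g x) && (g x <= f x))).
  by move=> x; rewrite eqn_leq.
by eapply (proj2_sig PT_and_sig); eapply (proj2_sig PT_leq_sig).
Qed.

Lemma PT_rank tf cf (T : finType) A (EA : Enc A) (f : A -> T) :
  PT tf cf f <-> PT tf cf (fun x => enum_rank (f x) : nat).
Proof. by []. Qed.

Lemma PT_eqfin_sig : SIG2 (fun tf cf tg cg t c => forall (T : finType) A (EA : Enc A)
    (f g : A -> T), PT tf cf f -> PT tg cg g -> PT t c (fun x => f x == g x)).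
Proof.
pt_start; apply: (@PT_ext _ _ _ _ _ _ (fun x => enum_rank (f x) == enum_rank (g x) :> nat)).
  by move=> x; exact: (inj_eq (inj_comp val_inj enum_rank_inj)).
by eapply (proj2_sig PT_eqn_sig).
Qed.

Ltac pt_user3 := first
  [ pt_user2
  | eapply (proj2_sig PT_flatten_sig)
  | eapply (proj2_sig PT_last_sig)
  | eapply (proj2_sig PT_units_sig)
  | eapply PT_succ
  | eapply (proj2_sig PT_size_sig)
  | eapply (proj2_sig PT_behead_sig)
  | eapply (proj2_sig PT_pred_sig)
  | eapply (proj2_sig PT_subn_sig)
  | eapply (proj2_sig PT_nil_eq_sig)
  | eapply (proj2_sig PT_leq_sig)
  | eapply (proj2_sig PT_eqn_sig)
  | eapply (proj2_sig PT_eqfin_sig) ].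
Ltac pt_user ::= pt_user3.

Lemma PT_memfin_sig : SIG2 (fun tf cf tg cg t c => forall (T : finType) A (EA : Enc A)
    (f : A -> T) (g : A -> seq T), PT tf cf f -> PT tg cg g -> PT t c (fun x => f x \in g x)).
Proof.
pt_start; apply: (@PT_ext _ _ _ _ _ _ (fun x => has (fun y => y == f x) (g x))).
  by move=> x; rewrite -has_pred1.
by pt; eapply (PT_comp (f := fun p => p.1) (g := f)); pt.
Qed.

Lemma PT_ohead_sig : SIG1 (fun tf cf t c => forall A B (EA : Enc A) (EB : Enc B)
    (f : A -> seq B), PT tf cf f -> PT t c (fun x => ohead (f x))).
Proof.
pt_start.
apply: (@PT_ext _ _ _ _ _ _ (fun x => foldl (fun _ y => Some y) None (rev (f x)))).
  by move=> x; rewrite foldl_rev; case: (f x).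
eapply (PT_foldl_add (F := fun x _ y => Some y) (d := 1)); try by pt.
move=> x b y; rewrite expn1; apply: leq_trans (leq_addl _ _).
have : 2 <= sz x by exact: sz_ge2.
have : 2 <= sz y by exact: sz_ge2.
have -> : sz (Some y) = sz y + 2 by rewrite /sz /= add1n addn2.
by move: (sz x) (sz y) => u v; nia.
Qed.

Lemma PT_drop_sig : SIG2 (fun tf cf tg cg t c => forall A B (EA : Enc A) (EB : Enc B)
    (f : A -> nat) (g : A -> seq B),
  PT tf cf f -> PT tg cg g -> PT t c (fun x => drop (f x) (g x))).
Proof.
pt_start.
apply: (@PT_ext _ _ _ _ _ _ (fun x => foldl (fun s _ => behead s) (g x) (nseq (f x) tt))).
  by move=> x; elim: (f x) (g x) => [|n IHn] [|y s] //=; rewrite ?drop0 // IHn; case: n {IHn}.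
eapply (PT_foldl_add (F := fun x s _ => behead s) (d := 1)); try by pt.
move=> x b y; apply: leq_trans (leq_addr _ _).
by case: b => //= u s; rewrite sz_cons leq_addl.
Qed.

Lemma PT_take_sig : SIG2 (fun tf cf tg cg t c => forall A B (EA : Enc A) (EB : Enc B)
    (f : A -> nat) (g : A -> seq B),
  PT tf cf f -> PT tg cg g -> PT t c (fun x => take (f x) (g x))).
Proof.
pt_start.
apply: (@PT_ext _ _ _ _ _ _ (fun x => rev (foldl (fun acc y =>
   if 1 <= acc.1 then (acc.1.-1, y :: acc.2) else acc) (f x, [::]) (g x)).2)).
  move=> x; suff -> n s : (foldl (fun acc y =>
    if 1 <= acc.1 then (acc.1.-1, y :: acc.2) else acc) (n, s) (g x)).2
     = catrev (take n (g x)) s by rewrite -/(rev _) revK.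
  by elim: (g x) n s => [|y r IHr] [|n] s //=; rewrite ?IHr ?take0.
do 2!pt1.
eapply (PT_foldl_add (F := fun x acc y =>
   if 1 <= acc.1 then (acc.1.-1, y :: acc.2) else acc) (d := 1)); try by pt.
move=> x [n s] y; rewrite expn1; case: n => [|n] /=; first by rewrite leq_addr.
rewrite !sz_pair sz_cons; have -> : sz n.+1 = (sz n).+2 by [].
have : 2 <= sz x by exact: sz_ge2.
have : 2 <= sz y by exact: sz_ge2.
by move: (sz x) (sz y) (sz n) (sz s) => u v w z; nia.
Qed.

Lemma PT_find_sig : SIG2 (fun tf cf tl cl t c => forall A B (EA : Enc A) (EB : Enc B)
    (f : A -> B -> bool) (l : A -> seq B),
  PT tf cf (fun p : A * B => f p.1 p.2) -> PT tl cl l ->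
  PT t c (fun x => find (f x) (l x))).
Proof.
pt_start.
apply: (@PT_ext _ _ _ _ _ _ (fun x => (foldl (fun acc y =>
   if acc.1 then acc else if f x y then (true, acc.2) else (false, acc.2.+1))
   (false, 0) (l x)).2)).
  move=> x; set F := (fun acc y => _).
  have E b n : (foldl F (b, n) (l x)).2 = if b then n else n + find (f x) (l x).
    elim: (l x) b n => [|y r IHr] b n /=; first by rewrite addn0 if_same.
    by rewrite {2}/F /=; case: b; rewrite ?IHr //; case: (f x y); rewrite /= IHr ?addn0 ?addnS.
  by rewrite E.
pt1.
eapply (PT_foldl_add (F := fun x acc y =>
   if acc.1 then acc else if f x y then (true, acc.2) else (false, acc.2.+1)) (d := 1));
   try by pt.
  pt; eapply (PT_comp (f := fun p => (p.1, p.2.2)) (g := fun p => f p.1 p.2)); last by eassumption.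
  by pt.
move=> x [b n] y; rewrite expn1.
have : 2 <= sz x by exact: sz_ge2.
have : 2 <= sz y by exact: sz_ge2.
have E : sz n.+1 = (sz n).+2 by [].
have [T F] : sz true = 4 /\ sz false = 2 by [].
by case: b; case: (f x y); rewrite /= !sz_pair ?E ?T ?F;
  move: (sz x) (sz y) (sz n) => u v w; nia.
Qed.

Lemma PT_zip_sig : SIG2 (fun tf cf tg cg t c => forall A B C (EA : Enc A) (EB : Enc B)
    (EC : Enc C) (f : A -> seq B) (g : A -> seq C),
  PT tf cf f -> PT tg cg g -> PT t c (fun x => zip (f x) (g x))).
Proof.
pt_start.
apply: (@PT_ext _ _ _ _ _ _ (fun x => rev (foldl (fun acc y =>
   if ohead acc.1 is Some z then (behead acc.1, (y, z) :: acc.2) else acc)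
   (g x, [::]) (f x)).2)).
  move=> x; set F := (fun acc y => _).
  suff E s1 s2 : (foldl F (s1, s2) (f x)).2 = catrev (zip (f x) s1) s2.
    by rewrite E -/(rev _) revK.
  elim: (f x) s1 s2 => [|y r IHr] [|z s1] s2 //=; rewrite ?IHr //.
  by case: r {IHr}.
do 2!pt1.
eapply (PT_foldl_add (F := fun x acc y =>
   if ohead acc.1 is Some z then (behead acc.1, (y, z) :: acc.2) else acc) (d := 1));
  try by pt.
  by pt1; [eapply (proj2_sig PT_ohead_sig)|..]; pt.
move=> x [s1 s2] y; rewrite expn1; case: s1 => [|z s1] /=; first by rewrite leq_addr.
rewrite !sz_pair !sz_cons sz_pair.
have : 2 <= sz x by exact: sz_ge2.
have : 2 <= sz y by exact: sz_ge2.
by move: (sz x) (sz y) (sz s1) (sz s2) (sz z) => a b c d e; nia.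
Qed.

Ltac pt_user4 := first
  [ pt_user3
  | eapply (proj2_sig PT_memfin_sig)
  | eapply (proj2_sig PT_ohead_sig)
  | eapply (proj2_sig PT_drop_sig)
  | eapply (proj2_sig PT_take_sig)
  | eapply (proj2_sig PT_find_sig)
  | eapply (proj2_sig PT_zip_sig) ].
Ltac pt_user ::= pt_user4.

(** * The algorithm *)

Notation asg M W := (seq (M * option W)) (only parsing).
Notation cand M W := (M * option W)%type (only parsing).
Notation guess := (seq (nat * (nat * nat)) * seq (seq nat * seq nat))%type (only parsing).

Section Algorithm.
Variables (M W : finType) (I : smc M W).

Definition isw (x : option W) (w : W) := if x is Some w' then w' == w else false.
Definition eqw (x y : option W) :=
  if x is Some w then isw y w else if y is Some _ then false else true.

(* The man other than [m] who can be matched to [w]: unique when [DeltaW I <= 2]. *)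
Definition other (w : W) (m : M) : option M :=
  ohead [seq o <- wpref I w | (o != m) && (w \in mpref I o)].
(** Being single ranks just after the whole list, so one comparison covers both alternatives in the
    definition of blocking. *)
Definition rank (m : M) (x : option W) : nat :=
  if x is Some w then index w (mpref I m) else size (mpref I m).
Definition above (w : W) (m m' : M) : bool :=
  index m (wpref I w) < index m' (wpref I w).
(** No partner of [w] has to be looked up: if someone else than [m] holds her, it can only be
    [other w m]. *)
Definition blocks (p : M -> option W) (m : M) (w : W) : bool :=
  [&& acceptable I m w, rank m (Some w) < rank m (p m)
    & if other w m is Some o then ~~ (isw (p o) w && above w o m) else true].

(* An assignment is given by an association list in which the first entry of a
   man counts. *)
Definition get (q : asg M W) (m : M) : option W :=
  if ohead [seq e <- q | e.1 == m] is Some e then e.2 else None.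
Definition free (q : asg M W) (w : W) : bool := ~~ has (fun m => isw (get q m) w) (enum M).

(* Men-proposing deferred acceptance; [R] lists the rejections so far. *)
Definition proposal (R : asg M W) (m : M) : option W :=
  ohead [seq w <- mpref I m |
    (m \in wpref I w) && ~~ has (fun e => (e.1 == m) && isw e.2 w) R].
Definition refused (R : asg M W) (m : M) : bool :=
  if proposal R m is Some w then
    if other w m is Some o then isw (proposal R o) w && above w o m else false
  else false.
Definition gsstep (R : asg M W) : asg M W :=
  R ++ [seq (m, proposal R m) | m <- [seq m <- enum M | refused R m]].
(** One tick more than there are pairs: every round that refuses somebody records a new pair, so
    refusals cannot last until the end. *)
Definition clock : seq unit :=
  tt :: flatten [seq [seq tt | w <- enum W] | m <- enum M].
Definition gsR : asg M W := foldl (fun R _ => gsstep R) [::] clock.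
Definition base : asg M W := [seq (m, proposal gsR m) | m <- enum M].

Section Base.
Variable s : asg M W.

Definition nextm (m : M) : M :=
  if get s m is Some w then if other w m is Some o then o else m else m.
(** The orbit of [a] up to its first repetition; [enum M] merely provides enough rounds. The man met
    again is [nextm (walk_end a)]. *)
Definition walk (a : M) : seq M :=
  foldl (fun l _ => if nextm (last a l) \in l then l else l ++ [:: nextm (last a l)])
    [:: a] (enum M).
Definition walk_end (a : M) : M := last a (walk a).
(** The first man takes [x], every other one the [s]-partner of the man before him. The [s]-partner
    of the last man is left over and is dropped by [zip]. *)
Definition shift (x : option W) (path : seq M) : asg M W :=
  zip path (x :: [seq get s m | m <- path]).

Definition toks : seq W := [seq w <- enum W | (w \in wstar I) && free s w].
Definition start (w : W) (b : nat) : option M :=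
  ohead (drop b [seq m <- wpref I w | w \in mpref I m]).
Definition drops (m : M) : bool := if get s m is Some w then w \notin wstar I else false.
Definition unwanted (m : M) : bool :=
  drops m && ((nextm m == m) || (rank (nextm m) (get s (nextm m)) < rank (nextm m) (get s m))).

(** In a minimal solution a man who absorbs a woman stands where a walk closes or where the walks of
    two tokens merge. The start [a] is added for paths without such a man. *)
Definition specials (A : seq M) (a : M) : seq M :=
  nextm (walk_end a) :: a
    :: flatten [seq take 1 [seq m <- walk a | m \in walk b] | b <- A].
(* The places where the path of a token may stop in a minimal solution: the end of
   the walk, just before a special man [x], or at the first man from [x] on whose
   woman may stay single (in the third case, one whom the next man would not take
   in exchange for his own woman). *)
Definition options (A : seq M) (a : M) : seq nat :=
  size (walk a) :: flatten [seq
    [:: index x (walk a);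
        index x (walk a) + (find drops (drop (index x (walk a)) (walk a))).+1;
        index x (walk a) + (find unwanted (drop (index x (walk a)) (walk a))).+1]
    | x <- flatten [seq specials A b | b <- A]].
Definition pathto (A : seq M) (a : M) (i : nat) : seq M :=
  if ohead (drop i (options A a)) is Some l then take l (walk a) else [::].

(* A guess for a token [w] is [(b, (i, f))]: the man to whom [w] goes, the place
   where the walk from him stops, and whether the cycle met next is rotated. *)
Definition tokens (G : seq (nat * (nat * nat))) : seq (W * (M * (nat * nat))) :=
  flatten [seq if start e.1 e.2.1 is Some a then [:: (e.1, (a, e.2.2))] else [::]
          | e <- zip toks G].
(** The test checks that [n] lies on a cycle of [nextm]. Then [walk n] is this cycle, and [n] takes
    the woman of its last man. *)
Definition rotate (n : M) : asg M W :=
  if nextm (walk_end n) == n then shift (get s (walk_end n)) (walk n) else [::].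
Definition tokasg (D : seq (W * (M * (nat * nat)))) : asg M W :=
  flatten [seq if d.2.2.2 == 1 then
      rotate (nextm (last d.2.1 (pathto [seq d.2.1 | d <- D] d.2.1 d.2.2.1)))
    else [::] | d <- D]
  ++ flatten [seq shift (Some d.1) (pathto [seq d.2.1 | d <- D] d.2.1 d.2.2.1) | d <- D]
  ++ s.

Section Rows.
Variable N : asg M W.

Definition rows : seq M :=
  [seq m <- enum M | (m \in mstar I) && if get N m is Some _ then false else true].
Definition okcand (rw : seq M) (c : cand M W) : bool :=
  [&& walk_end c.1 \in rw, nextm (walk_end c.1) == walk_end c.1,
      all (fun m => eqw (get N m) (get s m)) (walk c.1)
    & if c.2 is Some w then [&& acceptable I c.1 w, w \notin wstar I & free s w]
      else c.1 \notin mstar I].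
Definition addc (q : asg M W) (c : cand M W) : asg M W := shift c.2 (walk c.1) ++ q.
Definition addcs (q : asg M W) (cs : seq (cand M W)) : asg M W := foldl addc q cs.
(** While [y] is single, [b] and [y] block, and giving her to [o], whom she ranks higher, removes
    the pair. In a minimal solution somebody must hold her, and that can only be [o], so the new
    candidate is forced. *)
Definition want (q : asg M W) (b : M) (y : W) : seq (cand M W) :=
  if other y b is Some o then
    if [&& acceptable I b y, y \notin wstar I, free s y,
           rank b (Some y) < rank b (get q b), above y o b & free q y]
    then [:: (o, Some y)] else [::]
  else [::].
Definition wants (q : asg M W) (cs : seq (cand M W)) : seq (cand M W) :=
  flatten [seq flatten [seq flatten [seq want q b y | y <- mpref I b]
                       | b <- walk c.1] | c <- cs].
(** For the heads that matter, the candidates added are distinct men, so [enum M] gives enough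
    rounds to reach a fixed point. *)
Definition close (c : cand M W) : seq (cand M W) :=
  foldl (fun cs _ => if ohead (wants (addcs N cs) cs) is Some c' then c' :: cs else cs)
    [:: c] (enum M).
Definition newm (cs : seq (cand M W)) : seq W :=
  flatten [seq if c.2 is Some y then [:: y] else [::] | c <- cs].
Definition served (cs : seq (cand M W)) : seq M := [seq walk_end c.1 | c <- cs].
Definition okclus (rw R : seq M) (F : seq W) (cs : seq (cand M W)) : bool :=
  [&& all (okcand rw) cs, uniq (served cs), uniq (newm cs),
      all (fun m => m \in R) (served cs), all (fun m => m \in served cs) R
    & all (fun y => y \notin F) (newm cs)].
Definition nblk (q : asg M W) : nat :=
  size (flatten [seq [seq w <- mpref I m | blocks (get q) m w] | m <- enum M]).
Definition heads : seq (cand M W) :=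
  flatten [seq (m, None) :: [seq (m, Some w) | w <- mpref I m] | m <- enum M].
Definition clusters (rw R : seq M) (F : seq W) : seq (seq (cand M W)) :=
  [seq cs <- [seq close h | h <- heads] | okclus rw R F cs].
Definition better (o : option (seq (cand M W))) (cs : seq (cand M W)) : option (seq (cand M W)) :=
  if o is Some b then
    if nblk (addcs N b) <= nblk (addcs N cs) then o else Some cs
  else Some cs.
Definition best_cluster (rw R : seq M) (F : seq W) : seq (cand M W) :=
  if foldl better None (clusters rw R F) is Some cs then cs else [::].
(** A woman has no bounded name, but her position among the new women of the cluster that is best
    under the restrictions made so far is bounded. A position beyond the end changes nothing and
    serves as padding. *)
Definition forbid (rw R : seq M) (js : seq nat) : seq W :=
  foldl (fun F j => if ohead (drop j (newm (best_cluster rw R F))) is Some y then y :: F else F)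
    [::] js.
Definition marked (rw : seq M) (b : seq nat) : seq M :=
  [seq e.1 | e <- [seq e <- zip rw b | e.2 == 1]].
Definition rowcands (rw : seq M) (G : seq (seq nat * seq nat)) : seq (cand M W) :=
  flatten [seq best_cluster rw (marked rw g.1) (forbid rw (marked rw g.1) g.2) | g <- G].

End Rows.

Definition fill (N : asg M W) (G : seq (seq nat * seq nat)) : asg M W :=
  addcs N (rowcands N (rows N) G).
Definition gen (g : guess) : asg M W := fill (tokasg (tokens g.1)) g.2.

End Base.

Definition feas (q : asg M W) : bool :=
  [&& all (fun m => if get q m is Some w then acceptable I m w else true) (enum M),
      all (fun m => if get q m is Some w then
             all (fun o => (o == m) || ~~ isw (get q o) w) (enum M) else true) (enum M),
      all (fun m => (m \notin mstar I) || if get q m is Some _ then true else false) (enum M)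
    & all (fun w => (w \notin wstar I) || ~~ free q w) (enum W)].
Definition keep (o : option (asg M W)) (q : asg M W) : option (asg M W) :=
  if feas q then
    if o is Some b then if nblk b <= nblk q then o else Some q else Some q
  else o.
Definition search (s : asg M W) (gs : seq guess) : option (asg M W) :=
  foldl (fun o g => keep o (gen s g)) None gs.
Definition pairs (q : asg M W) : seq (M * W) :=
  flatten [seq if get q m is Some w then [:: (m, w)] else [::] | m <- enum M].
Definition result (o : option (asg M W)) : option (seq (M * W)) :=
  if o is Some q then Some (pairs q) else None.
Definition param (s : asg M W) : nat :=
  size (toks s) + size (rows s).

End Algorithm.

(** * Exchange arguments *)

Section Basics.
Variables (M W : finType) (I : smc M W).
Implicit Types (m o : M) (w y : W) (p q : M -> option W) (x : option W).

Notation acc := (acceptable I).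
Notation rk := (rank I).
Notation oth := (other I).
Notation wlt := (above I).
Notation blk := (blocks I).

Definition asn p :=
  (forall m w, p m = Some w -> acc m w) /\
  (forall m m' w, p m = Some w -> p m' = Some w -> m = m').

Lemma iswP x w : reflect (x = Some w) (isw x w).
Proof. by case: x => [w'|] /=; apply: (iffP idP) => // [/eqP->|[->]]. Qed.

Lemma wlt_asym w m o : wlt w m o -> wlt w o m -> False.
Proof. by rewrite /above => ? ?; lia. Qed.

Lemma rk_none m w : acc m w -> rk m (Some w) < rk m None.
Proof. by case/andP=> H _; rewrite /= index_mem. Qed.

Definition okv m x := forall w, x = Some w -> acc m w.

Lemma rk_inj m (x y : option W) : okv m x -> okv m y -> rk m x = rk m y -> x = y.
Proof.
case: x y => [w|] [w'|] //= Hx Hy.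
- have /andP[H _] := Hx w erefl; have /andP[H' _] := Hy w' erefl.
  by move=> E; rewrite -(nth_index w H) -(nth_index w H') E.
- by have := rk_none (Hx w erefl) => /= ? ?; lia.
- by have := rk_none (Hy w' erefl) => /= ? ?; lia.
Qed.

Lemma wltN w m o : acc m w -> acc o w -> m <> o -> ~~ wlt w m o -> wlt w o m.
Proof.
case/andP=> _ Hm /andP[_ Ho] ne; rewrite /above -leqNgt leq_eqVlt => /orP[/eqP E|//].
by case: ne; rewrite -(nth_index m Hm) -(nth_index m Ho) E.
Qed.

Lemma blkP p m w :
  reflect [/\ acc m w, rk m (Some w) < rk m (p m) &
    forall o, oth w m = Some o -> p o = Some w -> ~~ wlt w o m] (blk p m w).
Proof.
apply: (iffP and3P) => -[H1 H2 H3]; split=> //.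
  by move=> o E Ep; move: H3; rewrite E; case: iswP.
by case E: (oth w m) => [o|] //; apply/nandP; case: iswP; [right; auto|left].
Qed.

Lemma blkNP p m w : acc m w -> rk m (Some w) < rk m (p m) -> ~~ blk p m w ->
  exists o, [/\ oth w m = Some o, p o = Some w & wlt w o m].
Proof.
move=> H1 H2; rewrite /blocks H1 H2 /=; case E: (oth w m) => [o|] //.
by rewrite negbK => /andP[/iswP Ep Hw]; exists o.
Qed.

Definition nb p := #|[set x | blk p x.1 x.2]|.

Lemma nb_le p p' : (forall m w, blk p' m w -> blk p m w) -> nb p' <= nb p.
Proof. by move=> H; apply: subset_leq_card; apply/subsetP => z; rewrite !inE; apply: H. Qed.

(** The form in which most exchanges are counted: at most one pair is gained and at least one is
    lost. *)
Lemma nb_le1 p p' m0 w0 :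
  (forall m w m' w', blk p' m w -> ~~ blk p m w -> blk p' m' w' -> ~~ blk p m' w' ->
     m = m' /\ w = w') ->
  blk p m0 w0 -> ~~ blk p' m0 w0 -> nb p' <= nb p.
Proof.
move=> H H1 H2; rewrite /nb; set A := [set x | _]; set B := [set x | _].
have HAB : #|A :\: B| <= 1.
  apply/card_le1P => -[m w]; rewrite !inE /= => /andP[h1 h2] [m' w'].
  rewrite !inE /=; apply/idP/eqP => [/andP[h3 h4]|[-> ->]]; last by rewrite h1 h2.
  by have [-> ->] := H _ _ _ _ h2 h1 h4 h3.
have HBA : 1 <= #|B :\: A| by apply/card_gt0P; exists (m0, w0); rewrite !inE /= H1 H2.
by have := cardsID B A; have := cardsID A B; rewrite setIC; lia.
Qed.

Hypothesis D2 : DeltaW I <= 2.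

Lemma size_wpref w : size (wpref I w) <= 2.
Proof. by apply: leq_trans D2; rewrite /DeltaW (bigD1 w) //= leq_maxl. Qed.

Lemma oth_acc w m o : oth w m = Some o -> acc o w /\ o <> m.
Proof.
rewrite /other /acceptable; set l := filter _ _.
have: all (fun o => [&& o \in wpref I w, o != m & w \in mpref I o]) l.
  by apply/allP => z; rewrite mem_filter => /andP[/andP[/= -> ->] ->].
by case: l => //= z l /andP[/and3P[h1 /eqP h2 h3] _] [<-]; rewrite h1 h3.
Qed.

Lemma oth_uniq w m o : acc m w -> acc o w -> m <> o -> oth w m = Some o.
Proof.
case/andP=> Hm1 Hm2 /andP[Ho1 Ho2] /eqP ne; rewrite /other.
case: (wpref I w) (size_wpref w) Hm2 Ho2 => [|a [|b [|]]] //= _.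
  by rewrite !inE => /eqP<- /eqP E; rewrite E eqxx in ne.
rewrite !inE => /orP[]/eqP Em /orP[]/eqP Eo; rewrite Em Eo ?eqxx // in ne Hm1 Ho1 *.
- by rewrite /= eq_sym ne Ho1.
- by rewrite /= eq_sym ne Ho1.
Qed.

Lemma acc2 w m o r : acc m w -> acc o w -> acc r w -> m <> o -> r <> m -> r = o.
Proof.
move=> Hm Ho Hr H1 H2; have E1 := oth_uniq Hm Ho H1.
by have := oth_uniq Hm Hr (fun e => H2 (esym e)); rewrite E1 => -[].
Qed.

Lemma oth_sym w m o : acc m w -> oth w m = Some o -> oth w o = Some m.
Proof. by move=> Hm /oth_acc[Ho ne]; apply: oth_uniq. Qed.

End Basics.

Section Stable.
Variables (M W : finType) (I : smc M W).
Hypothesis D2 : DeltaW I <= 2.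
Variable s : asg M W.
Implicit Types (m o a b : M) (w y : W) (p : M -> option W) (x : option W).

Notation acc := (acceptable I).
Notation rk := (rank I).
Notation oth := (other I).
Notation wlt := (above I).
Notation blk := (blocks I).
Notation asn := (asn I).
Notation sf := (get s).
Notation nxt := (nextm I s).

Hypothesis s_asn : asn sf.
Hypothesis s_st : forall m w, ~~ blk sf m w.

Lemma s_inj m m' w : sf m = Some w -> sf m' = Some w -> m = m'.
Proof. exact: (proj2 s_asn). Qed.

Lemma s_acc m w : sf m = Some w -> acc m w.
Proof. exact: (proj1 s_asn). Qed.

Lemma stab m w : acc m w -> rk m (Some w) < rk m (sf m) ->
  exists o, [/\ oth w m = Some o, sf o = Some w & wlt w o m].
Proof. by move=> H1 H2; apply: blkNP. Qed.

Lemma asn_okv p m : asn p -> okv I m (p m).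
Proof. by case=> H _ w; apply: H. Qed.

Lemma nxt_neq m : nxt m <> m -> exists w, sf m = Some w /\ oth w m = Some (nxt m).
Proof.
rewrite /nextm; case: (sf m) => [w|] //; case E: (oth w m) => [o|] // _.
by exists w.
Qed.

Lemma nxtE m w o : sf m = Some w -> oth w m = Some o -> nxt m = o.
Proof. by rewrite /nextm => -> ->. Qed.

(** The path continues after [m]: his [s]-partner went to the next man. Without the first conjunct
    an unchanged fixed point of [nextm] would follow itself. *)
Definition adv p m : bool := (nxt m != m) && (p (nxt m) == sf m).

Lemma advP p m : adv p m ->
  exists w, [/\ sf m = Some w, oth w m = Some (nxt m), p (nxt m) = Some w & nxt m <> m].
Proof.
case/andP=> /eqP /[dup] ne /nxt_neq[w [E1 E2]] /eqP E; exists w; split=> //.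
by rewrite E.
Qed.

Lemma hold_adv p m o w : asn p -> sf m = Some w -> p o = Some w -> o <> m ->
  adv p m /\ nxt m = o.
Proof.
move=> [Hp _] Em Eo ne.
have E : nxt m = o.
  by apply: (nxtE Em); apply: (oth_uniq D2) => //; [exact: s_acc|exact: Hp|exact: nesym].
by split=> //; rewrite /adv E Em Eo eqxx andbT; apply/eqP.
Qed.

Definition worse p m := rk m (sf m) < rk m (p m).

(** A worse-off man fails to block with his [s]-partner only if she is held by a man she ranks
    higher. That man cannot prefer her to his own [s]-partner, or the two would block [s]; so he is
    worse off as well. *)
Lemma worse_step p m : asn p -> worse p m ->
  (forall w, sf m = Some w -> ~~ blk p m w) -> adv p m /\ worse p (nxt m).
Proof.
move=> Hp; rewrite /worse; case Es: (sf m) => [w|] Hw Hb; last first.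
  case Ep: (p m) Hw => [w|] /=; last by rewrite ltnn.
  by have := rk_none ((proj1 Hp) _ _ Ep) => /= ? ?; lia.
have Ha := s_acc Es.
have [o [Eo Epo Hwo]] := blkNP Ha Hw (Hb w erefl).
have [Hao ne] := oth_acc Eo.
have [Hadv En] := hold_adv Hp Es Epo ne; split=> //; rewrite En Epo.
case: ltngtP => // [H|E]; last first.
  have Eso : sf o = Some w.
    by apply: (@rk_inj _ _ I o); [exact: asn_okv|move=> ? [<-]|exact: esym].
  by case: ne; apply: s_inj Eso Es.
have [o' [Eo' Es' Hw']] := stab Hao H.
by have E' := s_inj Es' Es; subst o'; case: (wlt_asym Hwo Hw').
Qed.

(* [m] holds a woman better than [sf m], and prefers to [sf m] also [w], who is
   unmatched although [sf] matches her. *)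
Definition absorbs p m w : bool :=
  [&& acc m w, rk m (p m) < rk m (Some w), rk m (Some w) < rk m (sf m) &
   if oth w m is Some o then p o != Some w else true].

Lemma absorbsP p m w : absorbs p m w ->
  exists o, [/\ oth w m = Some o, sf o = Some w, p o <> Some w, wlt w o m &
                nxt o = m /\ o <> m].
Proof.
case/and4P=> Ha H1 H2; have [o [Eo Es Hw]] := stab Ha H2; rewrite Eo => /eqP Hp.
have [_ ne] := oth_acc Eo.
exists o; split=> //; split=> //; apply: (nxtE Es).
exact: (oth_sym D2 Ha Eo).
Qed.

(** * Giving a closed set of men their partners in [s] back *)

Section Revert.
Variables (p : M -> option W) (S : pred M).
Hypothesis Hp : asn p.
Hypothesis Sadv : forall m, S m -> adv p m -> S (nxt m).
Hypothesis Sabs : forall m w, S m -> ~~ absorbs p m w.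

Definition revert m := if S m then sf m else p m.

Lemma asn_revert : asn revert.
Proof.
have H m o w : S m -> ~~ S o -> sf m = Some w -> p o = Some w -> m = o.
  move=> Hm Ho Em Eo; apply: NNPP => ne.
  by have [Ha En] := hold_adv Hp Em Eo (nesym ne); rewrite -En Sadv in Ho.
split=> [m w|m m' w]; rewrite /revert.
  by case: ifP => _; [exact: s_acc|exact: (proj1 Hp)].
case: ifP => Hm; case: ifP => Hm'.
- exact: s_inj.
- by move=> E E'; apply: (H m m' w); rewrite ?Hm'.
- by move=> E E'; symmetry; apply: (H m' m w); rewrite ?Hm.
- exact: (proj2 Hp).
Qed.

(** These are the women whom the reversal leaves single although [p] matches them; only they can
    gain a blocking pair. *)
Definition boundary w := exists o, [/\ S o, p o = Some w & forall m, S m -> sf m <> Some w].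

Lemma revert_new m w : blk revert m w -> ~~ blk p m w ->
  exists o, [/\ S o, p o = Some w, forall m', S m' -> sf m' <> Some w &
   (m = o /\ exists m1, [/\ acc m1 w, m1 <> o & wlt w m1 o]) \/ (m <> o /\ wlt w o m)].
Proof.
case/blkP; rewrite {1}/revert => Ha; case: ifP => Sm Hrk Ho Hb.
  have [m1 [E1 Es1 Hw1]] := stab Ha Hrk; have [Ha1 ne1] := oth_acc E1.
  have Hm1 : ~~ S m1.
    by apply/negP => Sm1; move: (Ho _ E1); rewrite /revert Sm1 Es1 Hw1 => /(_ erefl).
  have Hp1 : p m1 <> Some w.
    by move=> Hp1; move: (Ho _ E1); rewrite /revert (negbTE Hm1) Hp1 Hw1 => /(_ erefl).
  have Hle : rk m (p m) <= rk m (Some w).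
    rewrite leqNgt; apply/negP => H; move: Hb; case/negP; apply/blkP; split=> // o.
    by rewrite E1 => -[<-] /Hp1.
  move: Hle; rewrite leq_eqVlt => /orP[/eqP E|H].
    have Em : p m = Some w.
      by apply: (@rk_inj _ _ I m); [exact: asn_okv|move=> ? [<-]|exact: E].
    exists m; split=> //; last by left; split=> //; exists m1.
    by move=> m' Sm' E'; have E2 := s_inj Es1 E'; rewrite E2 Sm' in Hm1.
  (* What remains is exactly an absorption of [w] by [m]. *)
  case/negP: (Sabs w Sm); rewrite /absorbs Ha H Hrk E1 /=.
  by apply/eqP.
have [o [Eo Epo Hwo]] := blkNP Ha Hrk Hb; have [Hao neo] := oth_acc Eo.
have So : S o.
  by apply/negP => /negP So; move: (Ho _ Eo); rewrite /revert (negbTE So) Epo Hwo => /(_ erefl).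
exists o; split=> //; last by right; split=> // E; case: neo.
move=> m' Sm' Em'.
have ne' : m' <> o.
  by move=> E; subst m'; move: (Ho _ Eo); rewrite /revert So Em' Hwo => /(_ erefl).
have E : m = m' by apply: (acc2 D2 Hao (s_acc Em') Ha) => // [E|E];
  [case: ne'|case: neo; rewrite E].
by rewrite E Sm' in Sm.
Qed.

Lemma revert_nonew : (forall w, ~ boundary w) -> nb I revert <= nb I p.
Proof.
move=> H; apply: nb_le => m w Hb; apply/negPn/negP => /(revert_new Hb)[o [h1 h2 h3 _]].
by case: (H w); exists o.
Qed.

(** At one released woman the two alternatives of [revert_new] exclude each other: both speak of the
    only acceptable man besides her former holder, one placing him above the holder and one
    below. *)
Lemma revert_new1 w0 m0 z0 : (forall w, boundary w -> w = w0) ->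
  blk p m0 z0 -> ~~ blk revert m0 z0 -> nb I revert <= nb I p.
Proof.
move=> H; apply: nb_le1 => m w m' w' H1 H2 H3 H4.
have Ha : acc m w by case/blkP: H1.
have Ha' : acc m' w' by case/blkP: H3.
have [o [So Eo Ho K]] := revert_new H1 H2; have [o' [So' Eo' Ho' K']] := revert_new H3 H4.
have E : w = w0 by apply: H; exists o.
have E' : w' = w0 by apply: H; exists o'.
subst w w'; have Eoo := proj2 Hp _ _ _ Eo Eo'; subst o'; split=> //.
have Hao := proj1 Hp _ _ Eo.
case: K K' => [[-> [m1 [h1 h2 h3]]]|[n1 h1]] [[-> [m2 [g1 g2 g3]]]|[n2 g1]] //.
- have E : m1 = m' by apply: (acc2 D2 Hao Ha' h1) => // E; case: n2.
  by subst m1; case: (wlt_asym h3 g1).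
- have E : m2 = m by apply: (acc2 D2 Hao Ha g1) => // E; case: n1.
  by subst m2; case: (wlt_asym g3 h1).
- by apply: (acc2 D2 Hao Ha' Ha) => // E; case: n2.
Qed.

End Revert.

(** * Paths and cycles on which [p] differs from [s] *)

Definition upto p a n := forall j, j < n -> adv p (iter j nxt a).
Definition reach p a m := exists i, m = iter i nxt a /\ upto p a i.
Definition entry p a := p a <> sf a /\ forall m w, p a = Some w -> sf m <> Some w.
Definition pend p a l := upto p a l /\ ~~ adv p (iter l nxt a).
(** Defined as the changed men on no path; that they lie on cycles of [nextm] is the content of
    [cyc_step]. *)
Definition cyc p m := p m <> sf m /\ forall a, entry p a -> ~ reach p a m.

Lemma uptoW p a (i n : nat) : i <= n -> upto p a n -> upto p a i.
Proof. by move=> H U j Hj; apply: U; apply: leq_trans H. Qed.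

Lemma adv_eq p m : adv p m -> p (nxt m) = sf m.
Proof. by case/advP=> w [-> _ -> _]. Qed.

Lemma pred_uniq p m m' : adv p m -> adv p m' -> nxt m = nxt m' -> m = m'.
Proof.
case/advP=> w [E _ Ep _] /advP[w' [E' _ Ep' _]] En; apply: s_inj E _.
by rewrite E' -Ep' -En Ep.
Qed.

Lemma entry_nopred p a m : entry p a -> adv p m -> nxt m <> a.
Proof. by move=> [_ H] /advP[w [E _ Ep _]] En; apply: (H m w); rewrite -?En. Qed.

(** Predecessors on paths are unique and an entry has none, so a repetition could be pulled back to
    the entry. *)
Lemma iter_inj p a l i j : entry p a -> upto p a l -> i <= l -> j <= l ->
  iter i nxt a = iter j nxt a -> i = j.
Proof.
move=> He U; elim: i j => [|i IHi] [|j] //= Hi Hj E.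
- by case: (entry_nopred He (U j Hj)).
- by case: (entry_nopred He (U i Hi)).
by congr _.+1; apply: IHi (ltnW Hi) (ltnW Hj) (pred_uniq (U _ Hi) (U _ Hj) E).
Qed.

Lemma entry_end p a : entry p a -> exists l, pend p a l.
Proof.
move=> He; apply: NNPP => H.
have U n : upto p a n.
  elim: n => [|n IHn] j //; rewrite ltnS leq_eqVlt => /orP[/eqP->|]; last exact: IHn.
  by apply/negPn/negP => Hn; apply: H; exists n.
have /leq_card : injective (fun i : 'I_(#|M|.+1) => iter i nxt a).
  move=> i j /(iter_inj He (U #|M|)) E; apply: val_inj; apply: E; rewrite -ltnS //.
by rewrite card_ord ltnn.
Qed.

Lemma touched p a i : entry p a -> upto p a i -> p (iter i nxt a) <> sf (iter i nxt a).
Proof.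
case: i => [[]|i] //= He U E; have /advP[w [Es _ Ep ne]] := U i (leqnn _).
by apply: ne; apply: s_inj Es; rewrite -E.
Qed.

Lemma reach0 p a : reach p a a.
Proof. by exists 0. Qed.

Lemma reach_next p a m : reach p a m -> adv p m -> reach p a (nxt m).
Proof.
case=> i [-> U] Ha; exists i.+1; split=> // j.
by rewrite ltnS leq_eqVlt => /orP[/eqP->|]; last exact: U.
Qed.

Lemma reach_back p a m : entry p a -> reach p a (nxt m) -> adv p m -> reach p a m.
Proof.
move=> He [[|i] [/= E U]] Ha; first by case: (entry_nopred He Ha).
have -> : m = iter i nxt a by apply: pred_uniq Ha (U i (leqnn _)) E.
by exists i; split=> //; apply: uptoW U.
Qed.

Lemma reach_uniq p a b m : entry p a -> entry p b -> reach p a m -> reach p b m -> a = b.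
Proof.
move=> Ha Hb [i [-> U]]; elim: i U => [|i IHi] U.
  by case=> [[|j] [/= E V]] //; case: (entry_nopred Ha (V j (leqnn _))).
move=> H; apply: IHi; first exact: uptoW U.
by apply: reach_back Hb H _; exact: U.
Qed.

Lemma reach_end p a l m : entry p a -> pend p a l -> reach p a m ->
  exists2 i, i <= l & m = iter i nxt a.
Proof.
move=> He [_ Hl] [i [E U]]; exists i => //; rewrite leqNgt; apply/negP => H.
by rewrite U in Hl.
Qed.

Lemma pend_reach p a l i : pend p a l -> i <= l -> reach p a (iter i nxt a).
Proof. by case=> U _ H; exists i; split=> //; apply: uptoW U. Qed.

Lemma cyc_pred p m : asn p -> cyc p m -> exists m', [/\ adv p m', nxt m' = m & cyc p m'].
Proof.
move=> Hp [ne Hr].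
have /not_and_or[//|] : ~ entry p m by move=> He; exact: Hr He (reach0 _ _).
move=> /not_all_ex_not[m' /not_all_ex_not[w H]].
have [Ep /NNPP Es] := imply_to_and _ _ H.
have nm : m <> m' by move=> E; apply: ne; rewrite Ep E.
have [Ha En] := hold_adv Hp Es Ep nm; exists m'; split=> //; split.
  by rewrite Es => Ep'; case: nm; apply: (proj2 Hp) Ep Ep'.
by move=> a He Hm; apply: (Hr a He); rewrite -En; apply: reach_next.
Qed.

(** Every man of [cyc] has a predecessor in [cyc]. A chain of [#|M|] predecessors of [m] repeats a
    man, and going forward from both occurrences shows that [m] himself recurs. *)
Lemma cyc_step p m : asn p -> cyc p m ->
  [/\ adv p m, cyc p (nxt m) & exists2 k, 0 < k & iter k nxt m = m].
Proof.
move=> Hp Hm.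
have H n : exists t : nat -> M, t 0 = m /\
    forall i, i < n -> [/\ adv p (t i.+1), nxt (t i.+1) = t i & cyc p (t i.+1)].
  elim: n => [|n [t [t0 Ht]]]; first by exists (fun=> m).
  have Hc : cyc p (t n) by case: n Ht => [|n] Ht; [rewrite t0|case: (Ht n)].
  have [m' [h1 h2 h3]] := cyc_pred Hp Hc.
  exists (fun i => if i <= n then t i else m'); split=> // i; rewrite ltnS => Hi.
  rewrite Hi; case: ltnP => Hi'; first by apply: Ht.
  by have -> : i = n by apply/eqP; rewrite eqn_leq Hi Hi'.
have [t [t0 Ht]] := H #|M|.
have Hit i d : i + d <= #|M| -> iter i nxt (t (i + d)) = t d.
  elim: i => [|i IHi] //= Hd; rewrite -IHi; last by apply: ltnW.
  by rewrite addSn -iterS iterSr; case: (Ht (i + d) Hd) => _ ->.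
have [i [j [Hij Hj E]]] : exists i j, [/\ i < j, j <= #|M| & t i = t j].
  apply: NNPP => Hn.
  have /leq_card : injective (fun i : 'I_(#|M|.+1) => t i).
    move=> i j E; apply: val_inj; case: (ltngtP i j) => // Hij; case: Hn.
      by exists i, j; split=> //; rewrite -ltnS.
    by exists j, i; split=> //; rewrite -ltnS.
  by rewrite card_ord ltnn.
have Hk : t (j - i) = m.
  have Hi : i <= #|M| by apply: leq_trans Hj; apply: ltnW.
  rewrite -(Hit i) subnKC ?(ltnW Hij) // -E.
  by have := Hit i 0; rewrite addn0 t0; apply.
have Hji : 0 < j - i by rewrite subn_gt0.
have Hk' : iter (j - i) nxt (t (j - i)) = m.
  by have := Hit (j - i) 0; rewrite addn0 t0; apply; lia.
have [|h1 h2 h3] := Ht (j - i).-1; first by lia.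
move: h1 h2 h3; rewrite prednK // Hk => h1 h2 h3.
split=> //; last by exists (j - i) => //; rewrite -{1}Hk.
have Hc n : n <= #|M| -> cyc p (t n) by case: n => [|n] H'; [rewrite t0|case: (Ht n H')].
by rewrite h2; apply: Hc; lia.
Qed.

Lemma cyc_iter p m j : asn p -> cyc p m -> cyc p (iter j nxt m) /\ adv p (iter j nxt m).
Proof.
move=> Hp Hm; have H : cyc p (iter j nxt m).
  by elim: j => //= j IHj; have [] := cyc_step Hp IHj.
by split=> //; have [] := cyc_step Hp H.
Qed.

(** * Minimal feasible assignments *)

Definition fea p := [/\ asn p, forall m, m \in mstar I -> p m <> None
  & forall w, w \in wstar I -> exists m, p m = Some w].
(* As the ranks add up to less than [bigw], [wt] counts first the men who leave
   their [sf]-partner. *)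
Definition bigw := (\sum_(m : M) size (mpref I m)).+1.
Definition wterm p m := if p m == sf m then 0 else bigw + rk m (p m).
Definition wt p := \sum_(m : M) wterm p m.
Definition nice p := fea p /\
  forall p', fea p' -> nb I p <= nb I p' /\ (nb I p' <= nb I p -> wt p <= wt p').

Lemma rk_bigw m x : rk m x < bigw.
Proof.
rewrite ltnS (bigD1 m) //=; apply: leq_trans (leq_addr _ _).
by case: x => [w|] //=; apply: index_size.
Qed.

Lemma nice_no p p' : nice p -> fea p' -> nb I p' <= nb I p -> wt p' < wt p -> False.
Proof. by case=> _ H Hf Hn; have [_ /(_ Hn)] := H _ Hf; rewrite leqNgt => /negP. Qed.

Lemma wt_lt p p' m0 : (forall m, wterm p' m <= wterm p m) ->
  wterm p' m0 < wterm p m0 -> wt p' < wt p.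
Proof.
move=> H H0; rewrite /wt (bigD1 m0) //= [X in _ < X](bigD1 m0) //= -addSn.
by apply: leq_add => //; apply: leq_sum.
Qed.

(** Restoring [a] saves at least [bigw], which exceeds whatever the rank at [b] can add. *)
Lemma wt_redirect p p' a b : a <> b -> p a <> sf a -> p b <> sf b -> p' a = sf a ->
  (forall m, m <> b -> wterm p' m <= wterm p m) -> wt p' < wt p.
Proof.
move=> /eqP ne /eqP Ha /eqP Hb Ha' H; rewrite /wt (bigD1 a) //= (bigD1 b) 1?eq_sym //=.
rewrite [X in _ < X](bigD1 a) //= [X in _ < _ + X](bigD1 b) 1?eq_sym //=.
have : \sum_(i | (i != a) && (i != b)) wterm p' i
    <= \sum_(i | (i != a) && (i != b)) wterm p i.
  by apply: leq_sum => i /andP[_ /eqP]; exact: H.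
rewrite /wterm (negbTE Ha) (negbTE Hb) Ha' eqxx.
by case: ifP => _; have := rk_bigw b (p' b); lia.
Qed.

Lemma fea_revert p (S : pred M) : fea p ->
  (forall m, S m -> adv p m -> S (nxt m)) ->
  (forall m w, S m -> p m = Some w -> w \in wstar I -> exists2 m', S m' & sf m' = Some w) ->
  (forall m, S m -> m \in mstar I -> sf m <> None) -> fea (revert p S).
Proof.
case=> Hp HM HW Sadv HS HSM; split; first exact: asn_revert.
  by move=> m Hm; rewrite /revert; case: ifP => Sm; [apply: HSM|apply: HM].
move=> w Hw; have [m Em] := HW w Hw; case Sm: (S m).
  by have [m' Sm' Em'] := HS m w Sm Em Hw; exists m'; rewrite /revert Sm'.
by exists m; rewrite /revert Sm.
Qed.

Lemma wt_revert p (S : pred M) m : S m -> p m <> sf m -> wt (revert p S) < wt p.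
Proof.
move=> Sm /eqP Hm; apply: (@wt_lt _ _ m) => [m'|]; rewrite /wterm /revert.
  by case: (S m'); rewrite ?eqxx.
by rewrite Sm eqxx (negbTE Hm).
Qed.

(** Used contrapositively: if the path stops, or reaches a man who is not worse off, then an earlier
    man on it blocks with his own [s]-partner. *)
Lemma worse_chain p a n : asn p -> worse p a ->
  (forall j w, j < n -> sf (iter j nxt a) = Some w -> ~~ blk p (iter j nxt a) w) ->
  upto p a n /\ worse p (iter n nxt a).
Proof.
move=> Hp Ha; elim: n => [|n IHn] H //.
have [U Hw] : upto p a n /\ worse p (iter n nxt a).
  by apply: IHn => j w Hj; apply: H; apply: ltnW.
have [h1 h2] := worse_step Hp Hw (fun w => H n w (leqnn _)).
by split=> // j; rewrite ltnS leq_eqVlt => /orP[/eqP->|]; last exact: U.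
Qed.

(** If [a] preferred a woman unmatched in [s] to his [s]-partner, the two would block [s]. *)
Lemma entry_worse p a : asn p -> entry p a -> worse p a.
Proof.
move=> Hp [ne H]; rewrite /worse ltnNge; apply/negP => Hle.
case E: (p a) => [w|]; last first.
  case Es: (sf a) => [w|]; last by rewrite E Es in ne.
  by have := rk_none (s_acc Es); move: Hle; rewrite E Es /= => ? ?; lia.
have Ha := proj1 Hp _ _ E.
move: Hle; rewrite leq_eqVlt => /orP[/eqP Er|Hlt].
  by apply: ne; apply: rk_inj Er; apply: asn_okv.
by rewrite E in Hlt; have [o [_ Es _]] := stab Ha Hlt; case: (H o w).
Qed.

(** * Rerouting the beginning of a path *)

Section Redirect.
Variables (p : M -> option W) (a : M) (i : nat) (x : W).
Let b := iter i nxt a.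
Hypothesis Hp : asn p.
Hypothesis He : entry p a.
Hypothesis U : upto p a i.
Hypothesis Hbx : acc b x.
Hypothesis Hx : forall m, p m <> Some x.
Hypothesis Habs : forall j w, j < i -> ~~ absorbs p (iter j nxt a) w.

Let S m := [exists j : 'I_i, m == iter j nxt a].

(** The men before [b] return to [s], and the path now starts at [b] with a woman nobody held. *)
Definition redirect m := if m == b then Some x else if S m then sf m else p m.

Let SP m : reflect (exists2 j, j < i & m = iter j nxt a) (S m).
Proof.
apply: (iffP existsP) => [[j /eqP->]|[j Hj ->]]; first by exists j.
by exists (Ordinal Hj).
Qed.

Let Sb : ~~ S b.
Proof.
by apply/SP => -[j Hj E]; have := iter_inj He U (leqnn i) (ltnW Hj) E; lia.
Qed.

Let redS m : S m -> redirect m = sf m.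
Proof.
by move=> Sm; rewrite /redirect Sm; case: eqP => // E; rewrite E (negbTE Sb) in Sm.
Qed.

Let redb : redirect b = Some x.
Proof. by rewrite /redirect eqxx. Qed.

Let redN m : ~~ S m -> m <> b -> redirect m = p m.
Proof. by move=> /negbTE Sm /eqP/negbTE nb; rewrite /redirect nb Sm. Qed.

(* A man of the rerouted part gets his [p]-partner from [a] or from a man whose
   [sf]-partner is restored. *)
Let origin m : S m \/ m = b -> m = a \/ exists m', [/\ S m', adv p m' & nxt m' = m].
Proof.
have H j : j <= i -> iter j nxt a = a \/
    exists m', [/\ S m', adv p m' & nxt m' = iter j nxt a].
  case: j => [|j] Hj; [by left|right].
  by exists (iter j nxt a); split=> //; [apply/SP; exists j|exact: U].
by case=> [/SP[j Hj ->]|->]; [apply: H; apply: ltnW|apply: H].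
Qed.

Let restored m w : (S m \/ m = b) -> m <> a -> p m = Some w ->
  exists2 m', S m' & sf m' = Some w /\ m' <> m.
Proof.
case/origin=> [//|[m' [Sm Ha En]]] _ Em; exists m' => //.
by split; [rewrite -(adv_eq Ha) En|rewrite -En; case/advP: Ha => ? [_ _ _ ne] /esym].
Qed.

Let touchedS m : S m \/ m = b -> p m <> sf m.
Proof.
case=> [/SP[j Hj ->]|->]; apply: touched => //.
by apply: uptoW U; apply: ltnW.
Qed.

Lemma asn_redirect : asn redirect.
Proof.
have H m o w : S m -> ~~ S o -> o <> b -> sf m = Some w -> p o = Some w -> False.
  move=> Sm So ob Em Eo.
  have ne : o <> m by move=> E; rewrite E Sm in So.
  have [_ En] := hold_adv Hp Em Eo ne; case/SP: Sm => j Hj Ej.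
  move: En; rewrite Ej -iterS => Eo'.
  move: Hj; rewrite leq_eqVlt => /orP[/eqP Hj|Hj].
    by apply: ob; rewrite -Eo' Hj.
  by move/negP: So; apply; apply/SP; exists j.+1.
have Hxs m : S m -> sf m <> Some x.
  case/SP=> j Hj ->; have /advP[w [E _ Ep _]] := U Hj.
  by rewrite E => -[Ew]; apply: Hx; rewrite -Ew; exact: Ep.
split=> [m w|m m' w].
  case: (boolP (S m)) => Sm; first by rewrite redS //; exact: s_acc.
  case: (eqVneq m b) => [->|/eqP mb]; first by rewrite redb => -[<-].
  by rewrite redN //; exact: (proj1 Hp).
case: (boolP (S m)) => Sm; case: (boolP (S m')) => Sm'.
- by rewrite !redS //; exact: s_inj.
- case: (eqVneq m' b) => [->|/eqP mb].
    by rewrite redS // redb => E [Ew]; case: (Hxs _ Sm); rewrite Ew.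
  by rewrite redS // redN // => E E'; case: (H m m' w).
- case: (eqVneq m b) => [->|/eqP mb].
    by rewrite (redS Sm') redb => [[Ew]] E; case: (Hxs _ Sm'); rewrite Ew.
  by rewrite (redS Sm') redN // => E E'; case: (H m' m w).
case: (eqVneq m b) => [->|/eqP mb]; case: (eqVneq m' b) => [->|/eqP mb'] //.
- by rewrite redb redN // => -[<-] /Hx.
- by rewrite redb redN // => E [Ew]; case: (@Hx m); rewrite Ew.
- by rewrite !redN //; exact: (proj2 Hp).
Qed.

Lemma fea_redirect : fea p -> (forall w, p a = Some w -> w \notin wstar I) -> fea redirect.
Proof.
move=> [_ HM HW] Ha; split; first exact: asn_redirect.
  move=> m Hm; case: (boolP (S m)) => Sm.
    by rewrite redS //; case/SP: Sm => j Hj ->; have /advP[w [->]] := U Hj.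
  case: (eqVneq m b) => [->|/eqP mb]; first by rewrite redb.
  by rewrite redN //; exact: HM.
move=> w Hw; have [m Em] := HW w Hw.
case: (boolP (S m || (m == b))) => Sm.
  have Sm' : S m \/ m = b by case/orP: Sm => [|/eqP]; [left|right].
  have nma : m <> a by move=> E; move: (Ha w); rewrite -E Em Hw => /(_ erefl).
  by have [m' Sm2 [E _]] := restored Sm' nma Em; exists m'; rewrite redS.
by case/norP: Sm => Sm /eqP mb; exists m; rewrite redN.
Qed.

(** A pair gained by a restored man would be with a woman he absorbs, which is excluded, or with the
    one [p] gave him; but she is back with the man before him, or was unmatched in [s] if [m] is
    [a]. *)
Lemma redirect_newS m w : S m -> blk redirect m w -> blk p m w.
Proof.
move=> Sm /blkP[Ha]; rewrite redS // => Hrk Ho.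
have [o [Eo Es Hw]] := stab Ha Hrk; have [Hao ne] := oth_acc Eo.
have So : ~~ S o.
  by apply/negP => So; move: (Ho _ Eo); rewrite redS // Es Hw => /(_ erefl).
have Hpo : p o <> Some w.
  move=> Epo; case: (eqVneq o b) => [E|/eqP ob].
    by apply: (touchedS (or_intror E)); rewrite Es.
  by move: (Ho _ Eo); rewrite redN // Epo Hw => /(_ erefl).
apply/negPn/negP => Hb.
have Hle : rk m (p m) <= rk m (Some w).
  rewrite leqNgt; apply/negP => H; move: Hb; case/negP; apply/blkP; split=> // o'.
  by rewrite Eo => -[<-] /Hpo.
move: Hle; rewrite leq_eqVlt => /orP[/eqP E|H]; last first.
  case/SP: (Sm) => j Hj Ej; case/negP: (Habs w Hj); rewrite /absorbs -Ej Ha H Hrk Eo /=.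
  exact/eqP.
have Em : p m = Some w.
  by apply: (@rk_inj _ _ I m); [exact: asn_okv|move=> ? [<-]|exact: E].
case: (eqVneq m a) => [E'|/eqP ma].
  by case: He => _ /(_ o w); rewrite -E' Em Es => /(_ erefl).
have [m' Sm' [E' _]] := restored (or_introl Sm) ma Em.
by rewrite (s_inj Es E') Sm' in So.
Qed.

(** Only the partner of [a] is released: every other woman whom the rerouted men give up returns to
    her [s]-partner among them. *)
Lemma redirect_newN m w : ~~ S m -> m <> b -> blk redirect m w -> ~~ blk p m w ->
  p a = Some w /\ m <> a.
Proof.
move=> Sm mb /blkP[Ha]; rewrite redN // => Hrk Ho Hb.
have [o [Eo Epo Hwo]] := blkNP Ha Hrk Hb; have [Hao neo] := oth_acc Eo.
have So : S o \/ o = b.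
  case: (boolP (S o)) => So; [by left|right].
  apply: NNPP => ob; move: (Ho _ Eo); rewrite redN // Epo Hwo => /(_ erefl) //.
case: (eqVneq o a) => [E|/eqP oa]; first by rewrite -E; split=> // /esym.
have [m' Sm' [Em' ne]] := restored So oa Epo.
have E : m = m'.
  by apply: (acc2 D2 Hao (s_acc Em') Ha (nesym ne)) => E; case: neo.
by rewrite E Sm' in Sm.
Qed.

(** For the case that [x] is the best woman absorbed by [b]: any better one with whom he newly
    blocked would be absorbed too. *)
Lemma redirect_new_best w : rk b (Some x) < rk b (sf b) ->
  (forall w', rk b (Some w') < rk b (Some x) -> ~~ absorbs p b w') ->
  b <> a -> blk redirect b w -> blk p b w.
Proof.
move=> Hxs Hbest ba /blkP[Ha]; rewrite redb => Hrk Ho.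
have Hrk' := ltn_trans Hrk Hxs.
have [o [Eo Es Hw]] := stab Ha Hrk'; have [Hao ne] := oth_acc Eo.
have So : ~~ S o.
  by apply/negP => So; move: (Ho _ Eo); rewrite redS // Es Hw => /(_ erefl).
have Hpo : p o <> Some w.
  by move=> Epo; move: (Ho _ Eo); rewrite redN // Epo Hw => /(_ erefl).
apply/negPn/negP => Hb.
have Hle : rk b (p b) <= rk b (Some w).
  rewrite leqNgt; apply/negP => H; move: Hb; case/negP; apply/blkP; split=> // o'.
  by rewrite Eo => -[<-] /Hpo.
move: Hle; rewrite leq_eqVlt => /orP[/eqP E|H].
  have Em : p b = Some w.
    by apply: (@rk_inj _ _ I b); [exact: asn_okv|move=> ? [<-]|exact: E].
  have [m' Sm' [E' _]] := restored (or_intror erefl) ba Em.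
  by rewrite (s_inj Es E') Sm' in So.
case/negP: (Hbest w Hrk); rewrite /absorbs Ha H Hrk' Eo /=.
exact/eqP.
Qed.

(** For the case that [b] improves on his partner in [p]: he can only gain a pair with a woman who
    became available, and that is the one released by [a]. *)
Lemma redirect_new_cut w : rk b (Some x) < rk b (p b) ->
  blk redirect b w -> ~~ blk p b w -> p a = Some w /\ b <> a.
Proof.
move=> Hxp /blkP[Ha]; rewrite redb => Hrk Ho Hb.
have [o [Eo Epo Hwo]] := blkNP Ha (ltn_trans Hrk Hxp) Hb; have [Hao neo] := oth_acc Eo.
have So : S o.
  case: (boolP (S o)) => // So; move: (Ho _ Eo).
  by rewrite redN // Epo Hwo => /(_ erefl).
case: (eqVneq o a) => [E|/eqP oa]; first by rewrite -E; split=> // /esym.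
have [m' Sm' [Em' ne]] := restored (or_introl So) oa Epo.
have E : b = m' by apply: (acc2 D2 Hao (s_acc Em') Ha (nesym ne)) => E; case: neo.
by move: Sb; rewrite E Sm'.
Qed.

(** All new pairs are at the partner of [a], with a man other than [a], and only one such man is
    acceptable. *)
Lemma redirect_nb m0 w0 :
  (forall w, blk redirect b w -> ~~ blk p b w -> p a = Some w /\ b <> a) ->
  blk p m0 w0 -> ~~ blk redirect m0 w0 -> nb I redirect <= nb I p.
Proof.
move=> Hb; apply: nb_le1 => m w m' w' H1 H2 H3 H4.
have K n y : blk redirect n y -> ~~ blk p n y -> p a = Some y /\ n <> a.
  move=> h1 h2; case: (boolP (S n)) => Sn; first by rewrite redirect_newS in h2.
  case: (eqVneq n b) => [E|/eqP nb]; last exact: redirect_newN.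
  by move: h1 h2; rewrite E; exact: Hb.
have [E1 n1] := K _ _ H1 H2; have [E2 n2] := K _ _ H3 H4.
move: E2; rewrite E1 => -[E]; subst w'; split=> //.
case/blkP: H1 => Ha1 _ _; case/blkP: H3 => Ha2 _ _.
by apply: (acc2 D2 (proj1 Hp _ _ E1) Ha2 Ha1) => // /esym.
Qed.

(** If the path is cut at its first man, nobody is restored, and the weight has to drop through his
    rank. *)
Lemma wt_redirect_lt : (b = a -> rk b (Some x) < rk b (p b)) -> wt redirect < wt p.
Proof.
move=> H; have Tb := touchedS (or_intror erefl).
have Hm m : m <> b -> wterm redirect m <= wterm p m.
  move=> mb; case: (boolP (S m)) => Sm; rewrite /wterm ?(redS Sm) ?eqxx //.
  by rewrite redN.
case: (eqVneq a b) => [E|/eqP ab].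
  apply: (@wt_lt _ _ b); last first.
    rewrite /wterm redb; move/eqP/negbTE: Tb => ->; case: ifP => _; first by rewrite addSn.
    by rewrite ltn_add2l; apply: H.
  move=> m; case: (eqVneq m b) => [->|/eqP]; last exact: Hm.
  rewrite /wterm redb; move/eqP/negbTE: Tb => ->; case: ifP => _ //.
  by rewrite leq_add2l; apply/ltnW/H.
apply: (wt_redirect ab) => //; first by case: He.
apply: redS; apply/SP; exists 0 => //; rewrite lt0n; apply/eqP => i0.
by apply: ab; rewrite /b i0.
Qed.

End Redirect.

(** * Shape of a minimal solution *)

Section Nice.
Variable p : M -> option W.
Hypothesis Hn : nice p.

Let Hf : fea p. Proof. by case: Hn. Qed.
Let Hp : asn p. Proof. by case: Hf. Qed.

Definition nentry a := entry p a /\ forall w, p a = Some w -> w \notin wstar I.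

(** At the first absorbing man [b], let the path start anew with the woman [x] he likes best among
    those he absorbs. Since [a] is worse off than in [s] and [b] is not, some man before [b] blocks
    with his [s]-partner, and this pair disappears. *)
Lemma row_noabs a i w : nentry a -> upto p a i -> ~~ absorbs p (iter i nxt a) w.
Proof.
move=> [He Hnd]; have [n Hni] := ubnP i; elim: n i Hni w => // n IHn i Hni w U.
apply/negP => Hab.
have Habs j w' : j < i -> ~~ absorbs p (iter j nxt a) w'.
  by move=> Hj; apply: IHn; [lia|apply: uptoW U; apply: ltnW].
set b := iter i nxt a in Hab.
have [x Hx Hmin] := arg_minnP (fun w => rk b (Some w)) Hab.
have [o [Eo Es Epo Hwo [_ _]]] := absorbsP Hx.
case/and4P: (Hx) => Ha H1 H2 _.
have Hun m : p m <> Some x.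
  move=> Em; case: (eqVneq m b) => [E|/eqP mb]; first by rewrite -E Em ltnn in H1.
  have E : m = o by apply: (acc2 D2 Ha (proj1 (oth_acc Eo)) (proj1 Hp _ _ Em)) => //;
    exact/nesym/(proj2 (oth_acc Eo)).
  by apply: Epo; rewrite -E.
have Hw := entry_worse Hp He.
have ba : b <> a by move=> E; move: Hw; rewrite /worse -E; lia.
have [j [y [Hj Ey Hby]]] : exists j y, [/\ j < i, sf (iter j nxt a) = Some y
    & blk p (iter j nxt a) y].
  apply: NNPP => Hno; have [_] : upto p a i /\ worse p (iter i nxt a).
    apply: worse_chain => // j y Hj Ey; apply/negP => Hby; apply: Hno; by exists j, y.
  by rewrite /worse -/b; lia.
apply: (nice_no Hn (fea_redirect Hp He U Ha Hun Hf Hnd)).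
  apply: (redirect_nb Hp He U Ha Habs _ Hby).
    move=> z h1 h2; case/negP: h2; apply: (redirect_new_best Hp He U Ha H2 _ ba h1).
    by move=> w' Hw'; apply/negP => /Hmin; rewrite leqNgt Hw'.
  apply/negP => /blkP[_]; rewrite /redirect.
  case: eqP => [E|_]; first by have := iter_inj He U (ltnW Hj) (leqnn i) E; lia.
  case: existsP => [_|[]]; last by exists (Ordinal Hj).
  by rewrite Ey ltnn.
apply: wt_redirect_lt => //; exact: U.
Qed.

(** Otherwise the path could be cut at this man, who takes [y]; their blocking pair is the one that
    disappears. *)
Lemma row_nowant a i y : nentry a -> upto p a i -> acc (iter i nxt a) y ->
  (forall m, sf m <> Some y) ->
  rk (iter i nxt a) (Some y) < rk (iter i nxt a) (p (iter i nxt a)) ->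
  exists m, p m = Some y.
Proof.
move=> Ha U Hay Hs Hrk; apply: NNPP => Hno.
have [He Hnd] := Ha.
have Hun m : p m <> Some y by move=> E; apply: Hno; exists m.
have Habs j w : j < i -> ~~ absorbs p (iter j nxt a) w.
  by move=> Hj; apply: row_noabs => //; apply: uptoW U; apply: ltnW.
have Hby : blk p (iter i nxt a) y by apply/blkP; split=> // o _ /Hun.
apply: (nice_no Hn (fea_redirect Hp He U Hay Hun Hf Hnd)).
  apply: (redirect_nb Hp He U Hay Habs _ Hby).
    by move=> z; apply: redirect_new_cut.
  by apply/negP => /blkP[_]; rewrite /redirect eqxx ltnn.
exact: wt_redirect_lt.
Qed.

(** With any other end the whole path could be reverted. As the path stops, some man on it blocks
    with his [s]-partner, and this loss pays for the single pair that may arise at the woman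
    released by [a]. *)
Lemma row_end a l : nentry a -> pend p a l ->
  iter l nxt a \in mstar I /\ sf (iter l nxt a) = None.
Proof.
move=> Ha Hl; apply: NNPP => Hno; have [He Hnd] := Ha; have [U Hadv] := Hl.
pose S m := [exists j : 'I_l.+1, m == iter j nxt a].
have SP m : reflect (exists2 j, j <= l & m = iter j nxt a) (S m).
  apply: (iffP existsP) => [[j /eqP->]|[j Hj ->]]; first by exists j => //; rewrite -ltnS.
  have Hj' : j < l.+1 by []. by exists (Ordinal Hj').
have Sadv m : S m -> adv p m -> S (nxt m).
  move=> /SP[j Hj ->] Hj'; apply/SP; exists j.+1 => //.
  by rewrite ltn_neqAle Hj andbT; apply/eqP => E; rewrite -E Hj' in Hadv.
have Sabs m w : S m -> ~~ absorbs p m w.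
  by move=> /SP[j Hj ->]; apply: row_noabs => //; apply: uptoW U.
have [j [y [Hj Ey Hby]]] : exists j y, [/\ j <= l, sf (iter j nxt a) = Some y
    & blk p (iter j nxt a) y].
  apply: NNPP => H.
  have [] : upto p a l.+1 /\ worse p (iter l.+1 nxt a).
    apply: worse_chain => //; first exact: entry_worse.
    by move=> j y Hj Ey; apply/negP => Hby; apply: H; exists j, y.
  by move=> /(_ l (leqnn _)) H'; rewrite H' in Hadv.
have Hfr : fea (revert p S).
  apply: fea_revert => // [m w /SP[[|i] Hi ->] Em Hw|m /SP[i Hi ->] Hm Es].
  - by move: (Hnd w Em); rewrite Hw.
  - have Hi' := U i Hi; exists (iter i nxt a); first by apply/SP; exists i => //; apply: ltnW.
    by rewrite -(adv_eq Hi').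
  case: Hno; move: Hi; rewrite leq_eqVlt => /orP[/eqP E|Hi]; first by rewrite -E.
  by have /advP[w [E _ _ _]] := U i Hi; rewrite E in Es.
(* If [a] became single, the reversal releases no woman and no lost pair is needed. *)
case Epa: (p a) => [z0|]; last first.
  apply: (nice_no Hn Hfr).
    apply: revert_nonew => // w [o [/SP[[|i] Hi Eo] Ew H]].
      by rewrite Eo /= Epa in Ew.
    have Hi' := U i Hi; apply: (H (iter i nxt a)); first by apply/SP; exists i => //; apply: ltnW.
    by rewrite -(adv_eq Hi') -Ew Eo.
  by apply: (@wt_revert _ _ a); [apply/SP; exists 0|case: He].
apply: (nice_no Hn Hfr).
  apply: (revert_new1 Hp Sabs (w0 := z0) _ Hby).
    move=> w [o [/SP[[|i] Hi Eo] Ew H]].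
      by move: Ew; rewrite Eo /= Epa => -[].
    have Hi' := U i Hi; case: (H (iter i nxt a)).
      by apply/SP; exists i => //; apply: ltnW.
    by rewrite -(adv_eq Hi') -Ew Eo.
  apply/negP => /blkP[_]; rewrite /revert.
  have -> : S (iter j nxt a) by apply/SP; exists j.
  by rewrite Ey ltnn.
by apply: (@wt_revert _ _ a); [apply/SP; exists 0|case: He].
Qed.

End Nice.

(** * Cycles, and paths that start with a distinguished woman *)

Section Tokens.
Variable p : M -> option W.
Hypothesis Hn : nice p.

Let Hf : fea p. Proof. by case: Hn. Qed.
Let Hp : asn p. Proof. by case: Hf. Qed.

Definition token a := entry p a /\ exists2 w, p a = Some w & w \in wstar I.

Lemma entry_cases a : entry p a -> token a \/ nentry p a.
Proof.
move=> He; case: (classic (exists2 w, p a = Some w & w \in wstar I)) => H; first by left.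
by right; split=> // w Ew; apply/negP => Hw; apply: H; exists w.
Qed.

Lemma token_nentry a : token a -> ~ nentry p a.
Proof. by move=> [_ [w Ew Hw]] [_ /(_ w Ew)]; rewrite Hw. Qed.

Lemma touched_cases m : p m <> sf m -> cyc p m \/ exists2 a, entry p a & reach p a m.
Proof.
move=> H; case: (classic (exists2 a, entry p a & reach p a m)) => K; [by right|left].
by split=> // a He Hr; apply: K; exists a.
Qed.

Lemma fconnectP m (n : M) : reflect (exists j, n = iter j nxt m) (fconnect nxt m n).
Proof.
apply: (iffP idP) => [H|[j ->]]; last exact: fconnect_iter.
by exists (findex nxt m n); rewrite iter_findex.
Qed.

(** Reverting a cycle releases no woman; without an absorber it would therefore cost nothing and
    bring [p] closer to [s]. *)
Lemma cyc_absorbs m : cyc p m -> exists j w, absorbs p (iter j nxt m) w.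
Proof.
move=> Hc; apply: NNPP => Hno.
pose S := fconnect nxt m.
have Sc u : S u -> cyc p u by move=> /fconnectP[j ->]; have [] := cyc_iter j Hp Hc.
have Sabs u w : S u -> ~~ absorbs p u w.
  by move=> /fconnectP[j ->]; apply/negP => H; apply: Hno; exists j, w.
have Sadv u : S u -> adv p u -> S (nxt u).
  by move=> /fconnectP[j ->] _; apply/fconnectP; exists j.+1.
have Spred u w : S u -> p u = Some w -> exists2 u' : M, S u' & sf u' = Some w.
  move=> Sx Ex; have [_ _ [[//|k] _ Ek]] := cyc_step Hp (Sc u Sx).
  exists (iter k nxt u).
    by move/fconnectP: Sx => [j ->]; apply/fconnectP; exists (k + j); rewrite iterD.
  by have [_ Ha] := cyc_iter k Hp (Sc u Sx); rewrite -(adv_eq Ha) -iterS Ek.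
have Sm : S m by apply: connect0.
have Hfr : fea (revert p S).
  apply: fea_revert => // [u w Sx Ex _|u Sx _]; first exact: Spred Sx Ex.
  by have [/advP[w [-> _ _ _]] _ _] := cyc_step Hp (Sc u Sx).
apply: (nice_no Hn Hfr); last by apply: wt_revert Sm _; case: Hc.
apply: revert_nonew => // w [u [Sx Ex H]].
by have [u' Sx' Ex'] := Spred u w Sx Ex; case: (H u').
Qed.

(** The man matched to [w] in [s] has left her and the next man [n] did not take her, so his path
    ends there. It is not a cycle, and by [row_end] its start is a token, because he is matched in
    [s]. *)
Lemma absorb_source n w : absorbs p n w -> exists a l,
  [/\ token a, pend p a l, nxt (iter l nxt a) = n, iter l nxt a <> n
    & sf (iter l nxt a) = Some w].
Proof.
move=> Hab; have [o [Eo Es Epo Hwo [En ne]]] := absorbsP Hab.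
have Hadv : ~~ adv p o.
  apply/negP => /adv_eq; rewrite En Es => E.
  by case/and4P: Hab; rewrite E ltnn.
have [Hc|[a He [l [El U]]]] : cyc p o \/ exists2 a, entry p a & reach p a o.
  by apply: touched_cases; rewrite Es.
  by have [H _ _] := cyc_step Hp Hc; rewrite H in Hadv.
have Hl : pend p a l by split; rewrite -?El.
exists a, l; rewrite -El; split=> //.
have [//|Hna] := entry_cases He.
by have [_] := row_end Hn Hna Hl; rewrite -El Es.
Qed.

Lemma absorber_place n w : absorbs p n w ->
  cyc p n \/ exists2 a, token a & reach p a n.
Proof.
move=> Hab; have : p n <> sf n.
  by case/and4P: (Hab) => _ H1 H2 _ E; move: H1 H2; rewrite E; lia.
case/touched_cases => [|[a He Hr]]; first by left.
have [Ht|Hna] := entry_cases He; first by right; exists a.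
have [i [E U]] := Hr; case/negP: (row_noabs Hn w Hna U).
by rewrite -E.
Qed.

Lemma end_drops a l w : entry p a -> pend p a l -> sf (iter l nxt a) = Some w ->
  drops I s (iter l nxt a) /\ forall m, p m <> Some w.
Proof.
move=> He [U Hadv] Es.
have Hm m : p m <> Some w.
  move=> Em; have ne : m <> iter l nxt a.
    by move=> E; apply: (touched He U); rewrite -E Em E Es.
  by have [H _] := hold_adv Hp Es Em ne; rewrite H in Hadv.
split=> //; rewrite /drops Es; apply/negP => Hw.
by case: Hf => _ _ /(_ w Hw)[m /Hm].
Qed.

(** Let [i1] be the first place from [r] on where the path may stop. If it goes further, reverting
    the part after [i1] is feasible and releases a single woman. By minimality no blocking pair may
    then be lost, which makes all men of that part better off than in [s] and leaves only the last
    two cases. *)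
Lemma token_stop a l r : token a -> pend p a l -> r <= l ->
  (forall j w, r < j -> j <= l -> ~~ absorbs p (iter j nxt a) w) ->
  [\/ sf (iter l nxt a) = None,
      drops I s (iter l nxt a) /\
        (forall i, r <= i -> i < l -> ~~ drops I s (iter i nxt a)),
      nxt (iter l nxt a) <> iter l nxt a /\ (exists w, absorbs p (nxt (iter l nxt a)) w)
    | unwanted I s (iter l nxt a) /\
        (forall i, r <= i -> i < l -> ~~ unwanted I s (iter i nxt a))].
Proof.
move=> [He [w0 Ew0 Hw0]] Hl Hr Habs; have [U Hadv] := Hl.
case Ev: (sf (iter l nxt a)) => [v|]; last by constructor 1.
have [Hd Hv] := end_drops He Hl Ev.
have exd : exists i, (r <= i) && drops I s (iter i nxt a) by exists l; rewrite Hr.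
have [i1 /andP[Hri Hdi] Hmin] := ex_minnP exd.
have Hil : i1 <= l by apply: Hmin; rewrite Hr.
case: (ltngtP i1 l) Hil => // [Hil|E] _; last first.
  constructor 2; split=> // i Hi Hi'; apply/negP => H.
  by have := Hmin i; rewrite Hi H => /(_ isT); lia.
have [z Ez] : exists z, sf (iter i1 nxt a) = Some z.
  by move: Hdi; rewrite /drops; case: (sf _) => // z _; exists z.
have Hz : z \notin wstar I by move: Hdi; rewrite /drops Ez.
pose S m := [exists j : 'I_l.+1, (i1 < j) && (m == iter j nxt a)].
have SP m : reflect (exists j, [/\ i1 < j, j <= l & m = iter j nxt a]) (S m).
  apply: (iffP existsP) => [[j /andP[Hj /eqP->]]|[j [Hj Hj' ->]]].
    by exists j; split=> //; rewrite -ltnS.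
  have Hjl : j < l.+1 by [].
  by exists (Ordinal Hjl); rewrite /= Hj eqxx.
have Sadv m : S m -> adv p m -> S (nxt m).
  move=> /SP[j [Hj Hjl ->]] Ha; apply/SP; exists j.+1; split=> //; first exact: ltnW.
  by rewrite ltn_neqAle Hjl andbT; apply/eqP => E; rewrite -E Ha in Hadv.
have Sabs m w : S m -> ~~ absorbs p m w.
  by move=> /SP[j [Hj Hjl ->]]; apply: Habs => //; apply: leq_trans Hj.
have Spred m w : S m -> p m = Some w -> w = z \/ exists2 m', S m' & sf m' = Some w.
  case/SP=> j0 [Hj Hjl ->]; case: j0 Hj Hjl => [//|j] Hj Hjl Ew.
  have E : sf (iter j nxt a) = Some w by rewrite -(adv_eq (U j Hjl)).
  move: Hj; rewrite ltnS leq_eqVlt => /orP[/eqP Ej|Hj].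
    by left; move: E; rewrite -Ej Ez => -[].
  by right; exists (iter j nxt a) => //; apply/SP; exists j; split=> //; apply: ltnW.
have Hfr : fea (revert p S).
  apply: fea_revert => // [m w Sm Em Hw|m /SP[j [_ Hjl ->]] _].
    by case: (Spred m w Sm Em) => // E; rewrite E (negbTE Hz) in Hw.
  move: Hjl; rewrite leq_eqVlt => /orP[/eqP->|Hjl]; first by rewrite Ev.
  by have /advP[w [-> _ _ _]] := U j Hjl.
have Hwt : wt (revert p S) < wt p.
  apply: (@wt_revert _ _ (iter l nxt a)); first by apply/SP; exists l.
  exact: touched.
(* Only [z] is released, so a single lost pair would contradict minimality. *)
have Hdes m y : blk p m y -> blk (revert p S) m y.
  move=> Hb; apply/negPn/negP => Hb'; apply: (nice_no Hn Hfr _ Hwt).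
  apply: (revert_new1 Hp Sabs (w0 := z) _ Hb Hb') => w [o [So Ew H]].
  by case: (Spred o w So Ew) => // -[m' Sm' Em']; case: (H m').
have Hnb j y : i1 < j -> j <= l -> sf (iter j nxt a) = Some y -> ~~ blk p (iter j nxt a) y.
  move=> Hj Hjl Ey; apply/negP => /Hdes /blkP[_]; rewrite /revert.
  have -> : S (iter j nxt a) by apply/SP; exists j.
  by rewrite Ey ltnn.
(* A worse-off man here, with nobody after him blocking with his [s]-partner, would carry the path
   beyond its end. *)
have Hbet j : i1 < j -> j <= l -> rk (iter j nxt a) (p (iter j nxt a))
    < rk (iter j nxt a) (sf (iter j nxt a)).
  move=> Hj Hjl; have Ht : p (iter j nxt a) <> sf (iter j nxt a).
    by apply: touched => //; apply: uptoW U.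
  case: ltngtP => // [Hw|E]; last first.
    by case: Ht; apply: rk_inj E; apply: asn_okv.
  have [] : upto p (iter j nxt a) (l - j).+1 /\ worse p (iter (l - j).+1 nxt (iter j nxt a)).
    apply: worse_chain => // k y Hk; rewrite -iterD => Ey; apply: Hnb Ey; lia.
  move=> /(_ (l - j) (leqnn _)); rewrite -iterD subnK // => H.
  by rewrite H in Hadv.
case: (boolP (unwanted I s (iter l nxt a))) => Hun.
  constructor 4; split=> // i Hi Hi'; apply/negP => /andP[Hdi'].
  have Hi1 : i1 <= i by apply: Hmin; rewrite Hi.
  have /advP[w [Es _ Ep ne]] := U i Hi'; move/eqP/negbTE: (ne) => -> /=.
  by have := Hbet i.+1 Hi1 Hi'; rewrite [iter i.+1 _ _]iterS Ep Es; lia.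
move: Hun; rewrite /unwanted Hd /= negb_or -leqNgt => /andP[/eqP ne Hle].
set n := nxt (iter l nxt a) in ne Hle *.
constructor 3; split=> //; exists v.
have [v' [Ev' Eo]] := nxt_neq ne; move: Ev'; rewrite Ev => -[E]; subst v'.
have [Han _] := oth_acc Eo.
have Hlt : rk n (Some v) < rk n (sf n).
  move: Hle; rewrite Ev leq_eqVlt => /orP[/eqP E|//]; case: ne.
  have En : sf n = Some v.
    by apply/esym/(@rk_inj _ _ I n) => //; [move=> ? [<-]|exact: asn_okv].
  exact: s_inj En Ev.
have [o [Eo' Es' Hwo]] := stab Han Hlt.
have Eol := s_inj Es' Ev; subst o.
have Hpn : rk n (p n) < rk n (Some v).
  case: ltngtP => // [H|E]; last first.
    by case: (Hv n); apply: rk_inj E; [exact: asn_okv|move=> ? [<-]].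
  have Hb : blk p n v by apply/blkP; split=> // o' _ /Hv.
  move/Hdes/blkP: Hb => [_ _ /(_ _ Eo')]; rewrite /revert.
  have -> : S (iter l nxt a) by apply/SP; exists l.
  by rewrite Ev Hwo => /(_ erefl).
rewrite /absorbs Han Hpn Hlt Eo' /=.
exact/eqP.
Qed.

End Tokens.

(** * Walks and special men *)

Notation walk := (walk I s).
Notation endw := (walk_end I s).

Lemma walkP a : exists q, [/\ walk a = traject nxt a q.+1, endw a = iter q nxt a,
  uniq (walk a) & nxt (endw a) \in walk a].
Proof.
pose F l (_ : M) := if nxt (last a l) \in l then l else l ++ [:: nxt (last a l)].
have lastT k : last a (traject nxt a k.+1) = iter k nxt a by rewrite /= last_traject.
have H (e : seq M) : exists k, [/\ foldl F [:: a] e = traject nxt a k.+1,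
    uniq (traject nxt a k.+1) &
    iter k.+1 nxt a \in traject nxt a k.+1 \/ k = size e].
  elim/last_ind: e => [|e m [k [E Hu K]]]; first by exists 0; split=> //; right.
  rewrite -cats1 foldl_cat /= E /F lastT -iterS.
  case: ifP => Hk; first by exists k; split=> //; left.
  case: K => [K|K]; first by case/negP: (negbT Hk).
  have Hu' : uniq (traject nxt a k.+2) by rewrite trajectSr rcons_uniq Hk.
  exists k.+1; rewrite cats1 -trajectSr; split=> //.
  by right; rewrite size_cat addn1 K.
have [q [E Hu K]] := H (enum M).
have E' : walk a = traject nxt a q.+1 by rewrite -E.
exists q; rewrite /walk_end E' lastT -iterS; split=> //.
case: K => // K; have := uniq_leq_size Hu (s2 := enum M) (fun m _ => mem_enum M m).
by rewrite size_traject K ltnn.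
Qed.

Section OneWalk.
Variables (a : M) (q : nat).
Hypothesis Ew : walk a = traject nxt a q.+1.
Hypothesis Ee : endw a = iter q nxt a.
Hypothesis Hu : uniq (walk a).
Hypothesis Hc : nxt (endw a) \in walk a.

Lemma walk_inj i j : i <= q -> j <= q -> iter i nxt a = iter j nxt a -> i = j.
Proof.
move=> Hi Hj E; apply/eqP; rewrite -(nth_uniq a (s := walk a)) ?Ew ?size_traject //.
  by rewrite !nth_traject // E.
by rewrite -Ew.
Qed.

Lemma walk_mem i : i <= q -> iter i nxt a \in walk a.
Proof. by move=> Hi; rewrite Ew; apply/trajectP; exists i. Qed.

Lemma walk_next m : m \in walk a -> nxt m \in walk a.
Proof.
rewrite {1}Ew => /trajectP[i Hi ->].
move: Hi; rewrite ltnS leq_eqVlt => /orP[/eqP->|Hi]; first by rewrite -Ee.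
by rewrite -iterS walk_mem.
Qed.

Lemma walk_iter m j : m \in walk a -> iter j nxt m \in walk a.
Proof. by move=> H; elim: j => //= j; exact: walk_next. Qed.

Lemma walk_last i j : i <= q -> j <= i -> iter i.+1 nxt a = iter j nxt a -> i = q.
Proof.
move=> Hi Hj E; apply/eqP; rewrite eqn_leq Hi leqNgt; apply/negP => Hq.
by have := walk_inj Hq (leq_trans Hj Hi) E; lia.
Qed.

Lemma walk_index i : i <= q -> index (iter i nxt a) (walk a) = i.
Proof.
move=> Hi; rewrite -(nth_traject nxt (n := q.+1) Hi) -Ew index_uniq //.
by rewrite Ew size_traject.
Qed.

Lemma walk_find (P : pred M) r l : r <= l -> l <= q -> P (iter l nxt a) ->
  (forall i, r <= i -> i < l -> ~~ P (iter i nxt a)) ->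
  r + (find P (drop r (walk a))).+1 = l.+1.
Proof.
move=> Hr Hl HP Hn; set k := find _ _; rewrite addnS; congr _.+1.
have Hnth j : j <= l - r -> nth a (drop r (walk a)) j = iter (r + j) nxt a.
  by move=> Hj; rewrite nth_drop Ew nth_traject //; lia.
case: (ltngtP k (l - r)) => Hk; last by lia.
  have : P (nth a (drop r (walk a)) k).
    apply: nth_find; rewrite has_find -/k size_drop Ew size_traject; lia.
  by rewrite Hnth; [rewrite (negbTE (Hn _ _ _)) //; lia|exact: ltnW].
by have := before_find a Hk; rewrite Hnth // subnKC // HP.
Qed.

Definition periodic m := exists2 k, 0 < k & iter k nxt m = m.

Lemma periodic_iter m j : periodic m -> periodic (iter j nxt m).
Proof. by case=> k Hk E; exists k => //; rewrite -iterD addnC iterD E. Qed.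

(** A common multiple of the periods returns both men to themselves, and its iterate depends only on
    the common image. *)
Lemma periodic_inj m m' : periodic m -> periodic m' -> nxt m = nxt m' -> m = m'.
Proof.
case=> k Hk E [k' Hk' E'] En.
have E1 : iter (k' * k) nxt m = m by elim: k' {Hk' E'} => //= n IHn; rewrite mulSn iterD IHn.
have E2 : iter (k' * k) nxt m' = m'.
  by rewrite mulnC; elim: k {Hk E E1} => //= n IHn; rewrite mulSn iterD IHn.
rewrite -E1 -E2; case: (k' * k) (muln_gt0 k' k) => [|n _]; first by rewrite Hk Hk'.
by rewrite !iterSr En.
Qed.

(** The walk closes at its first periodic man: an earlier closing place would make the man before
    him periodic, a later one would contradict injectivity on periodic men. *)
Lemma walk_cycle i : periodic (iter i nxt a) -> i <= q ->
  i = 0 \/ ~ periodic (iter i.-1 nxt a) -> nxt (endw a) = iter i nxt a.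
Proof.
move=> Hper Hi Hfirst; move: (Hc); rewrite {1}Ew => /trajectP[c Hcq E].
rewrite E; have E' : iter q.+1 nxt a = iter c nxt a by rewrite iterS -Ee.
case: (ltngtP c i) => [H|H|-> //].
  case: Hfirst => [|[]]; first by lia.
  have -> : i.-1 = (i.-1 - c) + c by lia.
  rewrite iterD; apply: periodic_iter; exists (q.+1 - c); first by lia.
  by rewrite -iterD subnK // ltnW.
have P1 : periodic (iter c.-1 nxt a).
  by have -> : c.-1 = (c.-1 - i) + i by [lia]; rewrite iterD; apply: periodic_iter.
have P2 : periodic (iter q nxt a).
  by have -> : q = (q - i) + i by [lia]; rewrite iterD; apply: periodic_iter.
have Ec : nxt (iter q nxt a) = nxt (iter c.-1 nxt a) by rewrite -!iterS prednK //; lia.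
have Hcq1 : c.-1 <= q by lia.
by have := walk_inj (leqnn q) Hcq1 (periodic_inj P2 P1 Ec); lia.
Qed.

Lemma walk_pend p l : entry p a -> pend p a l -> l <= q.
Proof.
move=> He [U _]; rewrite leqNgt; apply/negP => H.
move: (Hc); rewrite {1}Ew => /trajectP[c Hcq]; rewrite Ee -iterS => E.
by have := iter_inj He U H (leq_trans (ltnW Hcq) H) E; lia.
Qed.

End OneWalk.

Section Specials.
Variable p : M -> option W.
Hypothesis Hn : nice p.
Variable A : seq M.
Hypothesis HA : forall a, token p a -> a \in A.

Let Hp : asn p. Proof. by case: Hn => -[]. Qed.

(** The path of some token [a] ends right before [n]. If [n] lies on a cycle or on this path, the
    walk of [a] closes at [n]. If he lies on the path of another token [b], the two walks merge at
    [n], unless the path of [a] met the walk of [b] earlier, beyond the end of the path of [b]; then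
    the walk of [b] closes at [n]. *)
Lemma special_mem n w : absorbs p n w -> n \in flatten [seq specials I s A b | b <- A].
Proof.
move=> Hab; have [a [l [Ta Hl En ne _]]] := absorb_source Hn Hab; have [Ea _] := Ta.
have [q [Ew Ee Hu Hc]] := walkP a; have Hlq := walk_pend Ew Ee Hu Hc Ea Hl.
have Hin (P : forall b, b \in A -> Prop) b (Hb : b \in A) :
    n \in specials I s A b -> n \in flatten [seq specials I s A b | b <- A].
  by move=> H; apply/flattenP; exists (specials I s A b) => //; apply: map_f.
have Hend b : token p b -> nxt (endw b) = n ->
    n \in flatten [seq specials I s A b | b <- A].
  move=> Tb E; apply: (Hin (fun _ _ => True) b (HA Tb)).
  by rewrite /specials E mem_head.
have [Hcy|[b Tb [i [Ei U]]]] := absorber_place Hn Hab.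
  apply: (Hend a Ta); rewrite -En -iterS.
  have Hper : periodic n by have [_ _] := cyc_step Hp Hcy.
  have Hlq' : l < q.
    rewrite ltn_neqAle Hlq andbT; apply/eqP => E.
    move: (Hc); rewrite Ee -E En Ew -E => /trajectP[c Hcl Ec].
    case: (Hcy) => _ /(_ a Ea); apply; rewrite Ec.
    exact: (pend_reach Hl).
  apply: (walk_cycle Ew Ee Hu Hc) => //; first by rewrite iterS En.
  right=> /= Hpl; have [[//|k] _ Ek] := Hper.
  have [Hz Haz] := cyc_iter k Hp Hcy.
  have E : iter l nxt a = iter k nxt n.
    by apply: periodic_inj; [|exact: periodic_iter|rewrite En -iterS Ek].
  by case: Hl => _; rewrite E Haz.
have [Eb _] := Tb.
case: (eqVneq b a) => [E|/eqP ab].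
  subst b; apply: (Hend a Ta).
  have Hil : i <= l.
    by rewrite leqNgt; apply/negP => H; case: Hl => _; rewrite U.
  have El : l = q by apply: (walk_last Ew Hu Hc Hlq Hil); rewrite iterS En.
  by rewrite Ee -El En.
have [l' Hl'] := entry_end Eb.
have [q' [Ew' Ee' Hu' Hc']] := walkP b; have Hlq' := walk_pend Ew' Ee' Hu' Hc' Eb Hl'.
have Hil' : i <= l'.
  by rewrite leqNgt; apply/negP => H; case: Hl' => _; rewrite U.
case: (boolP (has (fun t => iter t nxt a \in walk b) (iota 0 l.+1))) => Hmeet; last first.
  have Hno t : t <= l -> iter t nxt a \notin walk b.
    move=> Ht; apply/negP => H; case/negP: Hmeet; apply/hasP; exists t => //.
    by rewrite mem_iota.
  have Hnb : n \in walk b by rewrite Ei; apply: (walk_mem Ew'); apply: leq_trans Hlq'.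
  have Hllq : l < q.
    rewrite ltn_neqAle Hlq andbT; apply/eqP => E.
    move: (Hc); rewrite Ee -E En Ew -E => /trajectP[c Hcl Ec].
    by move: (Hno c Hcl); rewrite -Ec Hnb.
  apply: (Hin (fun _ _ => True) a (HA Ta)); rewrite /specials !inE; apply/orP; right.
  apply/orP; right; apply/flattenP.
  exists (take 1 [seq m <- walk a | m \in walk b]); first by apply: map_f (HA Tb).
  rewrite -(cat_take_drop l.+1 (walk a)) filter_cat.
  have -> : [seq m <- take l.+1 (walk a) | m \in walk b] = [::].
    apply/eqP; rewrite -size_eq0 size_filter -leqn0 leqNgt -has_count.
    apply/hasPn => m; rewrite Ew take_traject ?ltnS //.
    by move=> /trajectP[t Ht ->]; exact: Hno.
  rewrite Ew (drop_nth a) ?size_traject // nth_traject // [iter _ _ _]iterS En /=.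
  by rewrite Hnb /= take0 mem_head.
case/hasP: Hmeet => t; rewrite mem_iota add0n ltnS /= => Htl.
rewrite {1}Ew' => /trajectP[u Hu1 Eu].
have Hdis m : reach p a m -> reach p b m -> False.
  by move=> H1 H2; apply: ab; apply: reach_uniq Eb Ea H2 H1.
have Hul : l' < u.
  rewrite ltnNge; apply/negP => H.
  apply: (Hdis (iter t nxt a)); first exact: (pend_reach Hl).
  by rewrite Eu; apply: (pend_reach Hl').
have Em1 : iter l nxt a = iter (u + l - t - i) nxt n.
  by rewrite Ei -iterD subnK; [rewrite -addnBA // addnC iterD -Eu -iterD subnK|lia].
have Hper : periodic n.
  by exists (u + l - t - i).+1 => //; rewrite iterS -Em1 En.
apply: (Hend b Tb); rewrite Ei; apply: (walk_cycle Ew' Ee' Hu' Hc').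
- by rewrite -Ei.
- exact: leq_trans Hlq'.
case: i Ei U Hil' Em1 => [|i] Ei U Hil' Em1; [by left|right=> /= Hpi].
apply: (Hdis (iter l nxt a)); first exact: (pend_reach Hl).
have -> : iter l nxt a = iter i nxt b.
  apply: periodic_inj => //; first by rewrite Em1; apply: periodic_iter.
  by rewrite En Ei.
by exists i; split=> //; apply: uptoW U.
Qed.

Lemma option_stop a l : token p a -> pend p a l ->
  exists2 i, i < size (options I s A a) & pathto I s A a i = traject nxt a l.+1.
Proof.
move=> Ta Hl; have [Ea _] := Ta.
have [q [Ew Ee Hu Hc]] := walkP a; have Hlq := walk_pend Ew Ee Hu Hc Ea Hl.
suff H : l.+1 \in options I s A a.
  exists (index l.+1 (options I s A a)); first by rewrite index_mem.
  rewrite /pathto (drop_nth 0) ?index_mem // nth_index //= Ew.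
  by rewrite -/(traject nxt a q.+1) take_traject.
have Hq0 : l = q -> l.+1 \in options I s A a.
  by move=> ->; rewrite /options Ew size_traject mem_head.
(* The largest such [r] is the last absorber on the path, or 0 if there is none; in both cases the
   man there is special, and [token_stop] applies after him. *)
pose P r := (r <= l) && ((r == 0) || [exists w, absorbs p (iter r nxt a) w]).
have exP : exists r, P r by exists 0.
have [|r /andP[Hrl Hr] Hmax] := @ex_maxnP P l exP; first by move=> r /andP[].
have Hrq : r <= q by apply: leq_trans Hlq.
have Hx : iter r nxt a \in flatten [seq specials I s A b | b <- A].
  case/orP: Hr => [/eqP->|/existsP[w]]; last exact: special_mem.
  apply/flattenP; exists (specials I s A a); first by apply: map_f (HA Ta).
  by rewrite /specials !inE eqxx orbT.
have Habs j w : r < j -> j <= l -> ~~ absorbs p (iter j nxt a) w.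
  move=> Hj Hjl; apply/negP => H; have := Hmax j; rewrite /P Hjl orbC.
  have -> : [exists w, absorbs p (iter j nxt a) w] by apply/existsP; exists w.
  by move=> /(_ isT); lia.
have Hmem (z : M) k : z \in flatten [seq specials I s A b | b <- A] ->
    k \in [:: index z (walk a);
        index z (walk a) + (find (drops I s) (drop (index z (walk a)) (walk a))).+1;
        index z (walk a) + (find (unwanted I s) (drop (index z (walk a)) (walk a))).+1] ->
    k \in options I s A a.
  move=> Hy Hk; rewrite /options inE; apply/orP; right.
  apply/flattenP; eexists; last exact: Hk.
  by apply/mapP; exists z.
have [Es|[Hd Hmin]|[ne [w Hab]]|[Hd Hmin]] := token_stop Hn Ta Hl Hrl Habs.
- apply: Hq0; apply: (walk_last Ew Hu Hc Hlq (leqnn _)).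
  by rewrite iterS /nextm Es.
- by apply: (Hmem _ _ Hx); rewrite (walk_index Ew Hu Hrq) (walk_find Ew Hu Hc Hrl Hlq Hd Hmin) ?inE ?eqxx ?orbT.
- case: (boolP (iter l.+1 nxt a \in traject nxt a l.+1)) => Hin.
    case/trajectP: Hin => c Hcl E; apply: Hq0.
    exact: (walk_last Ew Hu Hc Hlq Hcl E).
  have Hlq' : l < q.
    rewrite ltn_neqAle Hlq andbT; apply/eqP => E; case/negP: Hin.
    by move: Hc; rewrite Ee Ew -E.
  apply: (Hmem _ _ (special_mem Hab)).
  by rewrite -iterS (walk_index Ew Hu Hlq') mem_head.
- by apply: (Hmem _ _ Hx); rewrite (walk_index Ew Hu Hrq) (walk_find Ew Hu Hc Hrl Hlq Hd Hmin) ?inE ?eqxx ?orbT.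
Qed.

End Specials.

(** * Reconstruction of the token part *)

Lemma get_cat (q1 q2 : asg M W) m :
  get (q1 ++ q2) m = if m \in [seq e.1 | e <- q1] then get q1 m else get q2 m.
Proof.
rewrite /get filter_cat; elim: q1 => [|e q1 IHq] //=.
by rewrite inE eq_sym; case: eqP.
Qed.

Lemma get_agree (q : asg M W) p m : (forall e, e \in q -> p e.1 = e.2) ->
  m \in [seq e.1 | e <- q] -> get q m = p m.
Proof.
rewrite /get; elim: q => [|e q IHq] //= H; rewrite inE eq_sym.
case: eqP => [<- _|_ Hm] /=; first by rewrite H // mem_head.
by apply: IHq => // e' He'; apply: H; rewrite inE He' orbT.
Qed.

Lemma shift_keys x t : [seq e.1 | e <- shift s x t] = t.
Proof. by elim: t x => //= a t IHt x; rewrite -/(shift s (sf a) t) IHt. Qed.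

Lemma shift_agree p a n e : upto p a n.-1 -> e \in shift s (p a) (traject nxt a n) -> p e.1 = e.2.
Proof.
elim: n a => [|n IHn] a U //=; rewrite -/(shift s (sf a) _) inE => /orP[/eqP->//|].
case: n IHn U => [|n] IHn U //.
rewrite -(adv_eq (U 0 _)) //; apply: IHn => j Hj.
by rewrite -iterSr; apply: U.
Qed.

Lemma freeP (q : asg M W) w : reflect (forall m, get q m <> Some w) (free q w).
Proof.
apply: (iffP hasPn) => H m; first by move=> E; move: (H m); rewrite mem_enum E /= eqxx => /(_ isT).
by move=> _; apply/iswP/H.
Qed.

Lemma size_flatten_le (S T : Type) (f : S -> seq T) c (l : seq S) :
  (forall z, size (f z) <= c) -> size (flatten [seq f z | z <- l]) <= size l * c.
Proof. by move=> H; elim: l => //= z l IHl; rewrite size_cat mulSn leq_add. Qed.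

Lemma size_specials (A : seq M) a : size (specials I s A a) <= (size A).+2.
Proof.
rewrite /specials /= !ltnS -[X in _ <= X]muln1; apply: size_flatten_le => b.
by rewrite size_take; case: ifP => // /negbT; rewrite -leqNgt.
Qed.

Lemma size_options (A : seq M) a :
  size (options I s A a) <= (size A * (size A).+2 * 3).+1.
Proof.
rewrite /options /= ltnS.
apply: leq_trans (size_flatten_le (c := 3) _ _) _ => //.
by rewrite leq_mul2r /=; apply: size_flatten_le => b; apply: size_specials.
Qed.

Section Rebuild.
Variable p : M -> option W.
Hypothesis Hn : nice p.

Let Hf : fea p. Proof. by case: Hn. Qed.
Let Hp : asn p. Proof. by case: Hf. Qed.

(** The men settled by the token guesses. The other changed men lie on the paths treated by
    clusters. *)
Definition moved m := cyc p m \/ exists2 a, token p a & reach p a m.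

Lemma toksP w : reflect (w \in wstar I /\ forall m, sf m <> Some w) (w \in toks I s).
Proof.
rewrite mem_filter mem_enum andbT; apply: (iffP andP) => -[h1 h2]; split=> //; exact/freeP.
Qed.

Lemma tok_token w : w \in toks I s -> exists2 a, token p a & p a = Some w.
Proof.
case/toksP=> Hw Hs; case: Hf => _ _ /(_ w Hw)[a Ea]; exists a => //.
split; last by exists w.
by split=> [E|m w']; [apply: (Hs a); rewrite -E|rewrite Ea => -[<-]; exact: Hs].
Qed.

Lemma token_tok a : token p a -> exists2 w, w \in toks I s & p a = Some w.
Proof.
case=> -[_ He] [w Ew Hw]; exists w => //; apply/toksP; split=> // m; exact: He.
Qed.

Let holder w : option M := [pick m | p m == Some w].

Let holderE a w : p a = Some w -> holder w = Some a.
Proof.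
move=> Ea; rewrite /holder; case: pickP => [m /eqP Em|/(_ a)]; last by rewrite Ea eqxx.
by rewrite (proj2 Hp _ _ _ Em Ea).
Qed.

Let A := pmap holder (toks I s).

Let HA a : token p a -> a \in A.
Proof.
by case/token_tok=> w Hw Ea; rewrite mem_pmap -(holderE Ea); apply: map_f.
Qed.

Let sizeA : size A <= size (toks I s).
Proof. by rewrite size_pmap; apply: count_size. Qed.

(* There are at most [k * k.+2] special men, each with three options. *)
Definition gbound k := (k * k.+2 * 3).+3.

Let tok_guess w : w \in toks I s -> exists j i f a, [/\
  [/\ j < 2, i < size (options I s A a) & f < 2], start I w j = Some a, holder w = Some a,
  token p a /\ p a = Some w &
  exists2 l, pend p a l &
    pathto I s A a i = traject nxt a l.+1 /\ (f = 1 <-> cyc p (nxt (iter l nxt a)))].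
Proof.
move=> Hw; have [a Ta Ea] := tok_token Hw; have [He _] := Ta.
have [l Hl] := entry_end He; have [i Hi Ei] := option_stop Hn HA Ta Hl.
have Ha : acc a w by apply: (proj1 Hp).
pose L := [seq m <- wpref I w | w \in mpref I m].
have HaL : a \in L by rewrite mem_filter; case/andP: Ha => -> ->.
have [f [Hf2 Ef]] : exists f, f < 2 /\ (f = 1 <-> cyc p (nxt (iter l nxt a))).
  by case: (classic (cyc p (nxt (iter l nxt a)))) => H; [exists 1|exists 0].
exists (index a L), i, f, a; split=> //; last by exists l.
- split=> //; apply: leq_trans (_ : size L <= 2); first by rewrite index_mem.
  by apply: leq_trans (size_wpref D2 w); rewrite size_filter count_size.
- by rewrite /start -/L (drop_nth a) ?index_mem //= nth_index.
- exact: holderE.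
Qed.

Let goodd (d : W * (M * (nat * nat))) := [/\ d.1 \in toks I s, token p d.2.1,
  p d.2.1 = Some d.1 & exists2 l, pend p d.2.1 l &
    pathto I s A d.2.1 d.2.2.1 = traject nxt d.2.1 l.+1 /\
    (d.2.2.2 = 1 <-> cyc p (nxt (iter l nxt d.2.1)))].

Let tok_list l : {subset l <= toks I s} -> exists G D, [/\ size G = size l,
  forall g, g \in G -> [/\ g.1 < gbound (size (toks I s)),
     g.2.1 < gbound (size (toks I s)) & g.2.2 < gbound (size (toks I s))],
  flatten [seq if start I e.1 e.2.1 is Some a then [:: (e.1, (a, e.2.2))] else [::]
          | e <- zip l G] = D,
  [seq d.2.1 | d <- D] = pmap holder l &
  (forall d, d \in D -> goodd d) /\ (forall w, w \in l -> exists2 d, d \in D & d.1 = w)].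
Proof.
elim: l => [|w l IHl] Hl; first by exists [::], [::].
have [|G [D [h1 h2 h3 h4 [h5 h6]]]] := IHl.
  by move=> z Hz; apply: Hl; rewrite inE Hz orbT.
have [b [i [f [a [[Hb Hi Hff] Hst Hho [Ta Ea] Hpath]]]]] := tok_guess (Hl w (mem_head _ _)).
exists ((b, (i, f)) :: G), ((w, (a, (i, f))) :: D); split=> //=.
- by rewrite h1.
- move=> g; rewrite inE => /orP[/eqP->|]; last exact: h2.
  rewrite /= /gbound; split; [lia| |lia].
  apply: leq_trans Hi _; apply: leq_trans (size_options _ _) _.
  have : size A * (size A).+2 * 3 <= size (toks I s) * (size (toks I s)).+2 * 3.
    by rewrite leq_mul2r /=; apply: leq_mul; rewrite ?ltnS sizeA.
  by move=> H; rewrite ltnS; apply: leq_trans H _; do ?apply: leqW; exact: leqnn.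
- by rewrite Hst h3.
- by rewrite Hho h4.
split=> [d|z]; rewrite inE => /orP[/eqP->|].
- by split=> //; apply: Hl; rewrite mem_head.
- exact: h5.
- by exists (w, (a, (i, f))); rewrite ?mem_head.
by case/h6=> d Hd Ed; exists d => //; rewrite inE Hd orbT.
Qed.

Let rotateP n : cyc p n ->
  (forall e, e \in rotate I s n -> p e.1 = e.2) /\
  (forall m, m \in [seq e.1 | e <- rotate I s n] <-> exists j, m = iter j nxt n).
Proof.
move=> Hc; have [q [Ew Ee Hu Hcl]] := walkP n.
have [_ _ Hper] := cyc_step Hp Hc.
have En : nxt (endw n) = n.
  by have := walk_cycle Ew Ee Hu Hcl (i := 0) Hper isT (or_introl erefl).
rewrite /rotate En eqxx; split.
  move=> e; have Hce : cyc p (endw n) by rewrite Ee; case: (cyc_iter q Hp Hc).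
  have -> : sf (endw n) = p n by rewrite -{2}En; apply/esym/adv_eq; case: (cyc_step Hp Hce).
  rewrite Ew; apply: shift_agree => j Hj; by case: (cyc_iter j Hp Hc).
move=> m; rewrite shift_keys; split=> [|[j ->]].
  by rewrite Ew => /trajectP[j _ ->]; exists j.
by apply: (walk_iter Ew Ee Hcl); rewrite Ew mem_head.
Qed.

(** A cycle is rotated on behalf of a token whose path ends just before an absorber on it;
    [cyc_absorbs] and [absorb_source] provide one. *)
Lemma rebuild : exists G, [/\ size G = size (toks I s),
  forall g, g \in G -> [/\ g.1 < gbound (size (toks I s)),
     g.2.1 < gbound (size (toks I s)) & g.2.2 < gbound (size (toks I s))] &
  forall m, (moved m -> get (tokasg I s (tokens I s G)) m = p m) /\
            (~ moved m -> get (tokasg I s (tokens I s G)) m = sf m)].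
Proof.
have [G [D [h1 h2 h3 h4 [h5 h6]]]] := tok_list (fun w => id).
exists G; split=> //; rewrite /tokens h3 /tokasg h4 -/A.
set q1 := flatten _; set q2 := flatten _.
have H1 e : e \in q1 -> p e.1 = e.2 /\ moved e.1.
  case/flattenP=> r /mapP[d Hd ->]; case: eqP => // Ef.
  have [_ Td Ed [l Hl [-> Hfl]]] := h5 d Hd.
  have Hc : cyc p (nxt (iter l nxt d.2.1)) by apply/Hfl.
  have -> : last d.2.1 (traject nxt d.2.1 l.+1) = iter l nxt d.2.1 by rewrite /= last_traject.
  move=> He; have [K1 K2] := rotateP Hc; split; first exact: K1.
  have /K2[j ->] : e.1 \in [seq e.1 | e <- rotate I s (nxt (iter l nxt d.2.1))] by apply: map_f.
  by left; case: (cyc_iter j Hp Hc).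
have H2 e : e \in q2 -> p e.1 = e.2 /\ moved e.1.
  case/flattenP=> r /mapP[d Hd ->].
  have [_ Td Ed [l Hl [-> _]]] := h5 d Hd.
  rewrite -Ed => He; split; first by apply: shift_agree He; case: Hl.
  have : e.1 \in [seq e.1 | e <- shift s (p d.2.1) (traject nxt d.2.1 l.+1)] by apply: map_f.
  rewrite shift_keys => /trajectP[j Hj ->].
  by right; exists d.2.1 => //; apply: (pend_reach Hl).
have H12 e : e \in q1 ++ q2 -> p e.1 = e.2 /\ moved e.1.
  by rewrite mem_cat => /orP[/H1|/H2].
move=> m; rewrite catA get_cat; case: ifP => Hm.
  rewrite (get_agree (p := p)) //; last by move=> e /H12[].
  by split=> // Hno; case: Hno; case/mapP: Hm => e /H12[_ He] ->.
split=> // Hmv; move/negP: Hm; case.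
have Hdtok a : token p a -> exists2 d, d \in D & d.2.1 = a.
  case/token_tok=> w Hw Ea; have [d Hd Ed] := h6 w Hw; exists d => //.
  have [_ _ Ed' _] := h5 d Hd; apply: (proj2 Hp) Ed' _; by rewrite Ed.
rewrite map_cat mem_cat; case: Hmv => [Hc|[a Ta Hr]].
  have [j [w Hab]] := cyc_absorbs Hn Hc.
  have [a [l [Ta Hl En _ _]]] := absorb_source Hn Hab.
  have [d Hd Ed] := Hdtok a Ta; have [_ _ _ [l' Hl' [Ep Hfl]]] := h5 d Hd.
  have [He _] := Ta.
  have El : l' = l.
    rewrite Ed in Hl'; apply/eqP; rewrite eqn_leq; apply/andP; split; rewrite leqNgt; apply/negP => H.
      by case: Hl => _; rewrite (proj1 Hl').
    by case: Hl' => _; rewrite (proj1 Hl).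
  have [Hcn _] := cyc_iter j Hp Hc.
  apply/orP; left; apply/mapP.
  have Hm : m \in [seq e.1 | e <- rotate I s (nxt (iter l nxt a))].
    rewrite En; apply/(proj2 (rotateP Hcn)).
    have [_ _ [k Hk Ek]] := cyc_step Hp Hc.
    have Ekj n : iter (n * k) nxt m = m.
      by elim: n => //= n IHn; rewrite mulSn iterD IHn.
    (* From the absorber, [j] steps after [m], one goes on to the next suitable multiple of the
       period [k], which is [m] again. *)
    exists (j * k - j); rewrite -iterD subnK ?Ekj //.
    by rewrite leq_pmulr.
  case/mapP: Hm => e He' Em; exists e => //; apply/flattenP.
  exists (rotate I s (nxt (iter l nxt a))) => //; apply/mapP; exists d => //.
  rewrite Ep El Ed.
  have -> : d.2.2.2 == 1 by apply/eqP/Hfl; rewrite El Ed En.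
  by rewrite /= last_traject.
have [d Hd Ed] := Hdtok a Ta; have [_ _ Epa [l Hl [Ep _]]] := h5 d Hd.
have [He _] := Ta; rewrite Ed in Hl Epa.
have [i Hi ->] := reach_end He Hl Hr.
apply/orP; right; have Hin : iter i nxt a \in [seq e.1 | e <- shift s (Some d.1) (traject nxt a l.+1)].
  by rewrite shift_keys; apply/trajectP; exists i.
case/mapP: Hin => e He' Em; apply/mapP; exists e => //; apply/flattenP.
exists (shift s (Some d.1) (traject nxt a l.+1)) => //; apply/mapP; exists d => //.
by rewrite Ep Ed.
Qed.

End Rebuild.

(** * Rows *)

Lemma blk_ext p p' m w : p m = p' m ->
  (forall o, oth w m = Some o -> p o = p' o) -> blk p m w = blk p' m w.
Proof. by rewrite /blocks => -> H; case E: (oth w m) => [o|] //; rewrite (H o). Qed.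

Lemma nbE p : nb I p = \sum_(z : M * W) (blk p z.1 z.2 : nat).
Proof. by rewrite /nb -sum1_card big_mkcond; apply: eq_bigr => z _; rewrite inE; case: (blk _ _ _). Qed.

(** * Additivity of the number of blocking pairs *)

Section Four.
Variables (T : pred M) (n q c qc : M -> option W).
Hypothesis HT : forall m, T (nxt m) = T m.
Hypothesis Hin : forall m, T m -> qc m = c m /\ q m = n m.
Hypothesis Hout : forall m, ~~ T m -> qc m = q m /\ c m = n m.
Hypothesis Hq : forall m, q m <> n m -> n m = sf m.
Hypothesis Hc : forall m, c m <> n m -> n m = sf m.

(** If [s] matched [w] to one of the two men, [nextm] would lead from him to the other and [T] would
    agree on them. So [w] is unmatched in [s], and by stability [m] does not prefer her to his
    [s]-partner. *)
Let apart m o w : acc m w -> oth w m = Some o -> T m != T o -> n m = sf m -> n o = sf o ->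
  [/\ sf m <> Some w, sf o <> Some w & ~~ (rk m (Some w) < rk m (sf m))].
Proof.
move=> Ha Eo ne _ _; have Eo' := oth_sym D2 Ha Eo.
have h1 : sf m <> Some w by move=> E; case/eqP: ne; rewrite -(nxtE E Eo) HT.
have h2 : sf o <> Some w by move=> E; case/eqP: ne; rewrite -(nxtE E Eo') HT.
split=> //; apply/negP => H; have [o' [Eo1 Es _]] := stab Ha H.
by move: Eo1; rewrite Eo => -[E]; subst o'.
Qed.

Let blk_sf pp m w : pp m = sf m -> ~~ (rk m (Some w) < rk m (sf m)) -> blk pp m w = false.
Proof. by move=> E H; apply/negP => /blkP[_]; rewrite E (negbTE H). Qed.

(** Across [T] the combination can only lose pairs, namely when one side holds the woman that a man
    of the other side wants. The premises of the second half exclude exactly this. *)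
Let pointwise m w :
  (blk qc m w + blk n m w <= blk q m w + blk c m w) /\
  ((forall o, T m -> ~~ T o -> oth w m = Some o -> acc m w -> q o = Some w -> n o <> q o ->
     n m <> c m -> wlt w o m -> rk m (Some w) < rk m (c m) -> False) ->
   (forall o, ~~ T m -> T o -> oth w m = Some o -> acc m w -> c o = Some w -> n o <> c o ->
     n m <> q m -> wlt w o m -> rk m (Some w) < rk m (q m) -> False) ->
   blk q m w + blk c m w <= blk qc m w + blk n m w).
Proof.
have Hext := @blk_ext.
case Ha: (acc m w); last first.
  by have H pp : blk pp m w = false by [rewrite /blocks Ha]; rewrite !H.
case Eo: (oth w m) => [o|]; last first.
  have Hext0 pp pp' : pp m = pp' m -> blk pp m w = blk pp' m w.
    by move=> e1; apply: Hext => // o; rewrite Eo.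
  case: (boolP (T m)) => Tm.
    by have [h1 h2] := Hin Tm; rewrite (Hext0 qc c) // (Hext0 q n) // addnC.
  by have [h1 h2] := Hout Tm; rewrite (Hext0 qc q) // (Hext0 c n).
have Hext' pp pp' : pp m = pp' m -> pp o = pp' o -> blk pp m w = blk pp' m w.
  by move=> e1 e2; apply: Hext => // o'; rewrite Eo => -[<-].
case: (boolP (T m)) => Tm; case: (boolP (T o)) => To.
- have [h1 h2] := Hin Tm; have [h3 h4] := Hin To.
  by rewrite (Hext' qc c) // (Hext' q n) // addnC.
- have [h1 h2] := Hin Tm; have [h3 h4] := Hout To.
  case: (eqVneq (c m) (n m)) => [E|/eqP ncm].
    by rewrite (Hext' qc q) ?h1 ?h2 // (Hext' c n).
  case: (eqVneq (q o) (n o)) => [E|/eqP nqo].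
    by rewrite (Hext' qc c) ?h3 ?h4 // (Hext' q n) // addnC.
  have Em := Hc ncm; have Eno := Hq nqo.
  have neT : T m != T o by rewrite Tm (negbTE To).
  have [a1 a2 a3] := apart Ha Eo neT Em Eno.
  rewrite (@blk_sf n) // (@blk_sf q) ?h2 // add0n addn0; split.
    case: (boolP (blk qc m w)) => // /blkP[_ b1 b2]; rewrite h1 in b1.
    have -> // : blk c m w.
    by apply/blkP; split=> // o'; rewrite Eo => -[<-]; rewrite h4 Eno => /a2.
  move=> H _; case: (boolP (blk c m w)) => // /blkP[_ b1 b2].
  have -> // : blk qc m w.
  apply/blkP; split; rewrite ?h1 // => o'; rewrite Eo => -[<-]; rewrite h3 => Eq.
  by apply/negP => Hw; apply: (H o) => //; apply/nesym.
- have [h1 h2] := Hout Tm; have [h3 h4] := Hin To.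
  case: (eqVneq (q m) (n m)) => [E|/eqP nqm].
    by rewrite (Hext' qc c) ?h1 ?h2 // (Hext' q n) // addnC.
  case: (eqVneq (c o) (n o)) => [E|/eqP nco].
    by rewrite (Hext' qc q) ?h3 ?h4 // (Hext' c n).
  have Em := Hq nqm; have Eno := Hc nco.
  have neT : T m != T o by rewrite To (negbTE Tm).
  have [a1 a2 a3] := apart Ha Eo neT Em Eno.
  rewrite (@blk_sf n) // (@blk_sf c) ?h2 // !addn0; split.
    case: (boolP (blk qc m w)) => // /blkP[_ b1 b2]; rewrite h1 in b1.
    have -> // : blk q m w.
    by apply/blkP; split=> // o'; rewrite Eo => -[<-]; rewrite h4 Eno => /a2.
  move=> _ H; case: (boolP (blk q m w)) => // /blkP[_ b1 b2].
  have -> // : blk qc m w.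
  apply/blkP; split; rewrite ?h1 // => o'; rewrite Eo => -[<-]; rewrite h3 => Eq.
  by apply/negP => Hw; apply: (H o) => //; apply/nesym.
- have [h1 h2] := Hout Tm; have [h3 h4] := Hout To.
  by rewrite (Hext' qc q) // (Hext' c n).
Qed.

Lemma four_le : nb I qc + nb I n <= nb I q + nb I c.
Proof.
rewrite !nbE -!big_split /=; apply: leq_sum => z _.
by case: (pointwise z.1 z.2).
Qed.

Lemma four_ge :
  (forall m o w, T m -> ~~ T o -> oth w m = Some o -> acc m w -> q o = Some w ->
     n o <> q o -> n m <> c m -> wlt w o m -> rk m (Some w) < rk m (c m) -> False) ->
  (forall m o w, ~~ T m -> T o -> oth w m = Some o -> acc m w -> c o = Some w ->
     n o <> c o -> n m <> q m -> wlt w o m -> rk m (Some w) < rk m (q m) -> False) ->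
  nb I q + nb I c <= nb I qc + nb I n.
Proof.
move=> H1 H2; rewrite !nbE -!big_split /=; apply: leq_sum => z _.
by have [_] := pointwise z.1 z.2; apply=> [o|o]; [exact: H1|exact: H2].
Qed.

End Four.

Lemma endw_fix m e j : nxt e = e -> e = iter j nxt m -> endw m = e.
Proof.
move=> He Ej; have [q [Ew Ee Hu Hc]] := walkP m.
have : e \in walk m by rewrite Ej; apply: (walk_iter Ew Ee Hc); rewrite Ew mem_head.
rewrite Ew => /trajectP[i Hi Ei]; rewrite Ee Ei.
move: Hi; rewrite ltnS => Hi; congr (iter _ nxt m); apply/esym.
by apply: (walk_last Ew Hu Hc Hi (leqnn _)); rewrite iterS -Ei.
Qed.

Lemma endw_walk a m : nxt (endw a) = endw a -> m \in walk a -> endw m = endw a.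
Proof.
move=> He; have [q [Ew Ee Hu Hc]] := walkP a; rewrite Ew => /trajectP[i Hi Ei].
apply: (@endw_fix _ _ (q - i) He); rewrite Ei -iterD subnK; [exact: Ee|by rewrite -ltnS].
Qed.

(** A fixed end identifies a component of the graph of [nextm]; this provides the sets [T] closed in
    both directions. *)
Lemma endw_nxt m e : nxt e = e -> (endw (nxt m) == e) = (endw m == e).
Proof.
move=> He; have [q [Ew Ee Hu Hc]] := walkP m; have [q' [Ew' Ee' _ _]] := walkP (nxt m).
apply/eqP/eqP => E; last first.
  have En : nxt (endw m) = endw m by rewrite E.
  rewrite -E; apply: (endw_walk En); rewrite Ew; case: q Ew Ee Hu Hc => [|q] Ew Ee Hu Hc.
    by move: Hc; rewrite Ee Ew.
  by rewrite /= !inE eqxx orbT.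
by apply: (@endw_fix _ _ q'.+1 He); rewrite iterSr -Ee' E.
Qed.

Section Lists.
Variable N : asg M W.
Notation rw := (rows I N).
Implicit Types (c d : cand M W) (cs ds : seq (cand M W)).

Definition okl cs := all (okcand I s N rw) cs && uniq (served I s cs).

Lemma okcand_end c : okcand I s N rw c -> nxt (endw c.1) = endw c.1.
Proof. by case/and4P=> _ /eqP. Qed.

Lemma addcs_cat (q : asg M W) cs ds : addcs I s q (cs ++ ds) = addcs I s (addcs I s q cs) ds.
Proof. exact: foldl_cat. Qed.

Lemma addcs_out (q : asg M W) cs m : (forall c, c \in cs -> m \notin walk c.1) ->
  get (addcs I s q cs) m = get q m.
Proof.
elim: cs q => [|c cs IHcs] q //= H.
rewrite -/(addcs I s _ cs) IHcs => [|d Hd]; last by apply: H; rewrite inE Hd orbT.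
by rewrite /addc get_cat shift_keys (negbTE (H c (mem_head _ _))).
Qed.

Lemma addcs_in (q : asg M W) cs c m : okl cs -> c \in cs -> m \in walk c.1 ->
  get (addcs I s q cs) m = get (shift s c.2 (walk c.1)) m.
Proof.
elim: cs q => [|d cs IHcs] q //= /andP[/= /andP[Hd Hcs] /andP[Hs Hu]].
rewrite -/(addcs I s _ cs) inE => /orP[/eqP E|Hc] Hm; last first.
  by apply: IHcs => //; rewrite /okl Hcs.
subst d; rewrite addcs_out => [|d Hd'].
  by rewrite /addc get_cat shift_keys Hm.
apply/negP => Hm'; case/negP: Hs; apply/mapP; exists d => //.
rewrite -(endw_walk (okcand_end Hd) Hm).
by rewrite (endw_walk (okcand_end (allP Hcs d Hd')) Hm').
Qed.

Lemma addcs_in_eq (q q' : asg M W) cs ds c m : okl cs -> okl ds -> c \in cs -> c \in ds ->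
  m \in walk c.1 -> get (addcs I s q cs) m = get (addcs I s q' ds) m.
Proof. by move=> H1 H2 H3 H4 Hm; rewrite (addcs_in q H1 H3 Hm) (addcs_in q' H2 H4 Hm). Qed.

Lemma okcand_untouched c m : okcand I s N rw c -> m \in walk c.1 -> get N m = sf m.
Proof.
case/and4P=> _ _ /allP H _ Hm; have := H m Hm; rewrite /eqw.
by case: (get N m) (sf m) => [w|] [w'|] //= /eqP->.
Qed.

Lemma okl_cat cs ds : okl (cs ++ ds) -> [/\ okl cs, okl ds &
  forall c d, c \in cs -> d \in ds -> endw c.1 != endw d.1].
Proof.
rewrite /okl all_cat /served map_cat cat_uniq => /andP[/andP[-> ->] /and3P[-> /hasPn H ->]].
split=> // c d Hc Hd; apply/eqP => E; have /negP := H (endw d.1) (map_f _ Hd); apply.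
by rewrite -E; apply: (map_f (fun c => endw c.1)).
Qed.

Section FourLists.
Variables (cs ds : seq (cand M W)).
Hypothesis Hok : okl (cs ++ ds).

Let T m := has (fun d => endw d.1 == endw m) ds.

Let fixd d : d \in ds -> nxt (endw d.1) = endw d.1.
Proof. by have [_ /andP[/allP H _] _] := okl_cat Hok => /H/okcand_end. Qed.

Let HT m : T (nxt m) = T m.
Proof.
apply: eq_in_has => d Hd; rewrite eq_sym [RHS]eq_sym.
exact: endw_nxt (fixd Hd).
Qed.

Let walkT d m : d \in ds -> m \in walk d.1 -> T m.
Proof. by move=> Hd Hm; apply/hasP; exists d => //; rewrite (endw_walk (fixd Hd) Hm). Qed.

Let walkNT c m : c \in cs -> m \in walk c.1 -> ~~ T m.
Proof.
have [/andP[/allP H _] _ Hd] := okl_cat Hok => Hc Hm; apply/hasPn => d Hdd.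
by rewrite (endw_walk (okcand_end (H c Hc)) Hm) eq_sym Hd.
Qed.

Let Hin m : T m -> get (addcs I s N (cs ++ ds)) m = get (addcs I s N ds) m /\
  get (addcs I s N cs) m = get N m.
Proof.
have [okc okd _] := okl_cat Hok => Tm.
have Hc c : c \in cs -> m \notin walk c.1.
  by move=> Hc; apply/negP => /(walkNT Hc); rewrite Tm.
split; last exact: addcs_out.
case: (boolP (has (fun d => m \in walk d.1) ds)) => [/hasP[d Hd Hm]|/hasPn H].
  by apply: (addcs_in_eq _ _ Hok okd _ Hd Hm); rewrite mem_cat Hd orbT.
by rewrite addcs_cat (addcs_out _ H) (addcs_out _ Hc) (addcs_out _ H).
Qed.

Let Hout m : ~~ T m -> get (addcs I s N (cs ++ ds)) m = get (addcs I s N cs) m /\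
  get (addcs I s N ds) m = get N m.
Proof.
move=> Tm; have Hd d : d \in ds -> m \notin walk d.1.
  by move=> Hd; apply/negP => /(walkT Hd); rewrite (negbTE Tm).
by rewrite addcs_cat !(addcs_out _ Hd).
Qed.

Let Hch es m : okl es -> get (addcs I s N es) m <> get N m ->
  get N m = sf m /\ exists2 c, c \in es & m \in walk c.1.
Proof.
move=> /andP[/allP H _] Hm.
case: (boolP (has (fun c => m \in walk c.1) es)) => [/hasP[c Hc Hcm]|/hasPn Hno].
  by split; [exact: okcand_untouched (H c Hc) Hcm|exists c].
by case: Hm; apply: addcs_out.
Qed.

Lemma add_le : nb I (get (addcs I s N (cs ++ ds))) + nb I (get N)
  <= nb I (get (addcs I s N cs)) + nb I (get (addcs I s N ds)).
Proof.
have [okc okd _] := okl_cat Hok.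
by apply: (four_le HT Hin Hout) => m; [case/(Hch okc)|case/(Hch okd)].
Qed.

Lemma add_ge :
  (forall c d m o w, (c \in cs /\ d \in ds) \/ (c \in ds /\ d \in cs) -> m \in walk d.1 ->
     o \in walk c.1 -> oth w m = Some o -> acc m w -> (forall m', sf m' <> Some w) ->
     get (shift s c.2 (walk c.1)) o = Some w -> wlt w o m ->
     rk m (Some w) < rk m (get (shift s d.2 (walk d.1)) m) -> False) ->
  nb I (get (addcs I s N cs)) + nb I (get (addcs I s N ds))
  <= nb I (get (addcs I s N (cs ++ ds))) + nb I (get N).
Proof.
have [okc okd _] := okl_cat Hok => H.
have Hfree m o w : T m != T o -> oth w m = Some o -> acc m w -> forall m', sf m' <> Some w.
  move=> ne Eo Ha m' Em'; have Eo' := oth_sym D2 Ha Eo; have [Hao no] := oth_acc Eo.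
  case: (eqVneq m' m) => [E|/eqP nm'].
    by case/eqP: ne; rewrite -E in Eo *; rewrite -(nxtE Em' Eo) HT.
  have E : m' = o by apply: (acc2 D2 Ha Hao (s_acc Em')) => // /esym.
  by case/eqP: ne; rewrite -E in Eo' *; rewrite -(nxtE Em' Eo') HT.
apply: (four_ge HT Hin Hout) => [m /(Hch okc)[]|m /(Hch okd)[]||] //.
- move=> m o w Tm To Eo Ha Eq no nm Hw Hrk.
  have [_ [c Hc Hco]] := Hch okc (nesym no); have [_ [d Hd Hdm]] := Hch okd (nesym nm).
  apply: (H c d m o w) => //; first by left.
  + by apply: (Hfree m o) => //; rewrite Tm (negbTE To).
  + by rewrite -(addcs_in N okc Hc Hco).
  + by rewrite -(addcs_in N okd Hd Hdm).
- move=> m o w Tm To Eo Ha Eq no nm Hw Hrk.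
  have [_ [c Hc Hco]] := Hch okd (nesym no); have [_ [d Hd Hdm]] := Hch okc (nesym nm).
  apply: (H c d m o w) => //; first by right.
  + by apply: (Hfree m o) => //; rewrite To (negbTE Tm).
  + by rewrite -(addcs_in N okd Hc Hco).
  + by rewrite -(addcs_in N okc Hd Hdm).
Qed.

End FourLists.
End Lists.

(** * Clusters of paths in a minimal solution *)

Section Clusters.
Variable p : M -> option W.
Hypothesis Hn : nice p.
Variable N : asg M W.
Hypothesis HN : forall m, (moved p m -> get N m = p m) /\ (~ moved p m -> get N m = sf m).
Notation rw := (rows I N).
Implicit Types (c d : cand M W) (cs ds : seq (cand M W)).

Let Hf : fea p. Proof. by case: Hn. Qed.
Let Hp : asn p. Proof. by case: Hf. Qed.

Definition nde a : bool :=
  (p a != sf a) && if p a is Some y then (y \notin wstar I) && free s y else true.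

Lemma ndeP a : reflect (nentry p a) (nde a).
Proof.
rewrite /nde; apply: (iffP andP) => [[/eqP h1 h2]|[[h1 h2] h3]]; last first.
  split; first exact/eqP.
  by case E: (p a) => [y|] //; rewrite (h3 y E) /=; apply/freeP => m; apply: h2.
have K w : p a = Some w -> (w \notin wstar I) /\ forall m, sf m <> Some w.
  by move=> E; move: h2; rewrite E => /andP[? /freeP].
by split; [split=> // m w /K[]|move=> w /K[]].
Qed.

Lemma nentry_unmoved a m : nentry p a -> reach p a m -> ~ moved p m.
Proof.
move=> Ha Hr [Hc|[b Tb Hr']]; first by case: Hc => _ /(_ a (proj1 Ha)).
have E := reach_uniq (proj1 Ha) (proj1 Tb) Hr Hr'; subst b.
exact: token_nentry Tb Ha.
Qed.

Lemma nentry_walk a l : nentry p a -> pend p a l ->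
  [/\ walk a = traject nxt a l.+1, endw a = iter l nxt a & nxt (endw a) = endw a].
Proof.
move=> Ha Hl; have [q [Ew Ee Hu Hc]] := walkP a.
have [_ Es] := row_end Hn Ha Hl.
have En : nxt (iter l nxt a) = iter l nxt a by rewrite /nextm Es.
have Hlq := walk_pend Ew Ee Hu Hc (proj1 Ha) Hl.
have El : l = q by apply: (walk_last Ew Hu Hc Hlq (leqnn _)); rewrite iterS.
by rewrite Ee Ew El -El.
Qed.

Lemma nentry_mem a m : nentry p a -> m \in walk a -> reach p a m.
Proof.
move=> Ha; have [l Hl] := entry_end (proj1 Ha); have [-> _ _] := nentry_walk Ha Hl.
by case/trajectP=> i Hi ->; apply: (pend_reach Hl).
Qed.

Lemma nentry_disj a b m : nentry p a -> nentry p b -> m \in walk a -> m \in walk b -> a = b.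
Proof.
move=> Ha Hb Hma Hmb; apply: reach_uniq (nentry_mem Ha Hma) (nentry_mem Hb Hmb).
  by case: Ha.
by case: Hb.
Qed.

Lemma endw_mem a : endw a \in walk a.
Proof. by have [q [Ew Ee _ _]] := walkP a; rewrite Ee Ew; apply/trajectP; exists q. Qed.

Lemma head_walk a : a \in walk a.
Proof. by have [q [Ew _ _ _]] := walkP a; rewrite Ew mem_head. Qed.

Lemma nentry_end_inj a b : nentry p a -> nentry p b -> endw a = endw b -> a = b.
Proof.
by move=> Ha Hb E; apply: (nentry_disj Ha Hb (endw_mem a)); rewrite E endw_mem.
Qed.

Lemma get_unmoved m : ~ moved p m -> get N m = sf m.
Proof. by case: (HN m) => _; apply. Qed.

Lemma get_moved m : moved p m -> get N m = p m.
Proof. by case: (HN m) => H _; apply: H. Qed.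

Definition pc a : cand M W := (a, p a).

Lemma pc_ok a : nentry p a -> okcand I s N rw (pc a).
Proof.
move=> Ha; have [l Hl] := entry_end (proj1 Ha); have [Ew Ee En] := nentry_walk Ha Hl.
have [Hm Es] := row_end Hn Ha Hl.
have Hun m : m \in walk a -> get N m = sf m.
  by move=> Hm'; apply: get_unmoved; apply: nentry_unmoved Ha (nentry_mem Ha Hm').
apply/and4P; split=> /=.
- by rewrite mem_filter mem_enum Ee Hm /= (Hun (iter l nxt a)) ?Es // -Ee endw_mem.
- exact/eqP.
- by apply/allP => m /Hun->; case: (sf m) => //= w; rewrite eqxx.
case E: (p a) => [w|]; last first.
  by apply/negP => Hma; case: Hf => _ /(_ a Hma).
rewrite (proj1 Hp _ _ E) (proj2 Ha _ E) /=; apply/freeP => m; exact: (proj2 (proj1 Ha)).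
Qed.

Lemma pc_get a m : nentry p a -> m \in walk a -> get (shift s (p a) (walk a)) m = p m.
Proof.
move=> Ha; have [l Hl] := entry_end (proj1 Ha); have [-> _ _] := nentry_walk Ha Hl => Hm.
apply: get_agree; last by rewrite shift_keys.
by move=> e; apply: shift_agree; case: Hl.
Qed.

Lemma pcs_okl (A : seq M) : uniq A -> (forall a, a \in A -> nentry p a) -> okl N (map pc A).
Proof.
move=> Hu HA; apply/andP; split.
  by apply/allP => c /mapP[a /HA Ha ->]; exact: pc_ok.
rewrite /served -map_comp map_inj_in_uniq // => a b /HA Ha /HA Hb.
exact: nentry_end_inj.
Qed.

Lemma pcs_get (A : seq M) a m : uniq A -> (forall a, a \in A -> nentry p a) ->
  a \in A -> m \in walk a -> get (addcs I s N (map pc A)) m = p m.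
Proof.
move=> Hu HA Ha Hm; rewrite -(pc_get (HA a Ha) Hm).
by apply: (addcs_in N (pcs_okl Hu HA) (c := pc a)) => //; apply: map_f.
Qed.

(** The path of [b] forces that of [a]: without the latter, [y] would be single and block with [m].
    As [m] is the only other man for [y], there is at most one successor. *)
Definition edge a b : bool :=
  [&& nde a, nde b, a != b & if p a is Some y then
     if oth y a is Some m then
       [&& m \in walk b, acc m y, rk m (Some y) < rk m (p m) & wlt y a m]
     else false else false].

Lemma edgeP a b : edge a b -> exists y m, [/\ nentry p a, nentry p b,
  p a = Some y, oth y a = Some m & [/\ m \in walk b, acc m y, rk m (Some y) < rk m (p m) & wlt y a m]].
Proof.
case/and4P=> /ndeP Ha /ndeP Hb _; case Ey: (p a) => [y|] //.
by case Em: (oth y a) => [m|] // /and4P[h1 h2 h3 h4]; exists y, m.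
Qed.

Lemma edge_uniq a b b' : edge a b -> edge a b' -> b = b'.
Proof.
case/edgeP=> y [m [Ha Hb Ey Em [Hm _ _ _]]].
case/edgeP=> y' [m' [_ Hb' Ey' Em' [Hm' _ _ _]]].
move: Ey' Em'; rewrite Ey => -[<-]; rewrite Em => -[E]; subst m'.
exact: nentry_disj Hb Hb' Hm Hm'.
Qed.

Lemma wantP (q : asg M W) m y c : c \in want I s q m y ->
  exists o, [/\ c = (o, Some y), oth y m = Some o,
    [/\ acc m y, y \notin wstar I & forall m', sf m' <> Some y],
    rk m (Some y) < rk m (get q m) /\ wlt y o m & forall m', get q m' <> Some y].
Proof.
rewrite /want; case Eo: (oth y m) => [o|] //.
case: ifP => // /and5P[h1 h2 /freeP h3 h4 /andP[h5 /freeP h6]].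
by rewrite inE => /eqP->; exists o.
Qed.

Lemma wantsP (q : asg M W) cs c : c \in wants I s q cs ->
  exists d m y, [/\ d \in cs, m \in walk d.1 & c \in want I s q m y].
Proof.
case/flattenP=> l1 /mapP[d Hd ->] /flattenP[l2 /mapP[m Hm ->]] /flattenP[l3 /mapP[y Hy ->]] H.
by exists d, m, y.
Qed.

Lemma wants_mem (q : asg M W) cs d m y : d \in cs -> m \in walk d.1 -> y \in mpref I m ->
  want I s q m y != [::] -> wants I s q cs != [::].
Proof.
move=> Hd Hm Hy; case E: (want I s q m y) => [|c l] // _.
have : c \in wants I s q cs; last by case: wants.
apply/flattenP; eexists; first by apply/mapP; exists d.
apply/flattenP; eexists; first by apply/mapP; exists m.
by apply/flattenP; exists (want I s q m y); [apply/mapP; exists y|rewrite E mem_head].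
Qed.

(** By [row_nowant] every wanted woman is held in [p], and only by the man to whom [want] gives her;
    so [close] retraces [p] without knowing it, from [a0] backwards along [edge]. *)
Lemma close_spec a0 : nentry p a0 -> exists A, [/\ close I s N (pc a0) = map pc A, uniq A,
  a0 \in A, forall a, a \in A -> nentry p a /\ connect edge a a0
  & forall a b, b \in A -> edge a b -> a \in A].
Proof.
move=> H0; pose F (cs : seq (cand M W)) (_ : M) :=
  if ohead (wants I s (addcs I s N cs) cs) is Some c' then c' :: cs else cs.
have H (e : seq M) : exists A, [/\ foldl F [:: pc a0] e = map pc A, uniq A,
    a0 \in A, forall a, a \in A -> nentry p a /\ connect edge a a0 &
    wants I s (addcs I s N (map pc A)) (map pc A) = [::] \/ size A = (size e).+1].
  elim/last_ind: e => [|e m0 [A [E Hu HA0 HA K]]].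
    exists [:: a0]; split=> //; [exact: mem_head| |by right].
    by move=> a; rewrite inE => /eqP->; split=> //; apply: connect0.
  rewrite -cats1 foldl_cat /= E /F.
  have HAn a : a \in A -> nentry p a by case/HA.
  case Ew: (wants _ _ _ _) => [|c l] /=; first by exists A; split=> //; left.
  have : c \in wants I s (addcs I s N (map pc A)) (map pc A) by rewrite Ew mem_head.
  case/wantsP=> d [m [y [/mapP[a Ha ->] /= Hm /wantP[o [Ec Eo [Hacc Hy Hs] [Hrk Hw] Hq]]]]].
  rewrite (pcs_get Hu HAn Ha Hm) in Hrk.
  have Hna := HAn a Ha; have [i [Ei U]] := nentry_mem Hna Hm.
  have [o' Eo'] : exists o', p o' = Some y.
    by rewrite Ei in Hacc Hrk; apply: (row_nowant Hn Hna U Hacc Hs Hrk).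
  have [Hao no] := oth_acc Eo.
  have E' : o' = o.
    apply: (acc2 D2 Hacc Hao (proj1 Hp _ _ Eo')) => [/esym //|E'].
    by move: Hrk; rewrite -E' Eo' ltnn.
  subst o'.
  have Hno : nentry p o.
    split; last by move=> w; rewrite Eo' => -[<-].
    split=> [E'|m' w]; first by apply: (Hs o); rewrite -E'.
    by rewrite Eo' => -[<-].
  have HoA : o \notin A.
    apply/negP => HoA; apply: (Hq o).
    by rewrite (pcs_get Hu HAn HoA (head_walk o)).
  exists (o :: A); split.
  - by rewrite Ec -Eo'.
  - by rewrite /= HoA.
  - by rewrite inE HA0 orbT.
  - move=> b; rewrite inE => /orP[/eqP->|]; last exact: HA.
    split=> //; have [_ Hca] := HA a Ha; apply: connect_trans Hca; apply: connect1.
    apply/and4P; split; [exact/ndeP|exact/ndeP| |].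
      by apply/eqP => E'; rewrite E' Ha in HoA.
    by rewrite Eo' (oth_sym D2 Hacc Eo) Hm Hacc Hrk Hw.
  right; rewrite size_cat addn1 /=; case: K => [K|->] //.
  by rewrite K in Ew.
have [A [E Hu HA0 HA K]] := H (enum M).
have HAn a : a \in A -> nentry p a by case/HA.
exists A; split=> // a b Hb /edgeP[y [m [Ha _ Ey Em [Hm Hacc Hrk Hw]]]].
case: K => [K|K]; last first.
  have := uniq_leq_size Hu (s2 := enum M) (fun m _ => mem_enum M m).
  by rewrite K ltnn.
apply/negPn/negP => HaA.
have Hpy : forall m', sf m' <> Some y by move=> m'; apply: (proj2 (proj1 Ha)) Ey.
suff: wants I s (addcs I s N (map pc A)) (map pc A) != [::] by rewrite K.
apply: (@wants_mem _ _ (pc b) m y) => //; first exact: map_f.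
  by case/andP: Hacc.
have Hay := proj1 Hp _ _ Ey.
rewrite /want (oth_sym D2 Hay Em) Hacc (proj2 Ha _ Ey) Hw.
rewrite (pcs_get Hu HAn Hb Hm) Hrk.
have -> : free s y by apply/freeP.
have -> // : free (addcs I s N (map pc A)) y.
apply/freeP => m' Em'.
case: (boolP (has (fun a' => m' \in walk a') A)) => [/hasP[a' Ha' Hm']|/hasPn Hno].
  rewrite (pcs_get Hu HAn Ha' Hm') in Em'.
  have E' := proj2 Hp _ _ _ Em' Ey; subst m'.
  have Ea := nentry_disj Ha (HAn a' Ha') (head_walk a) Hm'.
  by rewrite Ea Ha' in HaA.
rewrite addcs_out in Em'; last by move=> c /mapP[a' Ha' ->]; exact: Hno.
case: (classic (moved p m')) => Hmv; last by rewrite (get_unmoved Hmv) in Em'; case: (Hpy m').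
rewrite (get_moved Hmv) in Em'; have E' := proj2 Hp _ _ _ Em' Ey; subst m'.
exact: (nentry_unmoved Ha (reach0 p a)).
Qed.

Lemma nblkE (q : asg M W) : nblk I q = nb I (get q).
Proof.
rewrite /nblk nbE size_flatten /shape -map_comp sumnE big_map big_enum /=.
rewrite -(pair_bigA _ (fun m w => (blk (get q) m w : nat))) /=; apply: eq_bigr => m _.
have /card_uniqP <- : uniq [seq w <- mpref I m | blk (get q) m w].
  by rewrite filter_uniq ?mpref_uniq.
rewrite -sum1_card big_mkcond /=; apply: eq_bigr => w _; rewrite mem_filter.
by case E: (blk (get q) m w) => //=; case/and3P: E => /andP[-> _].
Qed.

Lemma nb_ext p1 p2 : p1 =1 p2 -> nb I p1 = nb I p2.
Proof.
by move=> E; rewrite !nbE; apply: eq_bigr => z _; rewrite (@blk_ext p1 p2) // => o _; rewrite E.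
Qed.

Lemma pcs_perm (A B : seq M) : uniq A -> uniq B -> A =i B ->
  (forall a, a \in A -> nentry p a) ->
  nb I (get (addcs I s N (map pc A))) = nb I (get (addcs I s N (map pc B))).
Proof.
move=> HuA HuB E HA; apply: nb_ext => m.
have HB a : a \in B -> nentry p a by rewrite -E; apply: HA.
case: (boolP (has (fun a => m \in walk a) A)) => [/hasP[a Ha Hm]|/hasPn Hno].
  by rewrite (pcs_get HuA HA Ha Hm) (pcs_get HuB HB _ Hm) -?E.
by rewrite !addcs_out // => c /mapP[a Ha ->]; apply: Hno => //; rewrite E.
Qed.

Lemma nentry_reach_walk a m : nentry p a -> reach p a m -> m \in walk a.
Proof.
move=> Ha [i [-> U]]; have [l Hl] := entry_end (proj1 Ha); have [-> _ _] := nentry_walk Ha Hl.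
apply/trajectP; exists i => //; rewrite ltnS leqNgt; apply/negP => Hi.
by case: Hl => _ /negP; apply; apply: U.
Qed.

Lemma unmoved_cases m : ~ moved p m -> p m = sf m \/ exists2 a, nentry p a & m \in walk a.
Proof.
move=> Hm; case: (classic (p m = sf m)) => [|ne]; [by left|right].
case: (touched_cases ne) => [Hc|[a Ha Hr]]; first by case: Hm; left.
case: (entry_cases Ha) => Ha'; first by case: Hm; right; exists a.
by exists a => //; apply: nentry_reach_walk.
Qed.

Lemma rowsP m : reflect (exists2 a, nentry p a & m = endw a) (m \in rw).
Proof.
apply: (iffP idP) => [|[a Ha ->]]; last by case/and4P: (pc_ok Ha).
rewrite mem_filter mem_enum andbT => /andP[Hm]; case E: (get N m) => // _.
have Hpm : p m <> None by case: Hf => _ /(_ m Hm).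
have Hnm : ~ moved p m by move=> /get_moved E'; case: Hpm; rewrite -E' E.
have Es := get_unmoved Hnm; rewrite E in Es.
case: (unmoved_cases Hnm) => [E'|[a Ha Hma]]; first by case: Hpm; rewrite E' Es.
exists a => //; have [l Hl] := entry_end (proj1 Ha); have [_ _ En] := nentry_walk Ha Hl.
by rewrite -(endw_walk En Hma); apply/esym/(@endw_fix _ _ 0) => //; rewrite /nextm -Es.
Qed.

Lemma pcs_all : nb I (get (addcs I s N (map pc (enum nde)))) = nb I p.
Proof.
have HA a : a \in enum nde -> nentry p a by rewrite mem_enum => /ndeP.
apply: nb_ext => m.
case: (boolP (has (fun a => m \in walk a) (enum nde))) => [/hasP[a Ha Hm]|/hasPn Hno].
  exact: (pcs_get (enum_uniq _) HA Ha Hm).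
rewrite addcs_out => [|c /mapP[a Ha ->]]; last exact: Hno.
case: (classic (moved p m)) => Hm; first exact: get_moved.
rewrite get_unmoved //; case: (unmoved_cases Hm) => [-> //|[a Ha Hma]].
by move: (Hno a); rewrite mem_enum Hma => /(_ (introT (ndeP a) Ha)).
Qed.

Lemma newm_mem cs y : reflect (exists a, (a, Some y) \in cs) (y \in newm cs).
Proof.
apply: (iffP flattenP) => [[l /mapP[[a [w|]] Hc ->]]|[a Ha]] //=.
  by rewrite inE => /eqP ->; exists a.
by exists [:: y]; rewrite ?mem_head //; apply/mapP; exists (a, Some y).
Qed.

Lemma newm_cat cs ds : newm (cs ++ ds) = newm cs ++ newm ds.
Proof. by rewrite /newm map_cat flatten_cat. Qed.

Lemma size_newm cs : size (newm cs) <= size cs.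
Proof. by elim: cs => // -[a [w|]] cs IH //=; apply: leq_trans IH _. Qed.

Lemma newm_pcs (A : seq M) : uniq A -> uniq (newm (map pc A)).
Proof.
elim: A => //= a A IH /andP[Ha Hu]; rewrite /newm /=; case E: (p a) => [y|] /=; last exact: IH.
rewrite IH // andbT; apply/newm_mem => -[b /mapP[b' Hb [_ E']]].
by move/negP: Ha; apply; rewrite (proj2 Hp _ _ _ E (esym E')).
Qed.

Lemma newm_pc (A : seq M) y : y \in newm (map pc A) -> exists2 a, a \in A & p a = Some y.
Proof. by case/newm_mem=> a /mapP[b Hb [_ E]]; exists b. Qed.

Section Forbid.
Variables (R : seq M) (n : nat).
Hypothesis Hrw : size rw <= n.
Notation good F cs := (okclus I s N rw R F cs).
Notation best := (best_cluster I s N rw R).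
Notation forbid := (forbid I s N rw R).

Lemma best_spec (F : seq W) cs : cs \in clusters I s N rw R F ->
  good F (best F) /\ nblk I (addcs I s N (best F)) <= nblk I (addcs I s N cs).
Proof.
rewrite /best_cluster => Hcs; set L := clusters _ _ _ _ _ _ in Hcs *.
have HL ds : ds \in L -> good F ds by rewrite mem_filter => /andP[].
have H (l : seq (seq (cand M W))) : (forall ds, ds \in l -> ds \in L) ->
  if foldl (better I s N) None l is Some b then
    b \in L /\ forall ds, ds \in l -> nblk I (addcs I s N b) <= nblk I (addcs I s N ds)
  else l = [::].
  elim/last_ind: l => // l d IHl Hl; rewrite -cats1 foldl_cat /=.
  have Hd : d \in L by apply: Hl; rewrite mem_rcons mem_head.
  have {}IHl : _ := IHl (fun ds (h : ds \in l) => Hl ds (eq_ind_r is_true (mem_behead (s := d :: l) h) (mem_rcons l d ds))).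
  case: foldl IHl => [b [Hb IHl]|->] /=; last first.
    by split=> // ds; rewrite inE => /eqP->.
  case: leqP => Hle; split=> // ds; rewrite mem_cat inE => /orP[|/eqP-> //].
  - exact: IHl.
  - by move/IHl; apply: leq_trans; apply: ltnW.
have := H L (fun _ => id); case: foldl => [b [Hb Hmin]|E]; first by split; [exact: HL|exact: Hmin].
by move: Hcs; rewrite E.
Qed.

Lemma good_size F cs : good F cs -> size (newm cs) <= n.
Proof.
case/and5P=> /allP Hok Hu _ _ _; apply: leq_trans (size_newm cs) _.
rewrite -(size_map (fun c => endw c.1) cs); apply: leq_trans Hrw.
by apply: uniq_leq_size Hu _ => m /mapP[c /Hok /and4P[H _ _ _] ->].
Qed.

(** At most [n] new women occur in a cluster, so the position [n] is out of range. *)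
Lemma forbid_pad js u : forbid js = forbid (js ++ nseq u n).
Proof.
rewrite /forbid foldl_cat; set F := foldl _ _ js; elim: u => //= u IH.
rewrite drop_oversize //=.
have [E|] := eqVneq (clusters I s N rw R F) [::]; first by rewrite /best_cluster E.
case E: (clusters _ _ _ _ _ _) => [|cs l] // _.
have /best_spec[Hg _] : cs \in clusters I s N rw R F by rewrite E mem_head.
exact: good_size Hg.
Qed.

(** As long as the best cluster uses a woman of [Y], she is forbidden. Only women of [Y] are ever
    forbidden, and [cs0] avoids them, so it stays admissible and the best cluster stays at least as
    good; every round uses up a woman of [Y]. *)
Lemma forbidP cs0 (Y : seq W) : cs0 \in [seq close I s N h | h <- heads I] ->
  good [::] cs0 -> (forall y, y \in Y -> y \notin newm cs0) -> size Y <= n ->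
  exists js, [/\ size js = n, forall j, j \in js -> j < n.+1,
    good [::] (best (forbid js)), forall y, y \in Y -> y \notin newm (best (forbid js))
    & nblk I (addcs I s N (best (forbid js))) <= nblk I (addcs I s N cs0)].
Proof.
move=> Hc0 /and5P[g1 g2 g3 g4 /andP[g5 _]] HY Hn0.
have Hin (F : seq W) : {subset F <= Y} -> cs0 \in clusters I s N rw R F.
  move=> HF; rewrite mem_filter Hc0 andbT; apply/and5P; split=> //; rewrite g5 /=.
  by apply/allP => y Hy; apply/negP => /HF/HY; rewrite Hy.
have H u : forall js, [/\ size js <= size Y, forall j, j \in js -> j < n.+1,
    {subset forbid js <= Y} , uniq (forbid js) & size (forbid js) = size js] ->
  size Y - size js <= u -> exists js', [/\ size js' <= n, forall j, j \in js' -> j < n.+1,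
    {subset forbid js' <= Y} & forall y, y \in Y -> y \notin newm (best (forbid js'))].
  elim: u => [|u IHu] js [h1 h2 h3 h4 h5] Hd.
    exists js; split=> //; first exact: leq_trans Hn0.
    move=> y Hy; have [Hg _] := best_spec (Hin _ h3); case/and5P: Hg => _ _ _ _ /andP[_ /allP Hg].
    apply/negP => /Hg/negP; apply.
    have/(uniq_min_size h4 h3)[] : size Y <= size (forbid js) by rewrite h5; clear -Hd; lia.
    by move=> _ ->.
  case: (boolP (has (fun y => y \in newm (best (forbid js))) Y)) => [/hasP[y Hy Hb]|/hasPn Hno]; last first.
    by exists js; split=> //; exact: leq_trans Hn0.
  have [Hg _] := best_spec (Hin _ h3).
  have Hyf : y \notin forbid js by case/and5P: Hg => _ _ _ _ /andP[_ /allP]; apply.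
  have Hsz := good_size Hg.
  have Ef : forbid (rcons js (index y (newm (best (forbid js))))) = y :: forbid js.
    rewrite /forbid -cats1 foldl_cat /= -/(forbid js).
    by rewrite (drop_nth y) ?index_mem // nth_index.
  have Hsub : {subset y :: forbid js <= Y}.
    by move=> z; rewrite inE => /orP[/eqP->|/h3].
  have Hu' : uniq (y :: forbid js) by rewrite /= Hyf.
  have Hs' := uniq_leq_size Hu' Hsub; rewrite /= h5 in Hs'.
  apply: (IHu (rcons js (index y (newm (best (forbid js)))))).
    rewrite Ef size_rcons /= h5; split=> //.
    move=> j; rewrite mem_rcons inE => /orP[/eqP->|/h2 //].
    by rewrite ltnS; apply: leq_trans Hsz; rewrite ltnW ?index_mem.
  by rewrite size_rcons; clear -Hs' Hd; lia.
have [||js [h1 h2 h3 h4]] := H (size Y) [::]; [by split|by rewrite subn0|].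
exists (js ++ nseq (n - size js) n); rewrite -forbid_pad; split=> //.
- by rewrite size_cat size_nseq subnKC.
- by move=> j; rewrite mem_cat => /orP[/h2 //|/nseqP[-> _]].
- have [/and5P[k1 k2 k3 k4 /andP[k5 _]] _] := best_spec (Hin _ h3); apply/and5P; split=> //.
  by rewrite k5 all_predT.
- by have [_] := best_spec (Hin _ h3).
Qed.

End Forbid.
(** Moving to a vertex from which there is no way back shrinks the set of reachable vertices. *)
Lemma terminal a : exists h, connect edge a h /\ forall b, connect edge h b -> connect edge b h.
Proof.
have [n] := ubnP #|connect edge a|; elim: n a => // n IHn a Hna.
case: (boolP [forall b, connect edge a b ==> connect edge b a]) => [/forallP H|].
  by exists a; split=> [|b]; [exact: connect0|exact: (implyP (H b))].
rewrite negb_forall => /existsP[b]; rewrite negb_imply => /andP[Hab Hba].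
have [|h [h1 h2]] := IHn b; last by exists h; split=> //; exact: connect_trans Hab h1.
apply: leq_trans (proper_card _) _; last by rewrite -ltnS; exact: Hna.
apply/properP; split; last by exists a; rewrite ?unfold_in // ; apply: connect0.
by apply/subsetP => m; rewrite !unfold_in; apply: connect_trans.
Qed.

Lemma marked_filter (P : pred M) (r : seq M) (n : nat) :
  marked r ([seq (P m : nat) | m <- r] ++ nseq n 0) = [seq m <- r | P m].
Proof.
rewrite /marked; elim: r => [|m r IHr]; first by case: n.
by rewrite /=; case: (P m) => /=; rewrite IHr.
Qed.

Definition gok (n : nat) (g : seq nat * seq nat) : bool :=
  [&& size g.1 == n, size g.2 == n, all (fun j => j < n.+2) g.1 & all (fun j => j < n.+2) g.2].

(** An interaction between the two parts, as described in [add_ge], would be an [edge] between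
    them. *)
Lemma no_cross (A B : seq M) : uniq (A ++ B) -> (forall a, a \in A ++ B -> nentry p a) ->
  (forall a b, edge a b -> (a \in A) = (b \in A)) ->
  nb I (get (addcs I s N (map pc A))) + nb I (get (addcs I s N (map pc B)))
  <= nb I (get (addcs I s N (map pc (A ++ B)))) + nb I (get N).
Proof.
move=> Hu HA Hcl; rewrite map_cat; apply: add_ge; rewrite -?map_cat; first exact: pcs_okl.
move=> c d m o w Hcd Hm Ho Eo Hacc Hw Eow Hlt Hrk.
have [a [b [Ec Ed Hab]]] : exists a b, [/\ c = pc a, d = pc b &
    (a \in A /\ b \in B) \/ (a \in B /\ b \in A)].
  by case: Hcd => -[/mapP[a Ha ->] /mapP[b Hb ->]]; exists a, b; split=> //; [left|right].
have [Ha Hb] : nentry p a /\ nentry p b.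
  by case: Hab => -[h1 h2]; split; apply: HA; rewrite mem_cat ?h1 ?h2 ?orbT.
subst c d; rewrite /= in Hm Ho Eow Hrk.
rewrite (pc_get Ha Ho) in Eow; rewrite (pc_get Hb Hm) in Hrk.
have Heo : entry p o.
  by split=> [E|m' w']; [apply: (Hw o); rewrite -E|rewrite Eow => -[<-]].
have E := reach_uniq (proj1 Ha) Heo (nentry_mem Ha Ho) (reach0 p o); subst o.
have He : edge a b.
  apply/and4P; split; [exact/ndeP|exact/ndeP| |].
    apply/eqP => E; subst b; case: Hab => -[h1 h2].
      by move: Hu; rewrite cat_uniq => /and3P[_ /hasPn/(_ a h2)/negP].
    by move: Hu; rewrite cat_uniq => /and3P[_ /hasPn/(_ a h1)/negP].
  by rewrite Eow (oth_sym D2 Hacc Eo) Hm Hacc Hrk Hlt.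
have E := Hcl a b He.
have K : forall z, z \in A -> z \in B -> False.
  by move=> z h1 h2; move: Hu; rewrite cat_uniq => /and3P[_ /hasPn/(_ z h2)/negP].
by case: Hab => -[h1 h2]; [apply: (K b)|apply: (K a)] => //; rewrite -?E // E.
Qed.

(** One cluster is split off. The rest is replaced by induction, avoiding the women of this cluster;
    then the cluster is replaced by the best one avoiding the women now used by the rest. [Y]
    collects the women to be avoided, and the bound on [size Y + size S] keeps them few enough to be
    named. *)
Lemma row_guess (n : nat) (Hrw : size rw <= n) : forall (u : nat) (S : seq M) (Y : seq W),
  size S <= u -> uniq S -> (forall a, a \in S -> nentry p a) ->
  (forall a b, edge a b -> (a \in S) = (b \in S)) ->
  (forall y, y \in Y -> y \notin newm (map pc S)) -> size Y + size S <= n ->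
  exists G, [/\ size G <= size S, all (gok n) G, okl N (rowcands I s N rw G) &
    served I s (rowcands I s N rw G) =i map endw S /\
   [/\ uniq (newm (rowcands I s N rw G)), forall y, y \in Y -> y \notin newm (rowcands I s N rw G) &
    nb I (get (addcs I s N (rowcands I s N rw G))) <= nb I (get (addcs I s N (map pc S)))]].
Proof.
elim=> [|u IHu] S Y Hs Hu HS Hcl HY Hn0.
  by exists [::]; case: S Hs Hu HS Hcl HY Hn0 => // *; split=> //; split.
case: (S =P [::]) => [->|]; first by exists [::]; split=> //; split.
case ES: {1}S => [|a0 S0] // _; have Ha0 : a0 \in S by rewrite ES mem_head.
clear ES S0.
(* Successors are unique, so the entries that reach a terminal [h] form a whole component, and
   removing them leaves a set closed under [edge]. *)
have [h [Hh Ht]] := terminal a0.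
have Hcon := closed_connect (a := mem S) Hcl.
have HhS : h \in S by rewrite -(Hcon _ _ Hh).
have [A [EA HuA HhA HA HAcl]] := close_spec (HS h HhS).
have HAS a : a \in A -> a \in S by case/HA=> _ /Hcon->.
have HAp t : forall b, path edge b t -> last b t \in A -> b \in A.
  by elim: t => //= z t IHt b /andP[Hz Hpt] Hl; apply: HAcl Hz; apply: IHt.
have HAc a b : edge a b -> (a \in A) = (b \in A).
  move=> Hab; apply/idP/idP => [/HA[Ha]|/HAcl/(_ Hab) //].
  case/connectP=> -[/= _ E|b' t /= /andP[Hab' Hpt] Et].
    have := Ht b; rewrite E => /(_ (connect1 Hab)) /connectP[t Hpt Et].
    by apply: HAp Hpt _; rewrite -Et -E.
  by rewrite (edge_uniq Hab Hab'); apply: HAp Hpt _; rewrite -Et.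
pose S' : seq M := [seq a <- S | a \notin A].
have HuS' : uniq S' by rewrite filter_uniq.
have HS'S a : a \in S' -> a \in S by rewrite mem_filter => /andP[].
have Hperm : perm_eq (A ++ S') S.
  apply: uniq_perm => //.
    rewrite cat_uniq HuA HuS' andbT; apply/hasPn => z; by rewrite mem_filter => /andP[].
  move=> z; rewrite mem_cat mem_filter; case: (boolP (z \in A)) => //= Hz; exact/esym/HAS.
have HS'm z : (z \in S') = (z \notin A) && (z \in S) by rewrite mem_filter.
clearbody S'.
have HuAS : uniq (A ++ S') by rewrite (perm_uniq Hperm).
have Hsz : size A + size S' = size S by rewrite -size_cat; exact: perm_size.
have HApos : 0 < size A by case: (A) HhA.
have HAn a : a \in A -> nentry p a by case/HA.
have HASn a : a \in A ++ S' -> nentry p a by rewrite (perm_mem Hperm); exact: HS.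
have [||||y|| G' [g1 g2 g3 [g4 [g5 g6 g7]]]] := IHu S' (Y ++ newm (map pc A)) => //.
- by clear -Hsz HApos Hs; lia.
- by move=> a /HS'S/HS.
- by move=> a b /[dup] /Hcl E /HAc E'; rewrite !HS'm E E'.
- rewrite mem_cat => /orP[/HY|/newm_pc[a Ha Ea]]; last first.
    apply/negP => /newm_pc[b Hb Eb]; move: Hb; rewrite HS'm.
    by rewrite (proj2 Hp _ _ _ Eb Ea) Ha.
  by apply: contra => /newm_pc[a /HS'S Ha Ea]; apply/newm_mem; exists a; apply/mapP; exists a => //; rewrite /pc Ea.
- have H1 := size_newm (map pc A); rewrite size_map in H1.
  by rewrite size_cat; clear -H1 Hsz Hn0; lia.
set ds' := rowcands I s N rw G' in g3 g4 g5 g6 g7.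
have Hsd : size ds' <= size S'.
  have /andP[_ Hus] := g3; rewrite -(size_map (fun c => endw c.1) ds') -(size_map endw S').
  by apply: uniq_leq_size => // z; rewrite -/(served I s ds') g4.
pose R := [seq m <- rw | m \in served I s (map pc A)].
have /andP[HokA HusA] := pcs_okl HuA HAn.
have HokE c : c \in map pc A -> endw c.1 \in rw by move/(allP HokA)/and4P=> [].
have HservA : served I s (map pc A) = map endw A by rewrite /served -map_comp.
have Hgood : okclus I s N rw R [::] (map pc A).
  apply/and5P; split=> //; first exact: newm_pcs.
    apply/allP => m Hm; rewrite mem_filter Hm /=; case/mapP: Hm => c Hc ->.
    exact: HokE.
  by apply/andP; split; apply/allP => // m; rewrite mem_filter => /andP[].
have [||||js [j1 j2 j3 j4 j5]] := forbidP (R := R) (cs0 := map pc A) (Y := Y ++ newm ds') Hrw.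
- rewrite -EA; apply: map_f; apply/flattenP; eexists; first by apply: map_f; rewrite mem_enum.
  rewrite /pc; case E: (p h) => [w|]; last exact: mem_head.
  by rewrite inE map_f ?orbT //; case/andP: (proj1 Hp _ _ E).
- exact: Hgood.
- move=> y; rewrite mem_cat => /orP[/HY h1|h1]; apply/negP => h2.
    move/negP: h1; apply; case/newm_pc: h2 => a Ha Ea; apply/newm_mem; exists a.
    by apply/mapP; exists a; [exact: HAS|rewrite /pc Ea].
  by have := g6 y; rewrite mem_cat h2 orbT => /(_ isT); rewrite h1.
- by have H1 := size_newm ds'; rewrite size_cat; clear -H1 Hsz Hn0 Hsd; lia.
pose g := ([seq (m \in served I s (map pc A) : nat) | m <- rw] ++ nseq (n - size rw) 0, js).
exists (g :: G'); set ds1 := best_cluster _ _ _ _ _ _ in j3 j4 j5.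
have Eds : rowcands I s N rw (g :: G') = ds1 ++ ds' by rewrite /rowcands /= marked_filter.
rewrite Eds; case/and5P: j3 => k1 k2 k3 /allP k4 /andP[/allP k5 _].
have Hsv1 : served I s ds1 =i map endw A.
  move=> m; rewrite -HservA; apply/idP/idP => [/k4|Hm]; first by rewrite mem_filter => /andP[].
  by apply: k5; rewrite mem_filter Hm; case/mapP: Hm => c Hc ->; exact: HokE.
have Hokl : okl N (ds1 ++ ds').
  case/andP: (g3) => h1 h2; rewrite /okl all_cat k1 h1 /served map_cat cat_uniq k2 h2 /= andbT.
  apply/hasPn => m; rewrite -/(served I s ds') g4 => /mapP[b Hb ->].
  apply/negP; rewrite -/(served I s ds1) Hsv1 => /mapP[a Ha].
  move/(nentry_end_inj (HS b (HS'S b Hb)) (HAn a Ha)) => E; subst b.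
  by move: Hb; rewrite HS'm Ha.
split=> //.
- by rewrite /=; clear -Hsz g1 HApos; lia.
- rewrite /= g2 andbT; apply/and4P; split=> /=.
  + by rewrite size_cat size_map size_nseq subnKC.
  + by rewrite j1.
  + rewrite all_cat all_map; apply/andP; split; first by apply/allP => m _ /=; case: (_ \in _).
    by apply/allP => j /nseqP[->].
  + by apply/allP => j /j2 Hj; rewrite leqW.
split.
  move=> m; rewrite /served map_cat mem_cat -/(served I s ds1) -/(served I s ds') Hsv1 g4.
  by rewrite -mem_cat -map_cat (perm_mem (perm_map endw Hperm)).
split.
- rewrite newm_cat cat_uniq k3 g5 andbT; apply/hasPn => y Hy; apply: j4.
  by rewrite mem_cat Hy orbT.
- move=> y Hy; rewrite newm_cat mem_cat negb_or j4 ?mem_cat ?Hy //=.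
  by apply: g6; rewrite mem_cat Hy.
rewrite !nblkE in j5.
(* Subadditivity for the replacements is played against superadditivity for the parts of [p]; the
   count for [N] cancels. *)
have h1 := add_le Hokl; have h2 := no_cross HuAS HASn HAc.
rewrite (pcs_perm HuAS Hu (perm_mem Hperm)) // in h2; clear -h1 h2 j5 g7; lia.
Qed.

(** * Feasibility of the assignment filled with clusters *)

Lemma moved_back m : adv p m -> moved p (nxt m) -> moved p m.
Proof.
move=> Ha [Hc|[a Ta Hr]]; last by right; exists a => //; apply: reach_back Hr Ha; case: Ta.
have [m' [Ha' E Hc']] := cyc_pred Hp Hc.
by left; rewrite (pred_uniq Ha Ha' (esym E)).
Qed.

Lemma N_asn : asn (get N).
Proof.
split=> [m w|m m' w].
  case: (classic (moved p m)) => Hm; first by rewrite get_moved //; apply: (proj1 Hp).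
  by rewrite get_unmoved //; apply: s_acc.
have K m1 m2 : moved p m1 -> ~ moved p m2 -> p m1 = Some w -> sf m2 = Some w -> m1 = m2.
  move=> H1 H2 E1 E2; apply: NNPP => ne.
  by have [Ha En] := hold_adv Hp E2 E1 ne; apply/H2/moved_back; rewrite ?En.
case: (classic (moved p m)) => Hm; case: (classic (moved p m')) => Hm';
  rewrite ?(get_moved Hm) ?(get_moved Hm') ?(get_unmoved Hm) ?(get_unmoved Hm').
- exact: (proj2 Hp).
- exact: K.
- by move=> h1 h2; apply/esym/K.
- exact: s_inj.
Qed.

(** Among the moved men only tokens hold women unmatched in [s], and those women are
    distinguished. *)
Lemma N_free y m : y \notin wstar I -> (forall m', sf m' <> Some y) -> get N m <> Some y.
Proof.
move=> Hy Hs; case: (classic (moved p m)) => Hm; last by rewrite get_unmoved //; apply: Hs.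
rewrite get_moved // => E.
have He : entry p m.
  by split=> [E'|m' w]; [apply: (Hs m); rewrite -E'|rewrite E => -[<-]].
case: Hm => [[_ Hc]|[a Ta Hr]]; first exact: Hc He (reach0 p m).
have E' := reach_uniq (proj1 Ta) He Hr (reach0 p m); subst a.
by case: Ta => _ [w]; rewrite E => -[<-]; rewrite (negbTE Hy).
Qed.

Lemma N_cover w : w \in wstar I -> exists m, get N m = Some w.
Proof.
move=> Hw; have [m Em] : exists m, p m = Some w by case: Hf => _ _; apply.
case: (classic (moved p m)) => Hm; first by exists m; rewrite get_moved.
case: (unmoved_cases Hm) => [E|[a Ha Hma]]; first by exists m; rewrite get_unmoved // -E.
have [[|i] [Ei U]] := nentry_mem Ha Hma.
  by case: Ha => _ /(_ w); rewrite -[a]/(iter 0 nxt a) -Ei Em Hw => /(_ erefl).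
exists (iter i nxt a); rewrite get_unmoved; last first.
  by apply: (nentry_unmoved Ha); exists i; split=> //; apply: uptoW U.
by rewrite -(adv_eq (U i (leqnn _))) -iterS -Ei.
Qed.

Lemma get_cons (e : M * option W) (q : asg M W) m :
  get (e :: q) m = if e.1 == m then e.2 else get q m.
Proof. by rewrite /get /=; case: eqP. Qed.

Lemma get_shift (n i : nat) a x : uniq (traject nxt a n) -> i < n ->
  get (shift s x (traject nxt a n)) (iter i nxt a) = if i is j.+1 then sf (iter j nxt a) else x.
Proof.
elim: n i a x => // n IHn i a x /= /andP[Ha Hu] Hi.
rewrite -/(shift s (sf a) _) get_cons /=; case: i Hi => [|i] Hi; first by rewrite eqxx.
rewrite iterSr; case: eqP => [E|_].
  by case/trajectP: Ha; exists i.
by rewrite IHn //; case: i Hi => //= i _; rewrite -iterSr.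
Qed.

Definition val (c : cand M W) m := get (shift s c.2 (walk c.1)) m.

Lemma val_cases c m : m \in walk c.1 -> (m = c.1 /\ val c m = c.2) \/
  exists m0, [/\ m0 \in walk c.1, nxt m0 = m, nxt m0 <> m0 & val c m = sf m0].
Proof.
rewrite /val; have [l [Ew Ee Hu Hc]] := walkP c.1; rewrite Ew in Hu *.
case/trajectP=> i Hi ->; rewrite get_shift //; case: i Hi => [|i] Hi; [by left|right].
exists (iter i nxt c.1); split=> //; first by apply/trajectP; exists i => //; apply: ltnW.
move=> E; move/uniqP: Hu => /(_ c.1 i i.+1).
rewrite !inE size_traject (ltnW Hi) Hi !nth_traject ?(ltnW Hi) // -E.
by move=> /(_ isT isT erefl) /n_Sn.
Qed.

Lemma val_next c m w : okcand I s N rw c -> m \in walk c.1 -> sf m = Some w ->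
  nxt m \in walk c.1 /\ val c (nxt m) = Some w.
Proof.
move=> Hok; rewrite /val; have [l [Ew Ee Hu Hc]] := walkP c.1 => Hm Es.
have ne : m <> endw c.1.
  move=> E; have := okcand_untouched Hok Hm; rewrite Es E.
  by case/and4P: Hok; rewrite mem_filter => /andP[/andP[_]]; case: (get N _).
move: Hm; rewrite Ew in Hu *; case/trajectP=> i Hi Ei.
have Hil : i.+1 < l.+1.
  rewrite ltnS ltn_neqAle -ltnS Hi andbT; apply/eqP => E; apply: ne.
  by rewrite Ei Ee E.
rewrite Ei -iterS get_shift // -Ei; split=> //.
by apply/trajectP; exists i.+1.
Qed.

(** Each path ends at a man without partner, so every woman given up on it is taken by the next man
    and all women covered by [N] stay covered. *)
Lemma filled_fea cs : okl N cs -> served I s cs =i rw -> uniq (newm cs) ->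
  fea (get (addcs I s N cs)).
Proof.
move=> Hok Hsv Huy; have /andP[Hall _] := Hok.
have Hc c : c \in cs -> okcand I s N rw c by move/(allP Hall).
have Hin c m : c \in cs -> m \in walk c.1 -> get (addcs I s N cs) m = val c m.
  exact: (addcs_in N Hok).
have Hcase m : (exists2 c, c \in cs & m \in walk c.1) \/
    get (addcs I s N cs) m = get N m /\ forall c, c \in cs -> m \notin walk c.1.
  case: (boolP (has (fun c => m \in walk c.1) cs)) => [/hasP[c h1 h2]|/hasPn Hno].
    by left; exists c.
  by right; split=> [|c /Hno //]; apply: addcs_out => c /Hno.
have Hdisj c d m : c \in cs -> d \in cs -> m \in walk c.1 -> m \in walk d.1 -> c = d.
  have /andP[_ Hus] := Hok => h1 h2 h3 h4.
  have E : endw c.1 = endw d.1.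
    by rewrite -(endw_walk (okcand_end (Hc c h1)) h3) (endw_walk (okcand_end (Hc d h2)) h4).
  move: Hus; rewrite /served => Hus.
  elim: cs Hus h1 h2 E {Hok Hsv Huy Hall Hc Hin Hcase h3 h4} => // e cs IH /= /andP[He Hus].
  rewrite !inE => /orP[/eqP->|h1] /orP[/eqP->|h2] // E.
  - by case/negP: He; apply/mapP; exists d.
  - by case/negP: He; apply/mapP; exists c.
  exact: IH.
have Hy c y : c \in cs -> c.2 = Some y -> [/\ acc c.1 y, y \notin wstar I & forall m, sf m <> Some y].
  by move=> /Hc/and4P[_ _ _]; case: c.2 => // w /and3P[h1 h2 /freeP h3] [<-].
have Hyu c d y : c \in cs -> d \in cs -> c.2 = Some y -> d.2 = Some y -> c = d.
  elim: cs Huy {Hok Hsv Hall Hc Hin Hcase Hdisj Hy} => // e cs IH Hu.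
  have Hu' : uniq (newm cs) by move: Hu; rewrite /newm /= cat_uniq => /and3P[].
  have Hne f : f \in cs -> e.2 = Some y -> f.2 = Some y -> False.
    move=> Hfc Ee Ef; move: Hu; rewrite /newm /= Ee /= => /andP[/newm_mem H _]; apply: H.
    by exists f.1; rewrite -Ef -surjective_pairing.
  rewrite !inE => /orP[/eqP->|h1] /orP[/eqP->|h2] // h3 h4.
  - by case: (Hne d).
  - by case: (Hne c).
  exact: IH.
split; first split.
- move=> m w; case: (Hcase m) => [[c h1 h2]|[-> _]]; last exact: (proj1 N_asn).
  rewrite (Hin c m h1 h2) => Ev; case: (val_cases h2) => [[E Ev']|[m0 [k1 k2 k3 k4]]].
    by have [h _ _] := Hy c w h1 (etrans (esym Ev') Ev); rewrite E.
  rewrite k4 in Ev; have [w' [E1 E2]] := nxt_neq k3.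
  by move: E1 E2; rewrite Ev => -[<-]; rewrite k2 => /oth_acc[].
- have Kout c m1 m2 w : c \in cs -> m1 \in walk c.1 -> val c m1 = Some w ->
      get N m2 = Some w -> m2 \in walk c.1.
    move=> h1 h2 h3 h4; case: (val_cases h2) => [[E Ev]|[m0 [k1 k2 k3 k4]]].
      by have [_ ny fy] := Hy c w h1 (etrans (esym Ev) h3); case: (N_free ny fy h4).
    rewrite -(proj2 N_asn _ _ w _ h4 : m0 = m2) //.
    by rewrite (okcand_untouched (Hc c h1) k1) -k4.
  move=> m m' w; case: (Hcase m) => [[c h1 h2]|[-> Ho]].
    rewrite (Hin c m h1 h2) => Ev; case: (Hcase m') => [[d h3 h4]|[-> Ho' E']]; last first.
      by move: (Ho' c h1); rewrite (Kout c m m' w).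
    rewrite (Hin d m' h3 h4) => Ev'.
    case: (val_cases h2) => [[Em Ec]|[m0 [k1 k2 k3 k4]]];
      case: (val_cases h4) => [[Em' Ed]|[m0' [k1' k2' k3' k4']]].
    + by rewrite Em Em' (Hyu c d w) // -?Ec -?Ed.
    + have [_ _ /(_ m0')] := Hy c w h1 (etrans (esym Ec) Ev).
      by rewrite -k4' Ev'.
    + have [_ _ /(_ m0)] := Hy d w h3 (etrans (esym Ed) Ev').
      by rewrite -k4 Ev.
    + by rewrite -k2 -k2' (s_inj (w := w) (etrans (esym k4) Ev) (etrans (esym k4') Ev')).
  case: (Hcase m') => [[d h3 h4]|[-> _]]; last exact: (proj2 N_asn).
  rewrite (Hin d m' h3 h4) => E Ev'.
  by move: (Ho d h3); rewrite (Kout d m' m w).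
- move=> m Hm; case: (Hcase m) => [[c h1 h2]|[-> Ho] E].
    rewrite (Hin c m h1 h2); case: (val_cases h2) => [[Em Ec]|[m0 [_ _ k3 ->]]].
      rewrite Ec; case/and4P: (Hc c h1) => _ _ _; case: c.2 => //.
      by rewrite -Em Hm.
    by have [w [-> _]] := nxt_neq k3.
  have : m \in served I s cs by rewrite Hsv mem_filter Hm E mem_enum.
  by case/mapP=> c h1 Em; move: (Ho c h1); rewrite Em endw_mem.
move=> w Hw; have [m Em] := N_cover Hw.
case: (Hcase m) => [[c h1 h2]|[E _]]; last by exists m; rewrite E.
have Es : sf m = Some w by rewrite -(okcand_untouched (Hc c h1) h2).
by have [h3 h4] := val_next (Hc c h1) h2 Es; exists (nxt m); rewrite (Hin c).
Qed.

Lemma feasP (q : asg M W) : reflect (fea (get q)) (feas I q).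
Proof.
apply: (iffP and4P) => [[/allP h1 /allP h2 /allP h3 /allP h4]|[[h1 h2] h3 h4]].
  split; first split.
  - by move=> m w E; have := h1 m; rewrite mem_enum E; apply.
  - move=> m m' w E E'; have := h2 m'; rewrite mem_enum E' => /(_ isT)/allP/(_ m).
    by rewrite mem_enum E /= eqxx orbF => /(_ isT)/eqP.
  - by move=> m Hm; have := h3 m; rewrite mem_enum Hm /= => /(_ isT); case: (get q m).
  - move=> w Hw; have := h4 w; rewrite mem_enum Hw /= => /(_ isT) H; apply: NNPP => Hno.
    by case/negP: H; apply/freeP => m E; apply: Hno; exists m.
split; apply/allP => z _.
- by case E: (get q z) => [w|] //; apply: h1.
- case E: (get q z) => [w|] //; apply/allP => o _; apply/orP.
  by case: (iswP (get q o) w) => [E'|]; [left; apply/eqP/(h2 _ _ w)|right].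
- by case: (boolP (z \in mstar I)) => //= Hz; case E: (get q z) => //; case: (h3 z Hz).
- case: (boolP (z \in wstar I)) => //= Hz; have [m Em] := h4 z Hz.
  by apply/negP => /freeP/(_ m).
Qed.

Lemma fill_nice (n : nat) : size rw <= n -> exists G,
  [/\ size G = n, all (gok n) G, feas I (fill I s N G) & nblk I (fill I s N G) <= nb I p].
Proof.
move=> Hrw; have HE a : a \in enum nde -> nentry p a by rewrite mem_enum => /ndeP.
have Hsz : size (enum nde) <= n.
  rewrite -(size_map endw); apply: leq_trans Hrw; apply: uniq_leq_size.
    rewrite map_inj_in_uniq ?enum_uniq // => a b /HE Ha /HE Hb; exact: nentry_end_inj.
  by move=> m /mapP[a /HE Ha ->]; apply/rowsP; exists a.
have [|||||G [g1 g2 g3 [g4 [g5 _ g7]]]] := row_guess Hrw (S := enum nde) (Y := [::]) (leqnn _) => //.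
- exact: enum_uniq.
- have K a : nentry p a -> a \in enum nde by move=> Ha; rewrite mem_enum; apply/ndeP.
  by move=> a b /edgeP[y [m [Ha Hb _ _ _]]]; rewrite !K.
(* Padding: with all marks 0 a cluster serving nobody is asked for. There is none, as closures are
   nonempty, and [best_cluster] returns its default, the empty list. *)
pose g0 := (nseq n 0, nseq n 0).
have Epad (u : nat) : rowcands I s N rw (G ++ nseq u g0) = rowcands I s N rw G.
  rewrite /rowcands map_cat flatten_cat -[RHS]cats0; congr cat.
  elim: u => //= u ->; rewrite cats0.
  have -> : marked rw (nseq n 0) = [::].
    by rewrite /marked; elim: (n) (rw) => [|i IH] [|m r] //=; rewrite IH.
  rewrite /best_cluster; case E: (clusters _ _ _ _ _ _) => [|cs l] //.
  have : cs \in clusters I s N rw [::] (forbid I s N rw [::] (nseq n 0)) by rewrite E mem_head.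
  rewrite mem_filter => /andP[/and5P[_ _ _ /allP H _] _]; exfalso.
  have : cs \in [seq close I s N h | h <- heads I].
    have : cs \in clusters I s N rw [::] (forbid I s N rw [::] (nseq n 0)) by rewrite E mem_head.
    by rewrite mem_filter => /andP[].
  case/mapP=> h _ Ecs.
  have : cs != [::].
    rewrite Ecs /close; elim/last_ind: (enum M) => // e m IH.
    by rewrite -cats1 foldl_cat /=; case: (ohead _).
  by case: (cs) H => //= c cs' /(_ (endw c.1)); rewrite mem_head => /(_ isT).
exists (G ++ nseq (n - size G) g0).
have Hgn : size G <= n by apply: leq_trans Hsz.
rewrite /fill Epad; split.
- by rewrite size_cat size_nseq subnKC.
- rewrite all_cat g2; apply/allP => g /nseqP[-> _]; apply/and4P; split; rewrite ?size_nseq //.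
    by apply/allP => j /nseqP[->].
  by apply/allP => j /nseqP[->].
- apply/feasP/filled_fea => // m; rewrite g4; apply/mapP/rowsP => -[a].
    by move=> /HE Ha ->; exists a.
  by move=> Ha ->; exists a => //; rewrite mem_enum; apply/ndeP.
by rewrite nblkE -pcs_all.
Qed.

End Clusters.

(** * Existence of a small guess at least as good as any feasible assignment *)

Lemma argmin (T : Type) (P : T -> Prop) (h : T -> nat) : (exists u, P u) ->
  exists u, P u /\ forall v, P v -> h u <= h v.
Proof.
move=> [u0 H0]; have [n] := ubnP (h u0); elim: n u0 H0 => // n IHn u0 H0 Hn.
case: (classic (exists2 v, P v & h v < h u0)) => [[v Hy Hlt]|Hno].
  by apply: (IHn v Hy); apply: leq_trans Hlt _.
by exists u0; split=> // v Hy; rewrite leqNgt; apply/negP => Hlt; apply: Hno; exists v.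
Qed.

Lemma nice_ex : (exists p, fea p) -> exists p, nice p.
Proof.
move=> Hex; have [p0 [H0 Hmin]] := @argmin _ fea (nb I) Hex.
have [|p [[h1 h2] Hp]] := @argmin _ (fun p => fea p /\ nb I p <= nb I p0) wt; first by exists p0.
exists p; split=> // p' Hf'; split; first by apply: leq_trans h2 (Hmin _ Hf').
by move=> Hle; apply: Hp; split=> //; apply: leq_trans Hle h2.
Qed.

Definition small (k : nat) (g : guess) : bool :=
  [&& size g.1 == k, size g.2 == k,
      all (fun e => [&& e.1 < gbound k, e.2.1 < gbound k & e.2.2 < gbound k]) g.1
    & all (fun e => [&& size e.1 == k, size e.2 == k,
         all (fun j => j < gbound k) e.1 & all (fun j => j < gbound k) e.2]) g.2].

Lemma guess_ex p : fea p -> exists g,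
  [/\ small (param I s) g, feas I (gen I s g) & nblk I (gen I s g) <= nb I p].
Proof.
move=> Hf; have [p1 Hn] := nice_ex (ex_intro _ p Hf).
have Hle : nb I p1 <= nb I p by case: Hn => _ /(_ p Hf)[].
have [G [G1 G2 G3]] := rebuild Hn.
(* The men left to be served are ends of paths in the minimal solution, hence unmatched in [s] and
   counted by the parameter. *)
have Hrw : size (rows I (tokasg I s (tokens I s G))) <= param I s.
  apply: leq_trans (leq_addl _ _); apply: uniq_leq_size.
    by rewrite filter_uniq ?enum_uniq.
  move=> m Hm; have := Hm; rewrite !mem_filter => /andP[/andP[h1 h2] h3].
  rewrite h1 h3 andbT /=; have [a Ha Em] := rowsP Hn G3 m Hm.
  have [l Hl] := entry_end (proj1 Ha); have [_ Es] := row_end Hn Ha Hl.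
  by have [_ Ee _] := nentry_walk Hn Ha Hl; rewrite Em Ee Es.
have [H [H1 H2 H3 H4]] := fill_nice Hn G3 Hrw.
set k := param I s in Hrw H1 H2 *.
have Hk : size (toks I s) <= k by apply: leq_addr.
(* The token guesses are padded to length [k]; [zip] ignores the surplus. *)
have Eg : gen I s (G ++ nseq (k - size G) (0, (0, 0)), H) = fill I s (tokasg I s (tokens I s G)) H.
  rewrite /gen /= /tokens; congr (fill I s (tokasg I s (flatten (map _ _))) H).
  rewrite -[in LHS](cats0 (toks I s)) zip_cat //; case: (nseq _ _) => [|? ?]; exact: cats0.
exists (G ++ nseq (k - size G) (0, (0, 0)), H); rewrite Eg; split=> //; last exact: leq_trans H4 Hle.
have Hb : gbound (size (toks I s)) <= gbound k.
  by rewrite /gbound !ltnS leq_mul2r leq_mul // !ltnS.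
apply/and4P; split=> /=.
- by rewrite size_cat size_nseq subnKC // G1.
- by rewrite H1.
- rewrite all_cat; apply/andP; split; last by apply/allP => e /nseqP[->].
  by apply/allP => e /G2[h1 h2 h3]; rewrite !(leq_trans _ Hb).
- apply/allP => e /(allP H2)/and4P[h1 h2 /allP h3 /allP h4].
  have Hk2 : k.+2 <= gbound k by rewrite /gbound; nia.
  by apply/and4P; split=> //; apply/allP => j; [move/h3|move/h4] => Hj; apply: leq_trans Hk2.
Qed.
End Stable.

(** * Deferred acceptance and stable matchings *)

Section Deferred.
Variables (M W : finType) (I : smc M W).
Hypothesis D2 : DeltaW I <= 2.
Implicit Types (m o : M) (w : W) (p : M -> option W) (R : asg M W) (X : {set M * W}).

Notation acc := (acceptable I).
Notation rk := (rank I).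
Notation oth := (other I).
Notation wlt := (above I).
Notation blk := (blocks I).
Notation prop := (proposal I).
Notation rej := (refused I).

Definition inR R m w := has (fun e => (e.1 == m) && isw e.2 w) R.

Lemma inRP R m w : reflect ((m, Some w) \in R) (inR R m w).
Proof.
apply: (iffP hasP) => [[[m' x] H /= /andP[/eqP <- /iswP <-]] //|H].
by exists (m, Some w); rewrite //= !eqxx.
Qed.

Lemma prop_some R m w : prop R m = Some w -> acc m w /\ ~~ inR R m w.
Proof.
rewrite /proposal /acceptable; set l := filter _ _ => E.
have : w \in l by case: l E => //= z l [<-]; rewrite mem_head.
by rewrite mem_filter => /andP[/andP[-> ->] ->].
Qed.

Lemma filter_head (T : eqType) (P : pred T) (l : seq T) (u : T) : u \in l -> P u ->
  (if ohead (filter P l) is Some v then index v l else size l) <= index u l.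
Proof.
elim: l => //= v l IHl; rewrite inE eq_sym; case Pv: (P v) => /=; first by rewrite eqxx.
have [<-|ne /= Hu Pu] := eqVneq v u; first by rewrite Pv.
have := IHl Hu Pu; case E: (ohead _) => [z|]; rewrite ?ltnS //.
have [Ez|_] := eqVneq v z; rewrite ?ltnS //.
Qed.

Lemma prop_first R m w : acc m w -> rk m (Some w) < rk m (prop R m) -> inR R m w.
Proof.
case/andP=> h1 h2 H; apply/negPn/negP => Hno.
have := filter_head (P := fun w => (m \in wpref I w) && ~~ inR R m w) h1; rewrite h2 Hno => /(_ isT).
by rewrite leqNgt => /negP; apply; move: H; rewrite /rank /proposal; case: ohead.
Qed.

Lemma prop_eq R R' m : (forall w, inR R m w = inR R' m w) -> prop R m = prop R' m.
Proof. by move=> H; congr ohead; apply: eq_filter => w; rewrite -!/(inR _ _ _) H. Qed.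

Lemma rejP R m : reflect (exists w o, [/\ prop R m = Some w, oth w m = Some o,
  prop R o = Some w & wlt w o m]) (rej R m).
Proof.
rewrite /refused; apply: (iffP idP) => [|[w [o [-> -> -> ->]]]]; last by rewrite /= eqxx.
case E: (prop R m) => [w|] //; case E': (oth w m) => [o|] // /andP[/iswP h1 h2].
by exists w, o.
Qed.

Lemma gsstepR R m w : inR (gsstep I R) m w = inR R m w || rej R m && (prop R m == Some w).
Proof.
rewrite /inR has_cat; congr (_ || _); apply/idP/idP.
  by case/inRP/mapP=> m'; rewrite mem_filter => /andP[Hr _] [-> ->]; rewrite Hr eqxx.
case/andP=> Hr /eqP E; apply/inRP/mapP; exists m; rewrite ?E //.
by rewrite mem_filter Hr mem_enum.
Qed.

(** The loop invariant of deferred acceptance: a woman who rejected someone always has a proposer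
    she ranks higher. For the final list it rules out blocking pairs. *)
Definition just R := forall m w, inR R m w -> acc m w /\
  exists o, [/\ oth w m = Some o, prop R o = Some w & wlt w o m].

(** The proposer who justifies a rejection keeps proposing to [w], since his only rival for her
    ranks below him. *)
Lemma just_step R : just R -> just (gsstep I R).
Proof.
move=> HR m w.
have K o : oth w m = Some o -> prop R o = Some w -> wlt w o m -> acc m w ->
    prop (gsstep I R) o = Some w.
  move=> Eo Ep Hw Ha; rewrite -Ep; apply/esym/prop_eq => w'; rewrite gsstepR.
  case: (rejP R o) => [[w1 [o1]]|_]; last by rewrite orbF.
  rewrite Ep => -[[<-]]; rewrite (oth_sym D2 Ha Eo) => -[<-] _ Hw'.
  by case: (wlt_asym Hw Hw').
rewrite gsstepR => /orP[Hr|/andP[/rejP[w' [o [E1 E2 E3 E4]]]]].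
  by have [Ha [o [h1 h2 h3]]] := HR m w Hr; split=> //; exists o; split=> //; apply: K.
rewrite E1 => /eqP[E]; subst w'; have [Ha _] := prop_some E1; split=> //.
by exists o; split=> //; apply: K.
Qed.

Definition rejected R : {set M * W} := [set z | inR R z.1 z.2].

Lemma grow R m : rej R m -> #|rejected R| < #|rejected (gsstep I R)|.
Proof.
move=> Hr; apply: proper_card; apply/properP; split.
  by apply/subsetP => z; rewrite !inE gsstepR => ->.
have /rejP[w [o [E _ _ _]]] := Hr; have [_ Hno] := prop_some E.
by exists (m, w); rewrite inE //= gsstepR Hr E eqxx orbT.
Qed.

Lemma step_fix R : (forall m, ~~ rej R m) -> gsstep I R = R.
Proof.
move=> H; rewrite /gsstep (_ : [seq m <- enum M | rej R m] = [::]) ?cats0 //.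
by elim: (enum M) => //= m l ->; rewrite (negbTE (H m)).
Qed.

Lemma gsR_spec : just (gsR I) /\ forall m, ~~ rej (gsR I) m.
Proof.
have H (l : seq unit) : let R := foldl (fun R _ => gsstep I R) [::] l in
    just R /\ ((forall m, ~~ rej R m) \/ size l <= #|rejected R|).
  elim/last_ind: l => [|l u [IH1 IH2]]; first by split=> [m w|]; [case/inRP|right].
  rewrite -cats1 foldl_cat /=; split; first exact: just_step.
  case: (boolP [forall m, ~~ rej (foldl (fun R _ => gsstep I R) [::] l) m]) => [/forallP Hf|].
    by left; rewrite step_fix.
  rewrite negb_forall => /existsP[m /negPn Hm]; right.
  case: IH2 => [/(_ m)|IH2]; first by rewrite Hm.
  by rewrite size_cat addn1; apply: leq_ltn_trans IH2 (grow Hm).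
have [h1 [h2|h2]] := H (clock M W); split=> //.
have := leq_trans h2 (max_card _); rewrite card_prod /clock /= size_flatten /shape -map_comp.
rewrite (_ : sumn _ = #|M| * #|W|) ?ltnn // cardE.
by elim: (enum M) => //= m l ->; rewrite size_map -cardE mulSn.
Qed.

Lemma get_base m : get (base I) m = prop (gsR I) m.
Proof.
apply: (get_agree (p := prop (gsR I))); first by move=> e /mapP[m' _ ->].
by rewrite -map_comp map_id mem_enum.
Qed.

Lemma base_asn : asn I (get (base I)).
Proof.
split=> [m w|m m' w]; rewrite !get_base; first by case/prop_some.
move=> E E'; apply: NNPP => ne; have [_ H] := gsR_spec.
have [Ha _] := prop_some E; have [Ha' _] := prop_some E'.
have Eo := oth_uniq D2 Ha Ha' ne.
case: (boolP (wlt w m' m)) => Hw.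
  by move/negP: (H m); apply; apply/rejP; exists w, m'.
move/negP: (H m'); apply; apply/rejP; exists w, m; split=> //; first exact: oth_sym Eo.
by apply: (wltN Ha' Ha) => // /esym.
Qed.

Lemma base_stable m w : ~~ blk (get (base I)) m w.
Proof.
apply/negP => /blkP[Ha]; rewrite get_base => /(prop_first Ha) Hr H.
have [HJ _] := gsR_spec; have [_ [o [h1 h2 h3]]] := HJ m w Hr.
by move: (H o h1); rewrite get_base h3 => /(_ h2).
Qed.

(** * Rural hospitals theorem *)

Section Rural.
Variables p p' : M -> option W.
Hypothesis Hp : asn I p.
Hypotheses (Sp : forall m w, ~~ blk p m w) (Sp' : forall m w, ~~ blk p' m w).

(* The map sending [m] to the man who holds [p m] under [p'] permutes the men who
   prefer [p] to [p']. *)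
Lemma pull m : rk m (p m) < rk m (p' m) ->
  [/\ p' m <> None, exists m0, p m0 = p' m & exists o, p' o = p m].
Proof.
pose A := [set m | rk m (p m) < rk m (p' m)].
pose f m := if p m is Some w then odflt m (oth w m) else m.
have Hf m0 : m0 \in A -> [/\ f m0 \in A, p' (f m0) = p m0 & p m0 <> None].
  rewrite inE => Hlt; case E: (p m0) Hlt => [w|] Hlt; last first.
    by move: Hlt; rewrite ltnNge; case: (p' m0) => [w|]; rewrite /= ?index_size ?leqnn.
  have Ha := proj1 Hp _ _ E; have [o [h1 h2 h3]] := blkNP Ha Hlt (Sp' m0 w).
  rewrite /f E h1 /= inE h2; split=> //.
  have [Hao no] := oth_acc h1.
  rewrite ltnNge leq_eqVlt; apply/negP => /orP[/eqP E'|Hlt'].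
    have E2 : Some w = p o.
      by apply: (rk_inj _ _ E') => v; [case=> <-|apply: (proj1 Hp)].
    by apply: no; apply: (proj2 Hp _ _ w).
  move/negP: (Sp o w); apply; apply/blkP; split=> // o'.
  by rewrite (oth_sym D2 Ha h1) => -[<-] _; apply/negP => /(wlt_asym h3).
have Himg : f @: A = A.
  apply/eqP; rewrite eqEcard; apply/andP; split.
    by apply/subsetP => z /imsetP[u /Hf[h _ _] ->].
  rewrite card_in_imset // => u v /Hf[_ h1 h2] /Hf[_ h3 _] E.
  case Eu: (p u) h2 => [w|] // _; apply: (proj2 Hp _ _ w) => //.
  by rewrite -h3 -E h1.
move=> Hm; have HmA : m \in A by rewrite inE.
have := HmA; rewrite -{1}Himg => /imsetP[m0 Hm0 Em]; have [_ h1 h2] := Hf _ Hm0.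
have [_ h3 _] := Hf _ HmA.
by split; [rewrite Em h1|exists m0; rewrite Em|exists (f m)].
Qed.

End Rural.

Lemma rural p p' : asn I p -> asn I p' ->
  (forall m w, ~~ blk p m w) -> (forall m w, ~~ blk p' m w) ->
  forall m w, p m = Some w -> p' m <> None /\ exists m', p' m' = Some w.
Proof.
move=> Hp Hp' Sp Sp' m w E; case: (ltngtP (rk m (p m)) (rk m (p' m))) => H.
- by have [h1 _ [o h2]] := pull Hp Sp Sp' H; split=> //; exists o; rewrite h2.
- have [h1 [m0 h2] _] := pull Hp' Sp' Sp H; split; last by exists m0; rewrite h2.
  move=> En; move: H; rewrite En E /= ltnNge.
  by have /andP[Hw _] := proj1 Hp _ _ E; rewrite index_size.
have E' : p m = p' m by apply: (rk_inj _ _ H) => v; [apply: (proj1 Hp)|apply: (proj1 Hp')].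
by rewrite -E' E; split=> //; exists m; rewrite -E'.
Qed.

(** * Matchings as sets of pairs and as functions on men *)

Section Sets.
Variable X : {set M * W}.
Hypothesis HX : matching I X.

Lemma mpartnerP m w : reflect (mpartner X m = Some w) ((m, w) \in X).
Proof.
have /andP[_ /forall_inP H2] := HX; rewrite /mpartner; apply: (iffP idP) => [h|].
  case: pickP => [w' h'|/(_ w)]; last by rewrite h.
  have /forall_inP/(_ _ h) := H2 _ h'; rewrite /= eqxx; case: eqP => [[->]|] //.
by case: pickP => // w' h [<-].
Qed.

Lemma wpartnerP m w : reflect (wpartner X w = Some m) ((m, w) \in X).
Proof.
have /andP[_ /forall_inP H2] := HX; rewrite /wpartner; apply: (iffP idP) => [h|].
  case: pickP => [m' h'|/(_ m)]; last by rewrite h.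
  have /forall_inP/(_ _ h) := H2 _ h'; rewrite /= eqxx andbF; case: eqP => [[->]|] //.
by case: pickP => // m' h [<-].
Qed.

Lemma mpartner_asn : asn I (mpartner X).
Proof.
have /andP[/forall_inP H1 _] := HX.
split=> [m w /mpartnerP/H1 //|m m' w /mpartnerP/wpartnerP E /mpartnerP/wpartnerP].
by rewrite E => -[].
Qed.

Lemma blockingE m w : blocking I X m w = blk (mpartner X) m w.
Proof.
rewrite /blocking /blocks; case Ha: (acc m w) => //=; have [HA1 HA2] := mpartner_asn.
have -> : (if mpartner X m is Some w' then prefers (mpref I m) w w' else true) =
    (rk m (Some w) < rk m (mpartner X m)).
  have /andP[h1 h2] := Ha; case E: (mpartner X m) => [w'|] /=; last by rewrite index_mem h1.
  by rewrite /prefers h1; have /andP[-> _] := HA1 _ _ E.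
case H: (_ < _) => //=; case E: (wpartner X w) => [o|].
  have Eo : mpartner X o = Some w by apply/mpartnerP/wpartnerP.
  have ne : m <> o by move=> E'; move: H; rewrite E' Eo ltnn.
  have Hao := HA1 _ _ Eo; rewrite (oth_uniq D2 Ha Hao ne) Eo /= eqxx /=.
  have /andP[_ h1] := Ha; have /andP[_ h2] := Hao.
  rewrite /prefers h1 h2 /=; apply/idP/idP => [h|].
    by apply/negP => h'; case: (wlt_asym h h').
  exact: wltN Hao Ha (fun e => ne (esym e)).
case Eo: (oth w m) => [o|] //; case: iswP => //= /mpartnerP/wpartnerP.
by rewrite E.
Qed.

Lemma card_blocking : #|blocking_pairs I X| = nb I (mpartner X).
Proof. by apply: eq_card => z; rewrite !inE blockingE. Qed.

Lemma feasible_fea : feasible I X -> fea I (mpartner X).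
Proof.
case/and3P=> _ /forall_inP h1 /forall_inP h2; split; first exact: mpartner_asn.
  by move=> m /h1/eqP.
move=> w /h2; case E: (wpartner X w) => [m|] // _.
by exists m; apply/mpartnerP/wpartnerP.
Qed.

Lemma param_stable : stable I X -> param I (base I) = #|wstar0 I X| + #|mstar0 I X|.
Proof.
case/andP=> _ /eqP HB.
have SX m w : ~~ blk (mpartner X) m w.
  rewrite -blockingE; apply/negP => H.
  have : (m, w) \in blocking_pairs I X by rewrite inE.
  by rewrite HB inE.
have R1 := rural base_asn mpartner_asn base_stable SX.
have R2 := rural mpartner_asn base_asn SX base_stable.
rewrite /param; congr (_ + _).
  have /card_uniqP <- : uniq (toks I (base I)) by rewrite filter_uniq ?enum_uniq.
  apply: eq_card => w; rewrite inE mem_filter mem_enum andbT; congr (_ && _).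
  apply/freeP/eqP => H.
    case E: (wpartner X w) => [m|] //.
    have Em : mpartner X m = Some w by apply/mpartnerP/wpartnerP.
    by have [_ [m' E']] := R2 _ _ Em; case: (H m').
  move=> m E; have [_ [m' /mpartnerP/wpartnerP]] := R1 _ _ E.
  by rewrite H.
have /card_uniqP <- : uniq (rows I (base I)) by rewrite filter_uniq ?enum_uniq.
apply: eq_card => m; rewrite inE mem_filter mem_enum andbT; congr (_ && _).
case E: (get (base I) m) => [w|]; first by apply/esym/eqP; case: (R1 _ _ E).
apply/esym/eqP; case E': (mpartner X m) => [w|] //.
by case: (R2 _ _ E').
Qed.

End Sets.

Section Pairs.
Variable q : asg M W.
Hypothesis Hq : asn I (get q).

Lemma mem_pairs m w : ((m, w) \in pairs q) = (get q m == Some w).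
Proof.
apply/flattenP/eqP => [[l /mapP[m' _ ->]]|E].
  by case E: (get q m') => [w'|] //; rewrite inE => /eqP[-> ->].
by exists [:: (m, w)]; rewrite ?mem_head //; apply/mapP; exists m; rewrite ?mem_enum ?E.
Qed.

Lemma pairs_uniq : uniq (pairs q).
Proof.
rewrite /pairs; elim: (enum M) (enum_uniq M) => //= m l IHl /andP[Hm Hu].
case: (get q m) => [w|] /=; last exact: IHl.
rewrite IHl // andbT; apply/flattenP => -[l' /mapP[m' Hm' ->]].
by case: (get q m') => [w'|] //; rewrite inE => /eqP[E _]; rewrite E Hm' in Hm.
Qed.

Lemma pairs_matching : matching I [set z in pairs q].
Proof.
apply/andP; split; apply/forall_inP => -[m w]; rewrite inE mem_pairs => /eqP E.
  exact: (proj1 Hq).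
apply/forall_inP => -[m' w']; rewrite inE mem_pairs => /eqP E' /=.
apply/implyP => ne; apply/andP; split; apply: contraNneq ne => E2.
  by move: E'; rewrite -E2 E => -[->].
by rewrite E2 in E *; rewrite (proj2 Hq _ _ _ E E').
Qed.

Lemma pairs_mpartner m : mpartner [set z in pairs q] m = get q m.
Proof.
case E: (get q m) => [w|]; first by apply/(mpartnerP pairs_matching); rewrite inE mem_pairs E.
rewrite /mpartner; case: pickP => // w; by rewrite inE mem_pairs E.
Qed.

End Pairs.

Lemma pairs_feasible q : fea I (get q) -> feasible I [set z in pairs q].
Proof.
case=> Hq h1 h2; have HX := pairs_matching Hq; apply/and3P; split=> //; apply/forall_inP.
  by move=> m /h1 H; rewrite pairs_mpartner //; apply/eqP.
move=> w /h2[m E]; rewrite -(pairs_mpartner Hq) in E; move/(mpartnerP HX)/(wpartnerP HX): E.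
by move->.
Qed.

End Deferred.

(** * The algorithm runs in polynomial time *)

Section Use.
Context {A B1 B2 B3 B4 B5 B6 C : Type} {EA : Enc A} {E1 : Enc B1} {E2 : Enc B2} {E3 : Enc B3}
  {E4 : Enc B4} {E5 : Enc B5} {E6 : Enc B6} {EC : Enc C}.

Lemma PT_use2 t c t1 c1 t2 c2 (f : B1 -> B2 -> C) (e1 : A -> B1) (e2 : A -> B2) :
  PT t c (fun x : B1 * B2 => f x.1 x.2) -> PT t1 c1 e1 -> PT t2 c2 e2 ->
  PT (Cmp t (Pr t1 t2)) (ccomp (c1 + c2 + 7) c) (fun a => f (e1 a) (e2 a)).
Proof. by move=> H H1 H2; apply: (PT_comp (PT_pair H1 H2) H). Qed.

Lemma PT_use3 t c t1 c1 t2 c2 t3 c3 (f : B1 -> B2 -> B3 -> C) (e1 : A -> B1) (e2 : A -> B2)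
    (e3 : A -> B3) :
  PT t c (fun x : B1 * (B2 * B3) => f x.1 x.2.1 x.2.2) ->
  PT t1 c1 e1 -> PT t2 c2 e2 -> PT t3 c3 e3 ->
  PT (Cmp t (Pr t1 (Pr t2 t3))) (ccomp (c1 + (c2 + c3 + 7) + 7) c)
    (fun a => f (e1 a) (e2 a) (e3 a)).
Proof. by move=> H H1 H2 H3; apply: (PT_comp (PT_pair H1 (PT_pair H2 H3)) H). Qed.

Lemma PT_use4 t c t1 c1 t2 c2 t3 c3 t4 c4 (f : B1 -> B2 -> B3 -> B4 -> C) (e1 : A -> B1)
    (e2 : A -> B2) (e3 : A -> B3) (e4 : A -> B4) :
  PT t c (fun x : B1 * (B2 * (B3 * B4)) => f x.1 x.2.1 x.2.2.1 x.2.2.2) ->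
  PT t1 c1 e1 -> PT t2 c2 e2 -> PT t3 c3 e3 -> PT t4 c4 e4 ->
  PT (Cmp t (Pr t1 (Pr t2 (Pr t3 t4))))
    (ccomp (c1 + (c2 + (c3 + c4 + 7) + 7) + 7) c)
    (fun a => f (e1 a) (e2 a) (e3 a) (e4 a)).
Proof.
by move=> H H1 H2 H3 H4; apply: (PT_comp (PT_pair H1 (PT_pair H2 (PT_pair H3 H4))) H).
Qed.

Lemma PT_use5 t c t1 c1 t2 c2 t3 c3 t4 c4 t5 c5 (f : B1 -> B2 -> B3 -> B4 -> B5 -> C)
    (e1 : A -> B1) (e2 : A -> B2) (e3 : A -> B3) (e4 : A -> B4) (e5 : A -> B5) :
  PT t c (fun x : B1 * (B2 * (B3 * (B4 * B5))) => f x.1 x.2.1 x.2.2.1 x.2.2.2.1 x.2.2.2.2) ->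
  PT t1 c1 e1 -> PT t2 c2 e2 -> PT t3 c3 e3 -> PT t4 c4 e4 -> PT t5 c5 e5 ->
  PT (Cmp t (Pr t1 (Pr t2 (Pr t3 (Pr t4 t5)))))
    (ccomp (c1 + (c2 + (c3 + (c4 + c5 + 7) + 7) + 7) + 7) c)
    (fun a => f (e1 a) (e2 a) (e3 a) (e4 a) (e5 a)).
Proof.
move=> H H1 H2 H3 H4 H5.
exact: (PT_comp (PT_pair H1 (PT_pair H2 (PT_pair H3 (PT_pair H4 H5)))) H).
Qed.

Lemma PT_use6 t c t1 c1 t2 c2 t3 c3 t4 c4 t5 c5 t6 c6 (f : B1 -> B2 -> B3 -> B4 -> B5 -> B6 -> C)
    (e1 : A -> B1) (e2 : A -> B2) (e3 : A -> B3) (e4 : A -> B4) (e5 : A -> B5) (e6 : A -> B6) :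
  PT t c (fun x : B1 * (B2 * (B3 * (B4 * (B5 * B6)))) =>
    f x.1 x.2.1 x.2.2.1 x.2.2.2.1 x.2.2.2.2.1 x.2.2.2.2.2) ->
  PT t1 c1 e1 -> PT t2 c2 e2 -> PT t3 c3 e3 -> PT t4 c4 e4 -> PT t5 c5 e5 -> PT t6 c6 e6 ->
  PT (Cmp t (Pr t1 (Pr t2 (Pr t3 (Pr t4 (Pr t5 t6))))))
    (ccomp (c1 + (c2 + (c3 + (c4 + (c5 + c6 + 7) + 7) + 7) + 7) + 7) c)
    (fun a => f (e1 a) (e2 a) (e3 a) (e4 a) (e5 a) (e6 a)).
Proof.
move=> H H1 H2 H3 H4 H5 H6.
exact: (PT_comp (PT_pair H1 (PT_pair H2 (PT_pair H3 (PT_pair H4 (PT_pair H5 H6))))) H).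
Qed.

Lemma PT_enc (B : Type) (EB : Enc B) t c (f : A -> B) (g : A -> C) :
  (forall x, enc (f x) = enc (g x)) -> PT t c f -> PT t c g.
Proof. by move=> E H x; have [h1 h2 h3] := H x; rewrite /sz -E. Qed.

End Use.

Lemma PT_addn_sig : SIG2 (fun tf cf tg cg t c => forall A (EA : Enc A) (f g : A -> nat),
  PT tf cf f -> PT tg cg g -> PT t c (fun x => f x + g x)).
Proof.
pt_start.
apply: (@PT_ext _ _ _ _ _ _ (fun x => size (nseq (f x) tt ++ nseq (g x) tt))).
  by move=> x; rewrite size_cat !size_nseq.
by pt.
Qed.

Lemma sz_nat (n : nat) : sz n = n.*2.+2.
Proof. by elim: n => // n IHn; rewrite doubleS -IHn. Qed.

Lemma sz_fin (T : finType) (u : T) : sz u = (enum_rank u).*2.+2.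
Proof. exact: sz_nat. Qed.

Lemma sz_all A (EA : Enc A) (s : seq A) n : (forall i, i < size s -> forall u, ohead (drop i s) = Some u -> sz u <= n) ->
  sz s <= size s * n + 2.
Proof.
elim: s => // u s IHs H; rewrite sz_cons mulSn -addnA; apply: leq_add.
  exact: (H 0 isT).
by apply: IHs => i Hi v Hv; apply: (H i.+1).
Qed.

Lemma sz_map A B (EB : Enc B) (f : A -> B) (l : seq A) n : (forall u, sz (f u) <= n) ->
  sz (map f l) <= size l * n + 2.
Proof. by move=> H; elim: l => // u l IHl; rewrite sz_cons mulSn -addnA; apply: leq_add. Qed.

Lemma sz_size A (EA : Enc A) (s : seq A) : 2 * size s + 2 <= sz s.
Proof.
by elim: s => // u s IHs; rewrite sz_cons mulnS -addnA; apply: leq_add => //; exact: sz_ge2.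
Qed.

Lemma PT_iota_sig : SIG1 (fun tf cf t c => forall A (EA : Enc A) (f : A -> nat),
  PT tf cf f -> PT t c (fun x => iota 0 (f x))).
Proof.
pt_start.
pose F (b : seq nat) (_ : unit) := size b :: b.
have K l : foldl F [::] l = rev (iota 0 (size l)).
  elim/last_ind: l => // l u IHl; rewrite -cats1 foldl_cat IHl /= /F size_rev size_iota.
  by rewrite size_cat iotaD add0n rev_cat.
apply: (@PT_ext _ _ _ _ _ _ (fun x => rev (foldl F [::] (nseq (f x) tt)))).
  by move=> x; rewrite K revK size_nseq.
eapply (proj2_sig PT_rev_sig).
eapply (PT_foldl (F := fun x => F) (d := cf + cf + 8)); try by rewrite /F; pt.
move=> x n; rewrite K; have [_ _ S] := H x.
have Hs : 2 <= sz x by exact: sz_ge2.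
set k := size _; have Hk : k <= f x by rewrite /k size_take size_nseq; case: ltnP => // /ltnW.
have : sz (rev (iota 0 k)) <= size (rev (iota 0 k)) * (sz (f x)) + 2.
  apply: sz_all => i Hi u; case E: (drop i _) => [|v l] //= -[<-]; rewrite !sz_nat !ltnS leq_double.
  have : v \in rev (iota 0 k) by apply: (mem_drop (n0 := i)); rewrite E mem_head.
  by rewrite mem_rev mem_iota => /andP[_ /ltnW Hv]; apply: leq_trans Hk.
move=> H1; apply: leq_trans H1 _; rewrite size_rev size_iota.
have H2 : k <= sz x ^ cf by apply: leq_trans Hk _; apply: leq_trans S; rewrite sz_nat; lia.
have := addX Hs (mulX H2 S) (kX 2 Hs); by move/(leX Hs _); apply; lia.
Qed.

Ltac pt_inst := fail.
Ltac pt_user5 :=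
  lazymatch goal with
  | |- PT _ _ (fun x => rev _) => eapply (proj2_sig PT_rev_sig)
  | |- PT _ _ (fun x => map _ _) => eapply (proj2_sig PT_map_sig)
  | |- PT _ _ (fun x => filter _ _) => eapply (proj2_sig PT_filter_sig)
  | |- PT _ _ (fun x => has _ _) => eapply (proj2_sig PT_has_sig)
  | |- PT _ _ (fun x => all _ _) => eapply (proj2_sig PT_all_sig)
  | |- PT _ _ (fun x => cat _ _) => eapply (proj2_sig PT_cat_sig)
  | |- PT _ _ (fun x => negb _) => eapply (proj2_sig PT_neg_sig)
  | |- PT _ _ (fun x => andb _ _) => eapply (proj2_sig PT_and_sig)
  | |- PT _ _ (fun x => orb _ _) => eapply (proj2_sig PT_or_sig)
  | |- PT _ _ (fun x => flatten _) => eapply (proj2_sig PT_flatten_sig)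
  | |- PT _ _ (fun x => last _ _) => eapply (proj2_sig PT_last_sig)
  | |- PT _ _ (fun x => nseq _ tt) => eapply (proj2_sig PT_units_sig)
  | |- PT _ _ (fun x => S _) => eapply PT_succ
  | |- PT _ _ (fun x => size _) => eapply (proj2_sig PT_size_sig)
  | |- PT _ _ (fun x => behead _) => eapply (proj2_sig PT_behead_sig)
  | |- PT _ _ (fun x => predn _) => eapply (proj2_sig PT_pred_sig)
  | |- PT _ _ (fun x => subn _ _) => eapply (proj2_sig PT_subn_sig)
  | |- PT _ _ (fun x => addn _ _) => eapply (proj2_sig PT_addn_sig)
  | |- PT _ _ (fun x => nilp _) => eapply (proj2_sig PT_nil_eq_sig)
  | |- PT _ _ (fun x => leq _ _) => eapply (proj2_sig PT_leq_sig)
  | |- PT _ _ (fun x => @eq_op nat _ _) => eapply (proj2_sig PT_eqn_sig)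
  | |- PT _ _ (fun x => @eq_op _ _ _) =>
      first [eapply (proj2_sig PT_eqfin_sig) | eapply (proj2_sig PT_eqn_sig)]
  | |- PT _ _ (fun x => ohead _) => eapply (proj2_sig PT_ohead_sig)
  | |- PT _ _ (fun x => drop _ _) => eapply (proj2_sig PT_drop_sig)
  | |- PT _ _ (fun x => take _ _) => eapply (proj2_sig PT_take_sig)
  | |- PT _ _ (fun x => find _ _) => eapply (proj2_sig PT_find_sig)
  | |- PT _ _ (fun x => zip _ _) => eapply (proj2_sig PT_zip_sig)
  | |- PT _ _ (fun x => iota 0 _) => eapply (proj2_sig PT_iota_sig)
  | |- PT _ _ (fun x => nat_of_ord _) => eapply (proj1 (PT_rank _ _ _ _))
  | _ => pt_inst
  end.
Ltac pt_user ::= pt_user5.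

(** * Reading the encoded instance *)

Definition rawM M W (I : smc M W) : seq (bool * seq W) :=
  [seq (m \in mstar I, mpref I m) | m <- enum M].
Definition rawW M W (I : smc M W) : seq (bool * seq M) :=
  [seq (w \in wstar I, wpref I w) | w <- enum W].

Lemma code_seq_map T T' (c : T' -> tree) (f : T -> T') (l : seq T) :
  code_seq (fun u => c (f u)) l = code_seq c (map f l).
Proof. by elim: l => //= u l <-. Qed.

Lemma enc_I M W (I : smc M W) : enc I = Node (enc (rawM I)) (enc (rawW I)).
Proof. by congr Node; rewrite /enc /enc_seq /rawM /rawW -code_seq_map. Qed.

Lemma PT_rawM : SIG (fun t c => forall M W, PT t c (@rawM M W)).
Proof.
eexists (pair _ _) => M W /=.
have H : PT (Cmp Fst Id) (1 + 10) (fun x : smc M W => (rawM x, rawW x).1).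
  apply: (PT_fst (e := fun x => (rawM x, rawW x))).
  by apply: (PT_enc (f := fun x : smc M W => x)) => [x|]; [exact: enc_I|exact: PT_id].
exact: H.
Qed.

Lemma PT_rawW : SIG (fun t c => forall M W, PT t c (@rawW M W)).
Proof.
eexists (pair _ _) => M W /=.
have H : PT (Cmp Snd Id) (1 + 10) (fun x : smc M W => (rawM x, rawW x).2).
  apply: (PT_snd (e := fun x => (rawM x, rawW x))).
  by apply: (PT_enc (f := fun x : smc M W => x)) => [x|]; [exact: enc_I|exact: PT_id].
exact: H.
Qed.

(** Names are ranks in [enum], and the instance is listed in this order, so a lookup is a [drop]. *)
Lemma raw_get (T : finType) B (f : T -> B) (u : T) :
  ohead (drop (enum_rank u) [seq f v | v <- enum T]) = Some (f u).
Proof.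
rewrite -map_drop (drop_nth u) -?cardE ?ltn_ord //=.
by rewrite -[in RHS](enum_rankK u) (enum_val_nth u).
Qed.

Lemma sz_M M W (I : smc M W) (m : M) : sz m <= sz I.
Proof.
apply: (@leq_trans (sz (rawM I))).
  apply: leq_trans (sz_size _ _); rewrite size_map -cardE sz_fin -muln2.
  by case: (enum_rank m) => i /=; move: #|M| => j; lia.
by rewrite [X in _ <= X]/sz enc_I /sz /= ltnS; lia.
Qed.

Lemma sz_W M W (I : smc M W) (w : W) : sz w <= sz I.
Proof.
apply: (@leq_trans (sz (rawW I))).
  apply: leq_trans (sz_size _ _); rewrite size_map -cardE sz_fin -muln2.
  by case: (enum_rank w) => i /=; move: #|W| => j; lia.
by rewrite [X in _ <= X]/sz enc_I /sz /= ltnS; lia.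
Qed.

Lemma rank_enum (T : finType) : [seq enum_rank u : nat | u <- enum T] = iota 0 #|T|.
Proof.
apply: (@eq_from_nth _ 0) => [|i]; rewrite size_map -cardE ?size_iota // => Hi.
have u0 : T by case: (pickP T) => [u _ //|E]; rewrite eq_card0 // in Hi.
rewrite nth_iota // (nth_map u0) -?cardE //.
by have := enum_valK (Ordinal Hi); rewrite (enum_val_nth u0) /= => ->.
Qed.

(** Only the number of persons is needed to produce the list of all of them. *)
Lemma enc_enum (T : finType) : enc (iota 0 #|T|) = enc (enum T).
Proof. by rewrite -rank_enum /enc /enc_seq -code_seq_map. Qed.

Lemma PT_enumM : SIG (fun t c => forall M W, PT t c (fun _ : smc M W => enum M)).
Proof.
pt_start; apply: (@PT_enc _ _ _ _ _ _ _ _ (fun I => iota 0 (size (rawM I)))); last first.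
  by eapply (proj2_sig PT_iota_sig); eapply (proj2_sig PT_size_sig); exact: (proj2_sig PT_rawM _ _).
by move=> I; rewrite size_map -cardE enc_enum.
Qed.

Lemma PT_enumW : SIG (fun t c => forall M W, PT t c (fun _ : smc M W => enum W)).
Proof.
pt_start; apply: (@PT_enc _ _ _ _ _ _ _ _ (fun I => iota 0 (size (rawW I)))); last first.
  by eapply (proj2_sig PT_iota_sig); eapply (proj2_sig PT_size_sig); exact: (proj2_sig PT_rawW _ _).
by move=> I; rewrite size_map -cardE enc_enum.
Qed.

Lemma PT_mpref : SIG (fun t c => forall M W, PT t c (fun x : smc M W * M => mpref x.1 x.2)).
Proof.
pt_start; apply: (@PT_ext _ _ _ _ _ _ (fun x =>
    if ohead (drop (enum_rank x.2) (rawM x.1)) is Some e then e.2 else [::])).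
  by move=> x; rewrite raw_get.
pt.
by eapply (PT_comp (g := @rawM M W)); [|exact: (proj2_sig PT_rawM)]; pt.
Qed.

Lemma PT_wpref : SIG (fun t c => forall M W, PT t c (fun x : smc M W * W => wpref x.1 x.2)).
Proof.
pt_start; apply: (@PT_ext _ _ _ _ _ _ (fun x =>
    if ohead (drop (enum_rank x.2) (rawW x.1)) is Some e then e.2 else [::])).
  by move=> x; rewrite raw_get.
pt.
by eapply (PT_comp (g := @rawW M W)); [|exact: (proj2_sig PT_rawW)]; pt.
Qed.

Lemma PT_mstar : SIG (fun t c => forall M W,
  PT t c (fun x : smc M W * M => x.2 \in mstar x.1)).
Proof.
pt_start; apply: (@PT_ext _ _ _ _ _ _ (fun x =>
    if ohead (drop (enum_rank x.2) (rawM x.1)) is Some e then e.1 else false)).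
  by move=> x; rewrite raw_get.
pt.
by eapply (PT_comp (g := @rawM M W)); [|exact: (proj2_sig PT_rawM)]; pt.
Qed.

Lemma PT_wstar : SIG (fun t c => forall M W,
  PT t c (fun x : smc M W * W => x.2 \in wstar x.1)).
Proof.
pt_start; apply: (@PT_ext _ _ _ _ _ _ (fun x =>
    if ohead (drop (enum_rank x.2) (rawW x.1)) is Some e then e.1 else false)).
  by move=> x; rewrite raw_get.
pt.
by eapply (PT_comp (g := @rawW M W)); [|exact: (proj2_sig PT_rawW)]; pt.
Qed.

Lemma PT_uniq_sig : SIG1 (fun tf cf t c => forall (T : finType) A (EA : Enc A)
    (f : A -> seq T), PT tf cf f -> PT t c (fun x => uniq (f x))).
Proof.
pt_start; pose F (b : bool * seq T) (u : T) := (b.1 && (u \notin b.2), u :: b.2).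
apply: (@PT_ext _ _ _ _ _ _ (fun x => (foldl F (true, [::]) (f x)).1)).
  move=> x; have K l b z : (foldl F (b, z) l).1 = [&& b, uniq l & ~~ has (fun u => u \in z) l].
    elim: l b z => [|u l IHl] b z /=; first by rewrite andbT.
    rewrite IHl (eq_has (fun v => in_cons _ _ _)) has_predU.
    by rewrite has_pred1 !negb_or -!andbA; case: b (u \in z) (u \in l) (uniq l) => [] [] [] [].
  by rewrite K /= (eq_has (a2 := pred0)) // has_pred0 andbT.
pt1; eapply (PT_foldl_add (F := fun _ => F) (d := 1)); try by pt.
  by rewrite /F /=; pt; eapply (proj2_sig PT_memfin_sig); pt.
move=> x [b z] u; rewrite /F /= !sz_pair sz_cons expn1.
have : 2 <= sz x by exact: sz_ge2.
have : 2 <= sz u by exact: sz_ge2.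
have : sz (b && (u \notin z)) <= sz b by case: b (u \notin z) => [] [].
by move: (sz x) (sz u) (sz z) (sz b) (sz _) => i1 i2 i3 i4 i5; nia.
Qed.

Lemma PT_index_sig : SIG2 (fun tf cf tg cg t c => forall (T : finType) A (EA : Enc A)
    (f : A -> T) (g : A -> seq T), PT tf cf f -> PT tg cg g -> PT t c (fun x => index (f x) (g x))).
Proof.
pt_start; apply: (@PT_ext _ _ _ _ _ _ (fun x => find (fun y => y == f x) (g x))) => //.
by pt; eapply (PT_comp (f := fun p => p.1) (g := f)); pt.
Qed.

(* The instance is always the leftmost component of the argument. *)
Ltac find_I :=
  lazymatch goal with
  | |- @PT (smc _ _) _ _ _ _ _ _ => exact: PT_id
  | |- @PT (prod ?B ?C) _ _ _ _ _ _ => eapply (PT_comp (f := @fst B C));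
      [eapply (PT_fst (e := fun x => x)); exact: PT_id|find_I]
  end.
Ltac pt_alg := fail.
Ltac pt_inst ::=
  lazymatch goal with
  | |- PT _ _ (fun x => uniq _) => eapply (proj2_sig PT_uniq_sig)
  | |- PT _ _ (fun x => @enum_mem ?M _) => first
      [ eapply (PT_comp (g := fun I : smc M _ => enum M)); [find_I|exact: (proj2_sig PT_enumM _ _)]
      | eapply (PT_comp (g := fun I : smc _ M => enum M)); [find_I|exact: (proj2_sig PT_enumW _ _)] ]
  | |- PT _ _ (fun x => index _ _) => eapply (proj2_sig PT_index_sig)
  | |- PT _ _ (fun x => mpref _ _) => eapply (PT_use2 (f := fun I m => mpref I m) (proj2_sig PT_mpref _ _))
  | |- PT _ _ (fun x => wpref _ _) => eapply (PT_use2 (f := fun I w => wpref I w) (proj2_sig PT_wpref _ _))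
  | |- PT _ _ (fun x => in_mem _ _) => first
      [ eapply (proj2_sig PT_memfin_sig)
      | eapply (PT_use2 (f := fun I m => m \in mstar I) (proj2_sig PT_mstar _ _))
      | eapply (PT_use2 (f := fun I w => w \in wstar I) (proj2_sig PT_wstar _ _)) ]
  | _ => pt_alg
  end.

Lemma PT_oth : SIG (fun t c => forall M W,
  PT t c (fun x : smc M W * (W * M) => other x.1 x.2.1 x.2.2)).
Proof. by pt_start; rewrite /other; pt. Qed.

Lemma PT_get : SIG (fun t c => forall M W : finType,
  PT t c (fun x : asg M W * M => get x.1 x.2)).
Proof. by pt_start; rewrite /get; pt. Qed.

Ltac pt_alg1 :=
  lazymatch goal with
  | |- PT _ _ (fun x => other _ _ _) =>
      eapply (PT_use3 (f := fun I w m => other I w m) (proj2_sig PT_oth _ _))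
  | |- PT _ _ (fun x => get _ _) =>
      eapply (PT_use2 (f := fun q m => get q m) (proj2_sig PT_get _ _))
  end.
Ltac pt_alg ::= pt_alg1.

Lemma PT_blk : SIG (fun t c => forall M W,
  PT t c (fun x : smc M W * (asg M W * (M * W)) => blocks x.1 (get x.2.1) x.2.2.1 x.2.2.2)).
Proof. by pt_start; rewrite /blocks /rank /above /isw /acceptable; pt. Qed.

Lemma PT_free : SIG (fun t c => forall M W,
  PT t c (fun x : smc M W * (asg M W * W) => free x.2.1 x.2.2)).
Proof. by pt_start; rewrite /free /isw; pt. Qed.

Lemma PT_prop : SIG (fun t c => forall M W,
  PT t c (fun x : smc M W * (asg M W * M) => proposal x.1 x.2.1 x.2.2)).
Proof. by pt_start; rewrite /proposal /isw; pt. Qed.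

Ltac pt_alg2 :=
  lazymatch goal with
  | |- PT _ _ (fun x => blocks _ (get _) _ _) =>
      eapply (PT_use4 (f := fun I q m w => blocks I (get q) m w) (proj2_sig PT_blk _ _))
  | |- PT _ _ (fun x => @free ?M ?W _ _) =>
      eapply (PT_use3 (f := fun (I : smc M W) q w => free q w) (proj2_sig PT_free _ _)); [find_I|..]
  | |- PT _ _ (fun x => proposal _ _ _) =>
      eapply (PT_use3 (f := fun I R m => proposal I R m) (proj2_sig PT_prop _ _))
  | _ => pt_alg1
  end.
Ltac pt_alg ::= pt_alg2.

Lemma sz_optM M W (I : smc M W) (x : option W) : sz x <= (sz I).+2.
Proof. by case: x => [w|] //; have := sz_W I w; rewrite /sz /=; lia. Qed.

Lemma size_enumM M W (I : smc M W) : size (enum M) <= sz I.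
Proof.
have <- : size (rawM I) = size (enum M) by rewrite size_map.
have H : sz (rawM I) <= sz I by rewrite [X in _ <= X]/sz enc_I /sz /= ltnS; lia.
by apply: leq_trans H; apply: leq_trans (sz_size _ _); move: (size _) => i; lia.
Qed.

(** A round adds at most one rejection per man, an amount bounded in the instance whatever [R] is,
    as [PT_foldl_add] requires. *)
Lemma PT_gsR : SIG (fun t c => forall M W, PT t c (@gsR M W)).
Proof.
pt_start; rewrite /gsR /clock.
eapply (PT_foldl_add (F := fun I R _ => gsstep I R) (d := 4)); try by pt.
  by rewrite /gsstep /refused /isw /above; pt.
move=> I R e; apply: leq_trans (sz_cat _ _ _) _; rewrite leq_add2l.
have H1 : forall m, sz (m, proposal I R m) <= sz I + (sz I).+2.
  by move=> m; rewrite sz_pair; apply: leq_add; [exact: sz_M|exact: sz_optM].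
set l := [seq m <- enum M | refused I R m].
have H3 : sz [seq (m, proposal I R m) | m <- l] <= size l * (sz I + (sz I).+2) + 2 by exact: sz_map.
apply: leq_trans H3 _; rewrite expnMn.
have H2 : size l <= sz I.
  by apply: leq_trans (size_enumM I); rewrite size_filter count_size.
have : 2 <= sz I by exact: sz_ge2.
move: (sz I) (size l) H2 => i j H2 Hi; apply: (@leq_trans (i ^ 4)); last by rewrite leq_pmulr.
rewrite -[4]/(2 + 2) expnD -!mulnn; have H4 : 4 <= i * i by nia.
apply: (@leq_trans (4 * (i * i))); last by rewrite leq_mul2r H4 orbT.
by apply: (@leq_trans (i * (i + i.+2) + 2)); [rewrite leq_add2r leq_mul2r H2 orbT|nia].
Qed.

Lemma PT_base : SIG (fun t c => forall M W, PT t c (@base M W)).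
Proof.
pt_start; rewrite /base; pt.
by eapply (PT_comp (g := @gsR M W)); [pt|exact: (proj2_sig PT_gsR _ _)].
Qed.

Lemma PT_nxt : SIG (fun t c => forall M W,
  PT t c (fun x : smc M W * (asg M W * M) => nextm x.1 x.2.1 x.2.2)).
Proof. by pt_start; rewrite /nextm; pt. Qed.

Ltac pt_alg3 :=
  lazymatch goal with
  | |- PT _ _ (fun x => nextm _ _ _) =>
      eapply (PT_use3 (f := fun I s m => nextm I s m) (proj2_sig PT_nxt _ _))
  | _ => pt_alg2
  end.
Ltac pt_alg ::= pt_alg3.

Lemma add_bound i u v n : n <= i -> 2 <= u -> 2 <= v -> n + 2 <= (i + u) * v.
Proof. by nia. Qed.

Lemma PT_walk : SIG (fun t c => forall M W,
  PT t c (fun x : smc M W * (asg M W * M) => walk x.1 x.2.1 x.2.2)).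
Proof.
pt_start; rewrite /walk.
eapply (PT_foldl_add (F := fun (x : smc M W * (asg M W * M)) l _ =>
  if nextm x.1 x.2.1 (last x.2.2 l) \in l then l else l ++ [:: nextm x.1 x.2.1 (last x.2.2 l)]) (d := 1));
  try by pt.
move=> x b e; case: ifP => _; first by rewrite leq_addr.
apply: leq_trans (sz_cat _ _ _) _; rewrite leq_add2l sz_cons expn1.
case: x b => I [s a] b; rewrite sz_pair; apply: (@add_bound (sz I)); [exact: sz_M|exact: sz_ge2..].
Qed.

Ltac pt_alg4 :=
  lazymatch goal with
  | |- PT _ _ (fun x => walk _ _ _) =>
      eapply (PT_use3 (f := fun I s m => walk I s m) (proj2_sig PT_walk _ _))
  | _ => pt_alg3
  end.
Ltac pt_alg ::= pt_alg4.

Lemma PT_pathto : SIG (fun t c => forall M W,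
  PT t c (fun x : smc M W * (asg M W * (seq M * (M * nat))) =>
    pathto x.1 x.2.1 x.2.2.1 x.2.2.2.1 x.2.2.2.2)).
Proof.
by pt_start; rewrite /pathto /options /specials /walk_end /unwanted /drops /rank; pt.
Qed.

Ltac pt_alg5 :=
  lazymatch goal with
  | |- PT _ _ (fun x => pathto _ _ _ _ _) => 
      eapply (PT_use5 (f := fun I s A a i => pathto I s A a i) (proj2_sig PT_pathto _ _))
  | _ => pt_alg4
  end.
Ltac pt_alg ::= pt_alg5.

Lemma PT_tokens : SIG (fun t c => forall M W,
  PT t c (fun x : smc M W * (asg M W * seq (nat * (nat * nat))) => tokens x.1 x.2.1 x.2.2)).
Proof. by pt_start; rewrite /tokens /toks /start; pt. Qed.

Lemma PT_tokasg : SIG (fun t c => forall M W,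
  PT t c (fun x : smc M W * (asg M W * seq (W * (M * (nat * nat)))) =>
    tokasg x.1 x.2.1 x.2.2)).
Proof. by pt_start; rewrite /tokasg /rotate /shift /walk_end; pt. Qed.

Lemma PT_rows : SIG (fun t c => forall M W,
  PT t c (fun x : smc M W * asg M W => rows x.1 x.2)).
Proof. by pt_start; rewrite /rows; pt. Qed.

Lemma PT_addc : SIG (fun t c => forall M W,
  PT t c (fun x : smc M W * (asg M W * (asg M W * cand M W)) =>
    addc x.1 x.2.1 x.2.2.1 x.2.2.2)).
Proof. by pt_start; rewrite /addc /shift; pt. Qed.

Lemma PT_addcs : SIG (fun t c => forall M W,
  PT t c (fun x : smc M W * (asg M W * (asg M W * seq (cand M W))) =>
    addcs x.1 x.2.1 x.2.2.1 x.2.2.2)).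
Proof.
have [[t0 c0] /= H0] : SIG (fun t c => forall M W,
    PT t c (fun x : smc M W * asg M W * cand M W => shift x.1.2 x.2.2 (walk x.1.1 x.1.2 x.2.1))).
  by pt_start; rewrite /shift; pt.
pt_start; rewrite /addcs.
eapply (PT_foldl_add (F := fun (x : smc M W * (asg M W * (asg M W * seq (cand M W)))) q c =>
  addc x.1 x.2.1 q c) (d := c0)); try by pt.
  by eapply (PT_use4 (f := fun I s q c => addc I s q c) (proj2_sig PT_addc _ _)); pt.
move=> [I [s [q0 l]]] q c /=; rewrite /addc; apply: leq_trans (sz_cat _ _ _) _.
rewrite addnC leq_add2l; have [_ _ /= S] := H0 M W (I, s, c).
apply: leq_trans S _; case: (c0) => // k; rewrite leq_exp2r //.
rewrite !sz_pair; have : 2 <= sz c by exact: sz_ge2.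
have : 2 <= sz q0 by exact: sz_ge2.
have : 2 <= sz I by exact: sz_ge2.
by move: (sz I) (sz s) (sz q0) (sz l) (sz c) => i1 i2 i3 i4 i5; nia.
Qed.

Ltac pt_alg6 :=
  lazymatch goal with
  | |- PT _ _ (fun x => tokens _ _ _) =>
      eapply (PT_use3 (f := fun I s G => tokens I s G) (proj2_sig PT_tokens _ _))
  | |- PT _ _ (fun x => tokasg _ _ _) =>
      eapply (PT_use3 (f := fun I s D => tokasg I s D) (proj2_sig PT_tokasg _ _))
  | |- PT _ _ (fun x => rows _ _) =>
      eapply (PT_use2 (f := fun I N => rows I N) (proj2_sig PT_rows _ _))
  | |- PT _ _ (fun x => addcs _ _ _ _) =>
      eapply (PT_use4 (f := fun I s q cs => addcs I s q cs) (proj2_sig PT_addcs _ _))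
  | _ => pt_alg5
  end.
Ltac pt_alg ::= pt_alg6.

Lemma PT_wants : SIG (fun t c => forall M W,
  PT t c (fun x : smc M W * (asg M W * (asg M W * seq (cand M W))) =>
    wants x.1 x.2.1 x.2.2.1 x.2.2.2)).
Proof. by pt_start; rewrite /wants /want /above /rank /acceptable; pt. Qed.

Lemma sz_cand M W (I : smc M W) (c : cand M W) : sz c <= sz I + (sz I).+2.
Proof. by case: c => m x; rewrite sz_pair; apply: leq_add; [exact: sz_M|exact: sz_optM]. Qed.

Lemma PT_close : SIG (fun t c => forall M W,
  PT t c (fun x : smc M W * (asg M W * (asg M W * cand M W)) =>
    close x.1 x.2.1 x.2.2.1 x.2.2.2)).
Proof.
pt_start; rewrite /close.
eapply (PT_foldl_add (F := fun (x : smc M W * (asg M W * (asg M W * cand M W))) cs _ =>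
  if ohead (wants x.1 x.2.1 (addcs x.1 x.2.1 x.2.2.1 cs) cs) is Some c' then c' :: cs else cs)
  (d := 1)); try by pt.
  by pt; eapply (PT_use4 (f := fun I s q cs => wants I s q cs) (proj2_sig PT_wants _ _)); pt.
move=> [I [s [N c]]] cs m /=; case: (ohead _) => [c'|]; last by rewrite leq_addr.
rewrite sz_cons addnC leq_add2l; apply: leq_trans (sz_cand I c') _.
rewrite !sz_pair; have : 2 <= sz c by exact: sz_ge2.
have : 2 <= sz m by exact: sz_ge2.
have : 2 <= sz I by exact: sz_ge2.
by move: (sz I) (sz s) (sz N) (sz c) (sz m) => i1 i2 i3 i4 i5; rewrite expn1; nia.
Qed.

Lemma PT_nblk : SIG (fun t c => forall M W,
  PT t c (fun x : smc M W * asg M W => nblk x.1 x.2)).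
Proof. by pt_start; rewrite /nblk; pt. Qed.

Ltac pt_alg7 :=
  lazymatch goal with
  | |- PT _ _ (fun x => close _ _ _ _) =>
      eapply (PT_use4 (f := fun I s N c => close I s N c) (proj2_sig PT_close _ _))
  | |- PT _ _ (fun x => nblk _ _) =>
      eapply (PT_use2 (f := fun I q => nblk I q) (proj2_sig PT_nblk _ _))
  | _ => pt_alg6
  end.
Ltac pt_alg ::= pt_alg7.

Lemma PT_okclus : SIG (fun t c => forall M W,
  PT t c (fun x : smc M W * (asg M W * (asg M W * (seq M * (seq M * seq W)))) * seq (cand M W) =>
    okclus x.1.1 x.1.2.1 x.1.2.2.1 x.1.2.2.2.1 x.1.2.2.2.2.1 x.1.2.2.2.2.2 x.2)).
Proof.
by pt_start; rewrite /okclus /okcand /served /newm /eqw /isw /acceptable /walk_end; pt.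
Qed.

Lemma PT_clusters : SIG (fun t c => forall M W,
  PT t c (fun x : smc M W * (asg M W * (asg M W * (seq M * (seq M * seq W)))) =>
    clusters x.1 x.2.1 x.2.2.1 x.2.2.2.1 x.2.2.2.2.1 x.2.2.2.2.2)).
Proof.
pt_start; rewrite /clusters /heads; pt.
exact: (proj2_sig PT_okclus _ _).
Qed.

Lemma PT_best : SIG (fun t c => forall M W,
  PT t c (fun x : smc M W * (asg M W * (asg M W * (seq M * (seq M * seq W)))) =>
    best_cluster x.1 x.2.1 x.2.2.1 x.2.2.2.1 x.2.2.2.2.1 x.2.2.2.2.2)).
Proof.
pt_start; rewrite /best_cluster; pt.
eapply (PT_foldl_add (F := fun (x : smc M W * (asg M W * (asg M W * (seq M * (seq M * seq W))))) o cs =>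
  better x.1 x.2.1 x.2.2.1 o cs) (d := 1)); try by pt.
- by rewrite /better; pt.
- exact: (proj2_sig PT_clusters _ _).
move=> x o cs; have H : sz (Some cs) <= (sz x * sz cs) ^ 1.
  have -> : sz (Some cs) = sz cs + 2 by rewrite /sz /= add1n addn2.
  have : 2 <= sz x by exact: sz_ge2.
  have : 2 <= sz cs by exact: sz_ge2.
  by rewrite expn1; move: (sz x) (sz cs) => i j; nia.
rewrite /better; case: o => [b|]; last by apply: leq_trans H (leq_addl _ _).
by case: ifP => _; [exact: leq_addr|apply: leq_trans H (leq_addl _ _)].
Qed.

Ltac pt_alg8 :=
  lazymatch goal with
  | |- PT _ _ (fun x => best_cluster _ _ _ _ _ _) => eapply
      (PT_use6 (f := fun I s N rw R F => best_cluster I s N rw R F) (proj2_sig PT_best _ _))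
  | _ => pt_alg7
  end.
Ltac pt_alg ::= pt_alg8.

Lemma PT_forbid : SIG (fun t c => forall M W,
  PT t c (fun x : smc M W * (asg M W * (asg M W * (seq M * (seq M * seq nat)))) =>
    forbid x.1 x.2.1 x.2.2.1 x.2.2.2.1 x.2.2.2.2.1 x.2.2.2.2.2)).
Proof.
pt_start; rewrite /forbid.
eapply (PT_foldl_add (F := fun (x : smc M W * (asg M W * (asg M W * (seq M * (seq M * seq nat))))) F j =>
  if ohead (drop j (newm (best_cluster x.1 x.2.1 x.2.2.1 x.2.2.2.1 x.2.2.2.2.1 F))) is Some y
  then y :: F else F) (d := 1)); try by pt.
  by rewrite /newm; pt.
move=> [I x] F j /=; case: (ohead _) => [y|]; last by rewrite leq_addr.
rewrite sz_cons addnC leq_add2l; apply: leq_trans (sz_W I y) _.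
rewrite expn1 sz_pair; have : 2 <= sz j by exact: sz_ge2.
by move: (sz I) (sz x) (sz j) => i1 i2 i3; nia.
Qed.

Ltac pt_alg9 :=
  lazymatch goal with
  | |- PT _ _ (fun x => forbid _ _ _ _ _ _) => eapply
      (PT_use6 (f := fun I s N rw R js => forbid I s N rw R js) (proj2_sig PT_forbid _ _))
  | _ => pt_alg8
  end.
Ltac pt_alg ::= pt_alg9.

Lemma PT_gen : SIG (fun t c => forall M W,
  PT t c (fun x : smc M W * (asg M W * guess) => gen x.1 x.2.1 x.2.2)).
Proof. by pt_start; rewrite /gen /fill /rowcands /marked; pt. Qed.

Lemma PT_feas : SIG (fun t c => forall M W,
  PT t c (fun x : smc M W * asg M W => feas x.1 x.2)).
Proof. by pt_start; rewrite /feas /isw /acceptable; pt. Qed.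

Ltac pt_alg10 :=
  lazymatch goal with
  | |- PT _ _ (fun x => gen _ _ _) =>
      eapply (PT_use3 (f := fun I s g => gen I s g) (proj2_sig PT_gen _ _))
  | |- PT _ _ (fun x => feas _ _) =>
      eapply (PT_use2 (f := fun I q => feas I q) (proj2_sig PT_feas _ _))
  | _ => pt_alg9
  end.
Ltac pt_alg ::= pt_alg10.

(** Polynomial in the instance and the list of guesses together; this lets the final bound split
    into a factor in [k] and one in the instance. *)
Lemma PT_search : SIG (fun t c => forall M W,
  PT t c (fun x : smc M W * (asg M W * seq guess) => search x.1 x.2.1 x.2.2)).
Proof.
have [[t0 c0] /= H0] := PT_gen.
pt_start; rewrite /search.
eapply (PT_foldl_add (F := fun (x : smc M W * (asg M W * seq guess)) o g =>
  keep x.1 o (gen x.1 x.2.1 g)) (d := c0 + 2)); try by pt.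
  by rewrite /keep; pt.
move=> [I [s gs]] o g /=; set q := gen _ _ _.
have H : sz (Some q) <= (sz (I, (s, gs)) * sz g) ^ (c0 + 2).
  have -> : sz (Some q) = sz q + 2 by rewrite /sz /= add1n addn2.
  have [_ _ /= S] := H0 M W (I, (s, g)).
  have Hx : sz (I, (s, g)) <= sz (I, (s, gs)) * sz g.
    rewrite !sz_pair; have : 2 <= sz gs by exact: sz_ge2.
    have : 2 <= sz g by exact: sz_ge2.
    have : 2 <= sz s by exact: sz_ge2.
    by move: (sz I) (sz s) (sz gs) (sz g) => i1 i2 i3 i4; nia.
  have H2 : 2 <= sz (I, (s, g)) by exact: sz_ge2.
  apply: (@leq_trans (sz (I, (s, g)) ^ (c0 + 2))); last by rewrite addn2 leq_exp2r.
  rewrite expnD; apply: leq_trans (leq_add S (leqnn 2)) _; move: (sz _) H2 => i Hi.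
  have : 0 < i ^ c0 by rewrite expn_gt0 (leq_trans _ Hi).
  rewrite -mulnn; have H4 : 4 <= i * i by nia.
  move: (i ^ c0) => j Hj; apply: (@leq_trans (j * 4)); first by lia.
  by rewrite leq_mul2l H4 orbT.
rewrite /keep; case: ifP => _; last exact: leq_addr.
case: o => [b|]; last by apply: leq_trans H (leq_addl _ _).
by case: ifP => _; [exact: leq_addr|apply: leq_trans H (leq_addl _ _)].
Qed.

Lemma PT_param : SIG (fun t c => forall M W,
  PT t c (fun x : smc M W * asg M W => param x.1 x.2)).
Proof. by pt_start; rewrite /param /toks; pt. Qed.

Lemma PT_result : SIG (fun t c => forall M W,
  PT t c (fun x : smc M W * option (asg M W) => result x.2)).
Proof. by pt_start; rewrite /result /pairs; pt. Qed.

(** * Enumerating the guesses *)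

Definition lists T (B : seq T) (k : nat) : seq (seq T) :=
  foldl (fun acc _ => flatten [seq [seq u :: l | l <- acc] | u <- B]) [:: [::]] (nseq k tt).

Lemma mem_lists (T : eqType) (B l : seq T) k : size l = k -> all (fun u => u \in B) l ->
  l \in lists B k.
Proof.
move=> <-; elim: l {k} => // u l IHl /= /andP[Hu Hl].
rewrite /lists -addn1 nseqD foldl_cat /= -/(lists B (size l)).
apply/flattenP; exists [seq u :: l' | l' <- lists B (size l)]; first by apply/mapP; exists u.
by apply/mapP; exists l => //; apply: IHl.
Qed.

Definition prod2 A B (s : seq A) (t : seq B) : seq (A * B) :=
  flatten [seq [seq (u, v) | v <- t] | u <- s].

Lemma mem_prod2 (A B : eqType) (s : seq A) (t : seq B) u v :
  u \in s -> v \in t -> (u, v) \in prod2 s t.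
Proof.
move=> Hu Hv; apply/flattenP; exists [seq (u, v) | v <- t]; first by apply/mapP; exists u.
by apply/mapP; exists v.
Qed.

Definition guesses (k : nat) : seq guess :=
  let b := iota 0 (gbound k) in
  prod2 (lists (prod2 b (prod2 b b)) k) (lists (prod2 (lists b k) (lists b k)) k).

Lemma mem_guesses k g : small k g -> g \in guesses k.
Proof.
case: g => G H /and4P[/= /eqP h1 /eqP h2 /allP h3 /allP h4].
have Hb (j : nat) : j < gbound k -> j \in iota 0 (gbound k) by rewrite mem_iota.
apply: mem_prod2; apply: mem_lists => //; apply/allP.
  move=> [i [j f]] /h3 /and3P[/Hb Hi /Hb Hj /Hb Hf].
  by do 2!apply: mem_prod2 => //.
move=> [u v] /h4 /and4P[/= /eqP k1 /eqP k2 /allP k3 /allP k4].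
by apply: mem_prod2; apply: mem_lists => //; apply/allP => j; [move/k3|move/k4] => /Hb.
Qed.

(* The guesses are too many for [PT]; only the value of their enumeration
   matters, since its cost depends on the parameter alone. *)
Definition CT A B {EA : Enc A} {EB : Enc B} (t : fn) (f : A -> B) :=
  forall x, sem t (enc x) = enc (f x).

Lemma CT_PT A B (EA : Enc A) (EB : Enc B) t c (f : A -> B) : PT t c f -> CT t f.
Proof. by move=> H x; case: (H x). Qed.

Lemma CT_comp A B C (EA : Enc A) (EB : Enc B) (EC : Enc C) t1 t2 (f : A -> B) (g : B -> C) :
  CT t1 f -> CT t2 g -> CT (Cmp t2 t1) (fun x => g (f x)).
Proof. by move=> Hf Hg x; rewrite /= Hf Hg. Qed.

Lemma CT_pair A B C (EA : Enc A) (EB : Enc B) (EC : Enc C) t1 t2 (f : A -> B) (g : A -> C) :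
  CT t1 f -> CT t2 g -> CT (Pr t1 t2) (fun x => (f x, g x)).
Proof. by move=> Hf Hg x; rewrite /= Hf Hg. Qed.

Lemma CT_foldl A B E (EA : Enc A) (EB : Enc B) (EE : Enc E) tF ti tl
    (F : A -> B -> E -> B) (i : A -> B) (l : A -> seq E) :
  CT tF (fun p : A * (B * E) => F p.1 p.2.1 p.2.2) -> CT ti i -> CT tl l ->
  CT (Cmp (Fold tF) (Pr Id (Pr ti tl))) (fun x => foldl (F x) (i x) (l x)).
Proof.
move=> HF Hi Hl x.
rewrite -[LHS]/(sloop tF (enc x) (sem ti (enc x)) (sem tl (enc x))) Hi Hl.
elim: (l x) (i x) => //= e s IHs b; rewrite -IHs -(HF (x, (b, e))).
by [].
Qed.

Lemma CT_lists : {t | forall T (ET : Enc T), CT t (fun x : seq T * nat => lists x.1 x.2)}.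
Proof.
eexists => T ET; rewrite /lists; eapply (@CT_foldl _ _ _ _ _ _ _ _ _ (fun (x : seq T * nat) acc (_ : unit) =>
  flatten [seq [seq u :: l | l <- acc] | u <- x.1])).
- by eapply CT_PT; pt.
- by eapply CT_PT; pt.
by eapply CT_PT; pt.
Qed.

Lemma PT_prod2_sig : SIG2 (fun tf cf tg cg t c => forall A B C (EA : Enc A) (EB : Enc B)
    (EC : Enc C) (f : A -> seq B) (g : A -> seq C),
  PT tf cf f -> PT tg cg g -> PT t c (fun x => prod2 (f x) (g x))).
Proof.
pt_start; rewrite /prod2; pt.
by eapply (PT_comp (f := fun p => p.1) (g := g)); pt.
Qed.

Lemma PT_muln_sig : SIG2 (fun tf cf tg cg t c => forall A (EA : Enc A) (f g : A -> nat),
  PT tf cf f -> PT tg cg g -> PT t c (fun x => f x * g x)).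
Proof.
pt_start; apply: (@PT_ext _ _ _ _ _ _ (fun x => size (prod2 (nseq (f x) tt) (nseq (g x) tt)))).
  move=> x; rewrite /prod2 size_flatten /shape -map_comp.
  by elim: (f x) => //= n ->; rewrite size_map size_nseq mulSn.
by pt; eapply (proj2_sig PT_prod2_sig); pt.
Qed.

Ltac pt_alg11 :=
  lazymatch goal with
  | |- PT _ _ (fun x => prod2 _ _) => eapply (proj2_sig PT_prod2_sig)
  | |- PT _ _ (fun x => muln _ _) => eapply (proj2_sig PT_muln_sig)
  | |- PT _ _ S => eapply (PT_succ (f := fun k => k))
  | |- PT _ _ (fun x => 3) => apply: (@PT_const _ nat)
  | _ => pt_alg10
  end.
Ltac pt_alg ::= pt_alg11.

Lemma CT_guesses : exists t, CT t guesses.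
Proof.
have [[tb cb] /= Hb] : SIG (fun t c => PT t c gbound).
  by pt_start; apply: (@PT_ext _ _ _ _ _ _ (fun k => (k * k.+2 * 3).+3)) => //; pt.
have [tl Hl] := CT_lists.
have [[t1 c1] /= /CT_PT H1] : SIG (fun t c => PT t c (fun k : nat =>
    (prod2 (iota 0 (gbound k)) (prod2 (iota 0 (gbound k)) (iota 0 (gbound k))), k))).
  by pt_start; pt.
have [[t2 c2] /= /CT_PT H2] : SIG (fun t c => PT t c (fun k : nat => (iota 0 (gbound k), k))).
  by pt_start; pt.
have [[t3 c3] /= /CT_PT H3] : SIG (fun t c => PT t c (fun x : seq (seq nat) * nat =>
    (prod2 x.1 x.1, x.2))).
  by pt_start; pt.
have [[t4 c4] /= /CT_PT H4] : SIG (fun t c =>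
    PT t c (fun x : seq (seq (nat * (nat * nat))) * seq (seq (seq nat * seq nat)) =>
      prod2 x.1 x.2)).
  by pt_start; pt.
have H0 : CT Id (fun k : nat => k) by [].
have HT := CT_comp H1 (Hl _ _).
have HJ := CT_comp (CT_comp (CT_pair (CT_comp H2 (Hl _ _)) H0) H3) (Hl _ _).
by eexists; exact: (CT_comp (CT_pair HT HJ) H4).
Qed.

(** * The program *)

Lemma searchP M W (I : smc M W) s (gs : seq guess) :
  match search I s gs with
  | Some q => feas I q /\ forall g, g \in gs -> feas I (gen I s g) -> nblk I q <= nblk I (gen I s g)
  | None => forall g, g \in gs -> ~~ feas I (gen I s g)
  end.
Proof.
elim/last_ind: gs => // gs g; rewrite /search -cats1 foldl_cat /=.
case: (foldl _ _ _) => [b [h1 h2]|h] /=; rewrite /keep; case: ifP => Hg.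
- case: leqP => Hle; split=> // g'; rewrite mem_cat inE => /orP[Hg'|/eqP-> //] Hf.
    exact: h2.
  by apply: leq_trans (ltnW Hle) _; apply: h2.
- by split=> // g'; rewrite mem_cat inE => /orP[/h2 //|/eqP->]; rewrite Hg.
- split=> // g'; rewrite mem_cat inE => /orP[/h/negbTE-> //|/eqP-> //].
by move=> g'; rewrite mem_cat inE => /orP[/h //|/eqP->]; rewrite Hg.
Qed.

Lemma result_solution M W (I : smc M W) : DeltaW I <= 2 ->
  solution I (result (search I (base I) (guesses (param I (base I))))).
Proof.
move=> D2; have := searchP I (base I) (guesses (param I (base I))).
have K Y : feasible I Y -> exists2 g, g \in guesses (param I (base I)) &
    feas I (gen I (base I) g) /\ nblk I (gen I (base I) g) <= #|blocking_pairs I Y|.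
  move=> HY; have HM : matching I Y by case/and3P: HY.
  have [g [h1 h2 h3]] := guess_ex D2 (base_asn D2) (base_stable D2) (feasible_fea HM HY).
  by exists g; [exact: mem_guesses|rewrite (card_blocking D2 HM)].
case: (search _ _ _) => [q [/feasP Hq Hmin]|Hno] /=.
  have Hasn : asn I (get q) by case: Hq.
  split; first exact: pairs_uniq.
  split=> [|Y /K[g Hg [Hf Hle]]]; first exact: pairs_feasible.
  apply: leq_trans Hle; apply: leq_trans (Hmin g Hg Hf).
  by rewrite (card_blocking D2 (pairs_matching Hasn)) nblkE (nb_ext _ (pairs_mpartner Hasn)).
by move=> X; apply/negP => /K[g /Hno/negP H [/H]].
Qed.

Lemma computable_fn (f : nat -> nat) t : CT t f -> computable f.
Proof.
move=> H; exists (compile t 0) => n; exists (cost t (code_nat n)).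
by rewrite -[code_nat (f n)](H n); exact: exec_fn.
Qed.

Lemma CT_muln t1 t2 (f g : nat -> nat) : CT t1 f -> CT t2 g ->
  exists t, CT t (fun k : nat => f k * g k).
Proof.
move=> Hf Hg; have [[t c] /= /CT_PT H] : SIG (fun t c =>
    PT t c (fun x : nat * nat => x.1 * x.2)) by pt_start; pt.
by eexists; exact: (CT_comp (CT_pair Hf Hg) H).
Qed.

Lemma CT_expn t (f : nat -> nat) n : CT t f -> exists t', CT t' (fun k => f k ^ n).
Proof.
move=> H; elim: n => [|n [t' IHn]]; first by exists (fnk 1) => k; exact: sem_fnk.
have [t2 H2] := CT_muln H IHn; exists t2 => k; rewrite expnS; exact: H2.
Qed.

Lemma CT_exp2 t (f : nat -> nat) : CT t f -> exists t', CT t' (fun k => 2 ^ f k).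
Proof.
move=> H; have [[t0 c0] /= /CT_PT H0] : SIG (fun t c =>
    PT t c (fun p : nat * (nat * unit) => p.2.1 + p.2.1)) by pt_start; pt.
have H1 : CT (fnk 1) (fun k : nat => 1) by move=> k; exact: sem_fnk.
have Hu : CT t (fun k => nseq (f k) tt).
  move=> k; rewrite H; elim: (f k) => //= n IHn.
  by rewrite -[RHS]/(Node Leaf (enc (nseq n tt))) -IHn.
exists (Cmp (Fold t0) (Pr Id (Pr (fnk 1) t))) => k; rewrite (@CT_foldl _ _ _ _ _ _ _ _ _ (fun _ b (_ : unit) => b + b) _ _ H0 H1 Hu).
suff -> m n : foldl (fun b _ => b + b) m (nseq n tt) = m * 2 ^ n by rewrite mul1n.
by elim: n m => [|n IHn] m /=; rewrite ?muln1 // IHn addnn -muln2 expnS mulnA.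
Qed.

Lemma CT_addn t1 t2 (f g : nat -> nat) : CT t1 f -> CT t2 g ->
  CT (plus t1 t2) (fun k => f k + g k).
Proof. by move=> Hf Hg k; apply: sem_plus; [exact: Hf|exact: Hg]. Qed.

Lemma CT_cst n : CT (fnk n) (fun _ : nat => n).
Proof. by move=> k; exact: sem_fnk. Qed.

Theorem theorem11 :
  exists (f : nat -> nat) (c : nat) (P : program),
    computable f /\
    forall (M W : finType) (I : smc M W),
      DeltaW I <= 2 ->
      exists (o : option (seq (M * W))) (t : nat),
        [/\ exec P (code_smc I) (code_output o) t,
            solution I o
          & forall Ms : {set M * W}, stable I Ms ->
              t <= f (#|wstar0 I Ms| + #|mstar0 I Ms|)
                   * tree_size (code_smc I) ^ c].
Proof.
have [[tA cA] /= HA] : SIG (fun t c => forall M W, PT t c (fun I : smc M W => (I, base I))).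
  by pt_start; pt; exact: (proj2_sig PT_base _ _).
have [[tK cK] /= HK] : SIG (fun t c => forall M W,
    PT t c (fun I : smc M W => param I (base I))).
  pt_start; eapply (PT_use2 (f := fun I s => param I s) (proj2_sig PT_param _ _)); first by pt.
  exact: (proj2_sig PT_base _ _).
have [[tB cB] /= HB] : SIG (fun t c => forall M W,
    PT t c (fun x : (smc M W * asg M W) * seq guess => result (search x.1.1 x.1.2 x.2))).
  pt_start; eapply (PT_use2 (f := fun (I : smc M W) o => result o) (proj2_sig PT_result _ _)).
    by find_I.
  by eapply (PT_use3 (f := fun I s gs => search I s gs) (proj2_sig PT_search _ _)); pt.
have [tG HG] := CT_guesses.
have [tC HC] := cost_computable tG.
(* [G] is the time to list the guesses, and [H] bounds the size of the list by [sem_size]; [k.*2.+1]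
   is the tree size of the numeral [k]. *)
pose G k := cost tG (code_nat k); pose H k := (k.*2.+1 * 2 ^ G k).+1.
(* The 13 consists of 11 steps of glue and one unit each for [tA] and [tK]. The factor 2 absorbs the
   successor in [sz]. *)
exists (fun k => H k ^ cB + G k + 13), (2 * (cA + cK + cA * cB)), (compile (Cmp tB (Pr tA (Cmp tG tK))) 0).
split.
  have H1 : CT tC G by move=> k; exact: HC.
  have [t2 H2] := CT_exp2 H1.
  have H0 : CT Id (fun k : nat => k) by [].
  have [t3 H3] := CT_muln (CT_addn (CT_addn H0 H0) (CT_cst 1)) H2.
  have [t4 H4] := CT_expn cB (CT_addn H3 (CT_cst 1)).
  apply: (@computable_fn _ (plus (plus t4 tC) (fnk 13))) => k.
  rewrite (CT_addn (CT_addn H4 H1) (CT_cst 13)); congr (enc (_ ^ _ + _ + _)).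
  by rewrite /H addn1 addnn addn1.
move=> M W I D2; set k := param I (base I).
exists (result (search I (base I) (guesses k))), (cost (Cmp tB (Pr tA (Cmp tG tK))) (code_smc I)).
have [EA CA SA] := HA M W I; have [EK CK _] := HK M W I.
have [EB CB _] := HB M W (I, base I, guesses k).
have EG : sem tG (sem tK (enc I)) = enc (guesses k) by rewrite EK HG.
have EP : sem (Pr tA (Cmp tG tK)) (enc I) = enc (I, base I, guesses k).
  by rewrite -[LHS]/(Node (sem tA (enc I)) (sem tG (sem tK (enc I)))) EA EG.
split; last 1 first.
- move=> Ms HMs; rewrite -(param_stable D2 (proj1 (andP HMs)) HMs) -/k.
  have -> : cost (Cmp tB (Pr tA (Cmp tG tK))) (code_smc I) =
      cost tA (enc I) + (cost tK (enc I) + G k + 3) + 5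
      + cost tB (enc (I, base I, guesses k)) + 3.
    rewrite -[LHS]/(cost tA (enc I) + (cost tK (enc I) + cost tG (sem tK (enc I)) + 3) + 5
      + cost tB (sem (Pr tA (Cmp tG tK)) (enc I)) + 3).
    by rewrite EP EK.
  have Hs : 2 <= sz I by exact: sz_ge2.
  have Hg : sz (guesses k) <= H k.
    rewrite /sz ltnS -EG EK; apply: leq_trans (sem_size _ _) _.
    by rewrite leq_mul2r; apply/orP; right; have := sz_nat k; rewrite /sz => -[->].
  have Hx : sz (I, base I, guesses k) <= sz I ^ cA * H k.
    rewrite sz_pair; apply: leq_trans (leq_add SA Hg) _.
    have h1 : 2 <= sz I ^ cA by apply: leq_trans SA; exact: sz_ge2.
    have h2 : 2 <= H k by apply: leq_trans Hg; exact: sz_ge2.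
    by move: (sz I ^ cA) (H k) h1 h2 => i j; nia.
  have {}CB : cost tB (enc (I, base I, guesses k)) <= sz I ^ (cA * cB) * H k ^ cB.
    by apply: leq_trans CB _; rewrite expnM -expnMn; case: (cB) => // j; rewrite leq_exp2r.
  have Hn : sz I <= tree_size (code_smc I) ^ 2.
    rewrite /sz -/(enc I); have : 3 <= tree_size (enc I).
      rewrite enc_I -[tree_size _]/(tree_size (enc (rawM I)) + tree_size (enc (rawW I))).+1.
      by rewrite ltnS; apply: (@leq_add 1 1); exact: tree_size_gt0.
    by move: (tree_size _) => i; rewrite -mulnn; nia.
  set X := cA + cK + cA * cB.
  have HX j : j <= X -> sz I ^ j <= sz I ^ X by move=> Hj; rewrite leq_exp2l.
  have HnX : sz I ^ X <= tree_size (code_smc I) ^ (2 * X).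
    by rewrite expnM; case: (X) => // j; rewrite leq_exp2r.
  apply: (@leq_trans ((H k ^ cB + G k + 13) * sz I ^ X)); last by rewrite leq_mul2l HnX orbT.
  have h1 : cost tA (enc I) <= sz I ^ X by apply: leq_trans CA (HX _ _); rewrite /X; lia.
  have h2 : cost tK (enc I) <= sz I ^ X by apply: leq_trans CK (HX _ _); rewrite /X; lia.
  have h3 : sz I ^ (cA * cB) * H k ^ cB <= sz I ^ X * H k ^ cB.
    by rewrite leq_mul2r HX ?orbT // /X leq_addl.
  have h4 : 0 < sz I ^ X by rewrite expn_gt0 (leq_trans _ Hs).
  move: (leq_trans CB h3) h1 h2 h4; clear.
  move: (cost _ _) (cost _ _) (cost _ _) (sz I ^ X) (H k ^ cB) (G k) => a b c d e f; nia.
- have := exec_fn (Cmp tB (Pr tA (Cmp tG tK))) (code_smc I).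
  have -> // : sem (Cmp tB (Pr tA (Cmp tG tK))) (code_smc I)
    = code_output (result (search I (base I) (guesses k))).
  by rewrite -[LHS]/(sem tB (sem (Pr tA (Cmp tG tK)) (enc I))) EP EB; case: (result _).
- exact: result_solution.
Qed.
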